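(* Let $K$ be the simplicial complex on the vertex set $\{1,\dots,16\}$ whose $4$-simplices are the orbits of $(1\,2\,4\,5\,11)$ and $(1\,2\,4\,11\,13)$ under the permutation group $G$ generated by $T=(1\,2\,3\,4\,5\,10)(6\,8\,9)(11\,12\,13\,14\,15\,16)$ and $S=(2\,7)(4\,10)(5\,6)(11\,12)$. Then: (i) $K$ is a triangulation of $\mathbb{R}P^4$ with $16$ vertices; (ii) $G\cong S_6$ has order $720$ and acts on the vertices with the two orbits $\{1,\dots,10\}$ and $\{11,\dots,16\}$; (iii) the two generating $4$-simplices have orbits of length $30$ and $120$ respectively; (iv) $K$ is $2$-neighbourly, with $f$-vector $(16,120,330,375,150)$; (v) the universal covering of $K$ is isomorphic to the boundary complex of a spherical, centrally symmetric convex $5$-polytope $P$ with $32$ vertices, which realises the full automorphism group $S_6\times C_2$ by Euclidean symmetries.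
   Context: A triangulation is $2$-neighbourly if every pair of vertices spans an edge. A polytope is spherical if its vertices lie on a sphere centred at its centre. A polytope is centrally symmetric if it is invariant under $x\mapsto -x$. *)

(* Defs.v *)
From HB Require Import structures.
From mathcomp Require Import all_boot all_order all_algebra all_fingroup.
From mathcomp Require Import all_solvable generic_quotient.
From mathcomp Require Import all_classical all_reals all_analysis.

Set Implicit Arguments.
Unset Strict Implicit.
Unset Printing Implicit Defensive.

Import Order.TTheory GRing.Theory Num.Theory.
Import numFieldNormedType.Exports.

Local Open Scope classical_set_scope.
Local Open Scope ring_scope.

(** * Abstract simplicial complexes on the vertex set ['I_n] *)

(* The empty simplex is a face; every element of ['I_n] is a vertex. *)
Definition simplicial_complex n (K : {set {set 'I_n}}) : Prop :=
  (forall s t : {set 'I_n}, s \in K -> t \subset s -> t \in K) /\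
  (forall i : 'I_n, [set i]%SET \in K).

Definition complex_iso m n (L : {set {set 'I_m}}) (K : {set {set 'I_n}}) :=
  exists2 f : 'I_m -> 'I_n,
    bijective f & forall s : {set 'I_m}, (f @: s \in K)%SET = (s \in L).

(* [fvec K k] is the number of k-dimensional faces. *)
Definition fvec n (K : {set {set 'I_n}}) (k : nat) : nat :=
  #|[set s in K | #|s| == k.+1]%SET|.

Definition two_neighbourly n (K : {set {set 'I_n}}) : Prop :=
  forall i j : 'I_n, i != j -> [set i; j]%SET \in K.

Definition aut_complex n (K : {set {set 'I_n}}) : {group 'S_n} :=
  'N(K | 'P^*)%G.

(** * Topology *)

Definition homeomorphic (X Y : topologicalType) : Prop :=
  exists f : X -> Y, exists g : Y -> X,
    [/\ continuous f, continuous g, cancel f g & cancel g f].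

Definition realization (R : realType) n (K : {set {set 'I_n}}) :
    set 'rV[R]_n :=
  [set x | [/\ forall i, 0 <= x 0 i, \sum_i x 0 i = 1
             & [set i | x 0 i != 0]%SET \in K]].
Arguments realization R {n} K.

Definition triangulates (R : realType) n (K : {set {set 'I_n}})
    (X : topologicalType) : Prop :=
  simplicial_complex K /\ homeomorphic (realization R K) X.

Section EuclideanSpace.
Variables (R : realType) (n : nat).

Definition dotv (x y : 'rV[R]_n) : R := \sum_i x 0 i * y 0 i.

(* The library norm [`|x|] on ['rV[R]_n] is the sup norm. *)
Definition enorm (x : 'rV[R]_n) : R := Num.sqrt (dotv x x).

End EuclideanSpace.

Definition sphere (R : realType) n : set 'rV[R]_n.+1 :=
  [set x | enorm x = 1].
Arguments sphere R n : clear implicits.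

Section RealProjectiveSpace.
Variables (R : realType) (n : nat).

Definition antipodal (x y : sphere R n) : bool :=
  (val x == val y) || (val x == - val y).

Lemma antipodal_equiv : equiv_class_of antipodal.
Proof.
split=> [x|x y|y x z]; rewrite /antipodal ?eqxx//.
  by rewrite eq_sym [val x == - _]eq_sym eqr_oppLR.
by case/orP=> /eqP xy /orP[] /eqP yz; rewrite xy yz ?opprK ?eqxx ?orbT.
Qed.

Canonical antipodal_equiv_rel := EquivRelPack antipodal_equiv.

Definition RP : topologicalType :=
  quotient_topology {eq_quot antipodal_equiv_rel}%qT.

End RealProjectiveSpace.

Definition covering_map (X Y : topologicalType) (p : X -> Y) : Prop :=
  [/\ continuous p, range p = setT
    & forall y : Y, exists U : set Y, [/\ open U, U y
      & exists W : set (set X),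
        [/\ (forall V, W V -> open V),
            trivIset W id,
            p @^-1` U = \bigcup_(V in W) V
          & forall V, W V -> exists g : Y -> X,
              [/\ {within U, continuous g},
                  forall z, U z -> V (g z) /\ p (g z) = z
                & forall x, V x -> g (p x) = x]]]].

Definition path_connected (R : realType) (X : topologicalType) : Prop :=
  forall x y : X, exists c : R -> X,
    [/\ {within `[0, 1], continuous c}, c 0 = x & c 1 = y].

Definition simply_connected (R : realType) (X : topologicalType) : Prop :=
  [/\ [set: X] !=set0, path_connected R X
    & forall c : R -> X, {within `[0, 1], continuous c} -> c 0 = c 1 ->
      exists H : R * R -> X,
        [/\ {within `[0, 1] `*` `[0, 1], continuous H},
            forall t, t \in `[0, 1] -> H (0, t) = c t,
            forall t, t \in `[0, 1] -> H (1, t) = c 0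
          & forall s, s \in `[0, 1] -> H (s, 0) = c 0 /\ H (s, 1) = c 0]].

(* Affine extension of a vertex map, in barycentric coordinates. *)
Definition realization_map (R : realType) m n (p : 'I_m -> 'I_n)
    (x : 'rV[R]_m) : 'rV[R]_n :=
  \row_j \sum_(i | p i == j) x 0 i.

Definition universal_covering (R : realType) m n (L : {set {set 'I_m}})
    (K : {set {set 'I_n}}) (p : 'I_m -> 'I_n) : Prop :=
  [/\ simplicial_complex L,
      (forall s : {set 'I_m}, s \in L -> (p @: s)%SET \in K),
      simply_connected R (realization R L)
    & exists2 f : realization R L -> realization R K,
        forall x, val (f x) = realization_map p (val x) & covering_map f].

(** * Convex polytopes *)

Section Polytopes.
Variables (R : realType) (n : nat).
Implicit Types (A P F : set 'rV[R]_n) (x c : 'rV[R]_n).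

Definition convex_hull A : set 'rV[R]_n :=
  \bigcap_(C in [set C | convex_set C /\ A `<=` C]) C.

Definition polytope P : Prop := exists2 A, finite_set A & P = convex_hull A.

Definition affinely_independent d (q : 'I_d.+1 -> 'rV[R]_n) : Prop :=
  row_free (\matrix_(i < d) (q (lift ord0 i) - q ord0)).

Definition contains_independent d P : Prop :=
  exists2 q : 'I_d.+1 -> 'rV[R]_n, forall i, P (q i) & affinely_independent q.

Definition affine_dimension P d : Prop :=
  contains_independent d P /\
  ~ contains_independent d.+1 P.

(* [c = 0] gives the improper face [P] and the empty face. *)
Definition face P F : Prop :=
  exists (c : 'rV[R]_n) (b : R),
    (forall x, P x -> dotv c x <= b) /\ F = P `&` [set x | dotv c x = b].

Definition proper_face P F : Prop := face P F /\ F <> P.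

Definition vertices P : set 'rV[R]_n := [set x | face P [set x]].

(* The vertex sets of the proper faces of [P], its vertices being labelled
   by [v].  When this is isomorphic to a simplicial complex, [P] is
   simplicial. *)
Definition boundary_complex P m (v : 'I_m -> 'rV[R]_n) : {set {set 'I_m}} :=
  [set s : {set 'I_m} |
    `[< exists2 F, proper_face P F & s = [set i | v i \in F]%SET >]]%SET.

Definition centrally_symmetric P : Prop := -%R @` P = P.

Definition centre P c : Prop := forall x, P x -> P (c *+ 2 - x).

Definition spherical P : Prop :=
  exists c (r : R), [/\ centre P c, 0 < r
    & forall x, vertices P x -> enorm (x - c) = r].

Definition euclidean_symmetry P (f : 'rV[R]_n -> 'rV[R]_n) : Prop :=
  (forall x y, enorm (f x - f y) = enorm (x - y)) /\ f @` P = P.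

End Polytopes.

(** * The complex on 16 vertices *)

(* The vertices 1, ..., 16 are the elements 0, ..., 15 of ['I_16]. *)
Definition lab (k : nat) : 'I_16 := inord k.-1.

Definition cyc (s : seq nat) : 'S_16 :=
  insubd (perm_one 'I_16) [ffun i => next (map lab s) i].

Lemma cycE (s : seq nat) : uniq (map lab s) -> cyc s =1 next (map lab s).
Proof.
move=> us i; rewrite /cyc /insubd insubT => [|inj_s].
  by apply/injectiveP => x y; rewrite !ffunE; apply: can_inj (prev_next us) _ _.
by rewrite -pvalE SubK ffunE.
Qed.

Definition permT : 'S_16 :=
  (cyc [:: 1; 2; 3; 4; 5; 10]%N * cyc [:: 6; 8; 9]%N
   * cyc [:: 11; 12; 13; 14; 15; 16]%N)%g.

Definition permS : 'S_16 :=
  (cyc [:: 2; 7]%N * cyc [:: 4; 10]%N * cyc [:: 5; 6]%N * cyc [:: 11; 12]%N)%g.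

Definition G16 : {group 'S_16} := <<[set permT; permS]%SET>>%G.

Definition simplex (s : seq nat) : {set 'I_16} := [set x in map lab s]%SET.

Definition simplex1 := simplex [:: 1; 2; 4; 5; 11]%N.
Definition simplex2 := simplex [:: 1; 2; 4; 11; 13]%N.

Definition simplex_orbit (F : {set 'I_16}) : {set {set 'I_16}} :=
  orbit 'P^* G16 F.

Definition K16 : {set {set 'I_16}} :=
  [set s : {set 'I_16} |
    [exists F in simplex_orbit simplex1 :|: simplex_orbit simplex2,
      s \subset F]]%SET.

(* Main.v *)
Require Import Defs.
From HB Require Import structures.
From mathcomp Require Import all_boot all_order all_algebra all_fingroup.
From mathcomp Require Import all_solvable generic_quotient.
From mathcomp Require Import all_classical all_reals all_analysis.
From mathcomp Require Import ring lra.

Set Implicit Arguments.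
Unset Strict Implicit.
Unset Printing Implicit Defensive.

Import Order.TTheory GRing.Theory Num.Theory.
Import numFieldNormedType.Exports.

Local Open Scope classical_set_scope.
Local Open Scope ring_scope.

(* The 32 vertices of the polytope are indexed by the subsets A of odd size of
   {1, ..., 6}: on the hyperplane of sum zero in R^6, A gives the projection of
   e_A - e_{A^c}, scaled by 3/sqrt 5 when A has size 1 or 5 so that all vertices
   have the same norm.  S_6 permutes the coordinates, and the antipodal map is
   complementation.  There are 300 facet functionals in Q(sqrt 5), and finite
   computations show that each is maximal at exactly five vertices and that every
   ridge lies in a second facet.  This local information suffices: a vector y lies
   in the cone over the facet whose functional is largest at y, because crossing
   the ridge opposite to a negative coordinate would increase the value.  Hence
   the cones over the facets form a complete simplicial fan, which gives the face
   lattice of the polytope and a radial homeomorphism from the boundary complex to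
   the 4-sphere.  Two vertices of a common face form an acute angle, so a face of
   the quotient by the antipodal map has exactly two lifts; the quotient is K16,
   it is homeomorphic to RP^4, and the projection is a double covering.  The
   4-sphere is simply connected because a loop can be deformed to a piecewise
   linear one, which misses a point.
   An automorphism of the boundary complex preserves the vertices of size 1 and 5,
   which lie on 45 facets while the others lie on 48; it acts on them through
   S_6 x C_2 and is determined by this action. *)

(** The model is dictated by the group: [T] and [S] have the cycle types of a six-cycle and a
    transposition acting on the ten splittings of six points into 3 + 3 and on the six points
    themselves. A splitting is an antipodal pair of 3-sets, a point is a pair formed by [{i}] and
    its complement, and [proj_table] is the labelling that makes this identification equivariant.
    The factor 3/sqrt 5 comes from the square norms of the projected sign vectors, 6 for size 3 and
    10/3 for sizes 1 and 5, whose ratio is 9/5. Up to sign the functionals form families of 30 and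
    120 members, the lengths of the two orbits of simplices. Geometry and combinatorics meet only in
    the conditions of [facet_system] and a few facts on antipodes and angles. They reduce to
    statements on lists of numbers below 32, with signs in Q(sqrt 5) certified by rational bounds.
    The hyperplane of sum zero is carried to 5-space by an explicit isometry, so that norms and
    symmetries can be computed in the six symmetric coordinates. *)

Section DotProduct.
Variables (R : realType) (n : nat).
Implicit Types (x y z : 'rV[R]_n) (a : R).

Lemma dotvC x y : dotv x y = dotv y x.
Proof. by apply: eq_bigr => i _; rewrite mulrC. Qed.

Lemma dotvDl x y z : dotv (x + y) z = dotv x z + dotv y z.
Proof. by rewrite -big_split; apply: eq_bigr => i _; rewrite mxE mulrDl. Qed.

Lemma dotvZl a x y : dotv (a *: x) y = a * dotv x y.
Proof. by rewrite mulr_sumr; apply: eq_bigr => i _; rewrite mxE mulrA. Qed.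

Lemma dotvNl x y : dotv (- x) y = - dotv x y.
Proof. by rewrite -scaleN1r dotvZl mulN1r. Qed.

Lemma dotv0l y : dotv 0 y = 0.
Proof. by apply: big1 => i _; rewrite mxE mul0r. Qed.

Lemma dotvDr x y z : dotv x (y + z) = dotv x y + dotv x z.
Proof. by rewrite dotvC dotvDl !(dotvC x). Qed.

Lemma dotvZr a x y : dotv x (a *: y) = a * dotv x y.
Proof. by rewrite dotvC dotvZl (dotvC x). Qed.

Lemma dotvNr x y : dotv x (- y) = - dotv x y.
Proof. by rewrite dotvC dotvNl dotvC. Qed.

Lemma dotv0r x : dotv x 0 = 0.
Proof. by rewrite dotvC dotv0l. Qed.

Lemma dotv_sumr (I : Type) (r : seq I) (P : pred I) (F : I -> 'rV[R]_n) x :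
  dotv x (\sum_(i <- r | P i) F i) = \sum_(i <- r | P i) dotv x (F i).
Proof. by apply: (big_morph (dotv x)) => [y z|]; rewrite ?dotvDr ?dotv0r. Qed.

Lemma dotv_suml (I : Type) (r : seq I) (P : pred I) (F : I -> 'rV[R]_n) x :
  dotv (\sum_(i <- r | P i) F i) x = \sum_(i <- r | P i) dotv (F i) x.
Proof. by rewrite dotvC dotv_sumr; apply: eq_bigr => i _; rewrite dotvC. Qed.

Lemma dotvv_ge0 x : 0 <= dotv x x.
Proof. by apply: sumr_ge0 => i _; rewrite -expr2 sqr_ge0. Qed.

Lemma dotvv_eq0 x : (dotv x x == 0) = (x == 0).
Proof.
apply/eqP/eqP => [/eqP|->]; last exact: dotv0l.
rewrite psumr_eq0 => [/allP x0|i _]; last by rewrite -expr2 sqr_ge0.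
apply/rowP => i; rewrite mxE; apply/eqP.
by have := x0 i; rewrite mem_index_enum mulf_eq0 orbb; apply.
Qed.

Lemma dotvv_gt0 x : (0 < dotv x x) = (x != 0).
Proof. by rewrite lt_neqAle dotvv_ge0 andbT eq_sym dotvv_eq0. Qed.

Lemma enorm_eq1 x : (enorm x = 1) <-> (dotv x x = 1).
Proof.
split=> [x1|x1]; last by rewrite /enorm x1 sqrtr1.
by rewrite -(sqr_sqrtr (dotvv_ge0 x)) -/(enorm x) x1 expr1n.
Qed.

End DotProduct.

Lemma convex_setP (R : realType) n (A : set 'rV[R]_n) : convex_set A <->
  forall x y (l : R), A x -> A y -> 0 <= l -> l <= 1 -> A (l *: x + (1 - l) *: y).
Proof.
split=> [cA x y l Ax Ay l0 l1|cA x y l Ax Ay].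
  exact: (set_mem (cA x y (Itv01 l0 l1) (mem_set Ax) (mem_set Ay))).
apply/mem_set/cA; [exact: set_mem Ax|exact: set_mem Ay|exact: ge0|exact: le1].
Qed.

(** * Polytopes given by vertices and facet functionals *)

Section FacetSystem.
Variables (R : realType) (n m : nat) (J : finType).
Variables (v : 'I_m -> 'rV[R]_n) (c : J -> 'rV[R]_n).

Definition facet_of (j : J) : {set 'I_m} := [set i | dotv (c j) (v i) == 1]%SET.

Definition facet_complex : {set {set 'I_m}} :=
  [set s : {set 'I_m} | [exists j, s \subset facet_of j]]%SET.

(** The ridge clause carries the weight: it yields both the linear independence of the vertices of a
    facet and the completeness of the list of facets. *)
Definition facet_system :=
  [/\ forall j i, dotv (c j) (v i) <= 1,
      forall j, #|facet_of j| = n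
    & forall j i, i \in facet_of j -> exists2 j',
        facet_of j :\ i \subset facet_of j' & i \notin facet_of j'].

Definition lincomb (a : 'I_m -> R) : 'rV[R]_n := \sum_i a i *: v i.

Lemma dotv_lincomb a x : dotv x (lincomb a) = \sum_i a i * dotv x (v i).
Proof. by rewrite dotv_sumr; apply: eq_bigr => i _; rewrite dotvZr. Qed.

Lemma lincombZ k a : lincomb (fun i => k * a i) = k *: lincomb a.
Proof. by rewrite scaler_sumr; apply: eq_bigr => i _; rewrite scalerA. Qed.

Definition cone_coord (j : J) (a : 'I_m -> R) :=
  (forall i, 0 <= a i) /\ (forall i, i \notin facet_of j -> a i = 0).

Hypothesis sys : facet_system.
Let c_le1 : forall j i, dotv (c j) (v i) <= 1. Proof. by case: sys. Qed.
Let card_facet : forall j, #|facet_of j| = n. Proof. by case: sys. Qed.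

Lemma facet_ridge j i : i \in facet_of j -> exists2 j',
  facet_of j :\ i \subset facet_of j' & i \notin facet_of j'.
Proof. by case: sys => _ _; apply. Qed.

Lemma in_facet j i : i \in facet_of j -> dotv (c j) (v i) = 1.
Proof. by rewrite inE => /eqP. Qed.

Lemma out_facet j i : i \notin facet_of j -> dotv (c j) (v i) < 1.
Proof. by rewrite inE lt_neqAle => ->; rewrite c_le1. Qed.

Lemma dotv_facet j (a : 'I_m -> R) : (forall i, i \notin facet_of j -> a i = 0) ->
  dotv (c j) (lincomb a) = \sum_i a i.
Proof.
move=> a0; rewrite dotv_lincomb; apply: eq_bigr => i _.
by case: (boolP (i \in facet_of j)) => [/in_facet->|/a0->];
  rewrite ?mulr1 ?mul0r.
Qed.

(* Up to a positive factor, the difference of the functionals of two facets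
   that meet in a ridge is the coordinate form of the vertex off the ridge. *)
Lemma facet_free j (a : 'I_m -> R) : (forall i, i \notin facet_of j -> a i = 0) ->
  lincomb a = 0 -> forall i, a i = 0.
Proof.
move=> a0 a_eq0 i; case: (boolP (i \in facet_of j)) => [ij|]; last exact: a0.
have [j' /fintype.subsetP sub ij'] := facet_ridge ij.
have := dotv_lincomb a (c j - c j'); rewrite a_eq0 dotv0r (bigD1 i)//=.
rewrite big1 => [/esym/eqP|k ki].
  rewrite addr0 mulf_eq0 => /orP[/eqP//|].
  rewrite dotvDl dotvNl (in_facet ij) subr_eq0 => /eqP ne.
  by have := out_facet ij'; rewrite -ne ltxx.
case: (boolP (k \in facet_of j)) => [kj|/a0->]; last by rewrite mul0r.
have kj' : k \in facet_of j' by apply: sub; rewrite finset.in_setD1 ki.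
by rewrite dotvDl dotvNl (in_facet kj) (in_facet kj') subrr mulr0.
Qed.

(** The vertices of a facet are independent by [facet_free] and there are exactly [n] of them, so
    they form a basis. *)
Lemma facet_span j y : exists2 a : 'I_m -> R,
  (forall i, i \notin facet_of j -> a i = 0) & y = lincomb a.
Proof.
pose A : 'M[R]_(#|facet_of j|, n) := \matrix_k v (enum_val k).
pose ext (u : 'rV[R]_#|facet_of j|) (i : 'I_m) : R :=
  \sum_(k | enum_val k == i) u 0 k.
have ext0 u i : i \notin facet_of j -> ext u i = 0.
  move=> ij; apply: big_pred0 => k; apply/eqP => ki.
  by rewrite -ki enum_valP in ij.
have extE u k : ext u (enum_val k) = u 0 k.
  by rewrite /ext (big_pred1 k)// => l; apply/eqP/eqP => [/enum_val_inj|->].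
have extA u : u *m A = lincomb (ext u).
  rewrite mulmx_sum_row /lincomb.
  transitivity (\sum_(i in facet_of j) ext u i *: v i).
    rewrite [RHS]big_enum_val /=; apply: eq_bigr => k _.
    by rewrite extE rowK.
  by rewrite big_mkcond; apply: eq_bigr => i _; case: ifPn => // /ext0->;
    rewrite scale0r.
have freeA : row_free A.
  apply: inj_row_free => u; rewrite extA => /(facet_free (ext0 u)) u0.
  by apply/rowP => k; rewrite -extE u0 mxE.
have fullA : row_full A by rewrite /row_full (eqP freeA) card_facet.
have /submxP[u yE] := submx_full y fullA.
by exists (ext u); [exact: ext0 | rewrite yE extA].
Qed.

(* The facet whose functional is largest at [y] works: crossing the ridge
   opposite to a vertex with a negative coordinate would increase the value. *)
Lemma cone_cover (j0 : J) y : exists j (a : 'I_m -> R),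
  cone_coord j a /\ y = lincomb a.
Proof.
case: (@Order.TotalTheory.arg_maxP _ _ J j0 xpredT (fun j => dotv (c j) y) isT).
move=> j _ jmax; have [a a0 yE] := facet_span j y.
exists j, a; split=> //; split=> // i; rewrite leNgt; apply/negP => ai_lt0.
have ij : i \in facet_of j by apply: contraTT ai_lt0 => /a0->; rewrite ltxx.
have [j' /fintype.subsetP sub ij'] := facet_ridge ij.
have := jmax j' isT; rewrite /= leNgt => /negP; apply.
rewrite -subr_gt0 -dotvNl -dotvDl yE dotv_lincomb (bigD1 i)//= big1.
  rewrite addr0 nmulr_rgt0// dotvDl dotvNl (in_facet ij) subr_lt0.
  exact: out_facet.
move=> k ki; case: (boolP (k \in facet_of j)) => [kj|/a0->]; last by rewrite mul0r.
have kj' : k \in facet_of j' by apply: sub; rewrite finset.in_setD1 ki.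
by rewrite dotvDl dotvNl (in_facet kj) (in_facet kj') subrr mulr0.
Qed.

Lemma dotv_lincomb_le j (a : 'I_m -> R) : (forall i, 0 <= a i) ->
  dotv (c j) (lincomb a) <= \sum_i a i.
Proof.
by move=> a_ge0; rewrite dotv_lincomb; apply: ler_sum => i _; rewrite ler_piMr.
Qed.

(** Equality makes a weighted sum of the nonnegative slacks [1 - dotv (c j) (v i)] vanish, and off
    the facet the slack is positive. *)
Lemma dotv_lincomb_eq j (a : 'I_m -> R) : (forall i, 0 <= a i) ->
  dotv (c j) (lincomb a) = \sum_i a i -> forall i, i \notin facet_of j -> a i = 0.
Proof.
move=> a_ge0; rewrite dotv_lincomb => /esym/eqP.
rewrite -subr_eq0 -sumrB psumr_eq0 => [/allP a0 i ij|i _]; last first.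
  by rewrite subr_ge0 ler_piMr.
have := a0 i; rewrite mem_index_enum -{1}[a i]mulr1 -mulrBr mulf_eq0 => /(_ isT).
by case/orP => [/eqP//|]; rewrite subr_eq0 => /eqP e; move: (out_facet ij);
  rewrite -e ltxx.
Qed.

(** The functional of either facet computes the total weight in its own cone and bounds it from
    below in the other one. So the total weights agree, the equality case puts [b] on the facet [j]
    as well, and independence concludes. *)
Lemma cone_coord_uniq j j' a b : cone_coord j a -> cone_coord j' b ->
  lincomb a = lincomb b -> a =1 b.
Proof.
move=> [a_ge0 a0] [b_ge0 b0] ab.
have le_ab : \sum_i a i <= \sum_i b i.
  by rewrite -(dotv_facet a0) ab dotv_lincomb_le.
have le_ba : \sum_i b i <= \sum_i a i.
  by rewrite -(dotv_facet b0) -ab dotv_lincomb_le.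
have sum_ab : \sum_i a i = \sum_i b i by apply/eqP; rewrite eq_le le_ab.
have b0' i : i \notin facet_of j -> b i = 0.
  by apply: (dotv_lincomb_eq b_ge0); rewrite -ab dotv_facet.
move=> i; apply/eqP; rewrite -subr_eq0; apply/eqP.
apply: (@facet_free j (fun i => a i - b i)) => [k kj|].
  by rewrite a0 ?b0' ?subrr.
rewrite /lincomb (eq_bigr (fun i => a i *: v i - b i *: v i)) => [|k _].
  by rewrite sumrB; apply/eqP; rewrite subr_eq0; apply/eqP.
by rewrite scalerBl.
Qed.

Lemma facet_complexP (s : {set 'I_m}) :
  reflect (exists j, s \subset facet_of j) (s \in facet_complex).
Proof. by rewrite inE; apply: existsP. Qed.

Lemma facet_complexS (s t : {set 'I_m}) :
  s \in facet_complex -> t \subset s -> t \in facet_complex.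
Proof.
by move=> /facet_complexP[j sj] ts; apply/facet_complexP; exists j;
  apply: (fintype.subset_trans ts sj).
Qed.

Variables (opp : 'I_m -> 'I_m) (j0 : J).
Hypothesis v_opp : forall i, v (opp i) = - v i.

Definition facet_polytope : set 'rV[R]_n := convex_hull (range v).

Lemma convex_hull_lincomb (a : 'I_m -> R) : (forall i, 0 <= a i) ->
  \sum_i a i = 1 -> facet_polytope (lincomb a).
Proof.
move=> a_ge0 a1 C /= [/convex_setP C_conv vC].
(* partial sums, normalized by their weight *)
pose P (s : seq 'I_m) := forall S, S = \sum_(i <- s) a i -> 0 < S ->
  C (S^-1 *: \sum_(i <- s) a i *: v i).
suff PP s : P s.
  by have := PP (index_enum 'I_m) 1; rewrite a1 invr1 scale1r => /(_ erefl ltr01).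
elim: s => [S ->|i s IH S]; first by rewrite big_nil ltxx.
rewrite !big_cons; set S' := \sum_(i <- s) a i => -> S_gt0.
have S'_ge0 : 0 <= S' by apply: sumr_ge0.
have [S'0|S'n0] := eqVneq S' 0.
  have ai_gt0 : 0 < a i by move: S_gt0; rewrite S'0 addr0.
  rewrite S'0 addr0 [X in _ + X](_ : _ = 0) ?addr0.
    by rewrite scalerA mulVf ?gt_eqF// scale1r; apply: vC; exists i.
  apply: big1_seq => k /= ks.
  have /eqP := S'0; rewrite psumr_eq0// => /allP/(_ _ ks)/eqP->.
  by rewrite scale0r.
have S'_gt0 : 0 < S' by rewrite lt_neqAle eq_sym S'n0.
have [ai0|ain0] := eqVneq (a i) 0; first by rewrite ai0 scale0r !add0r; apply: IH.
have ai_gt0 : 0 < a i by rewrite lt_neqAle eq_sym ain0 a_ge0.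
have := C_conv _ _ (a i / (a i + S')) (vC _ (ex_intro2 _ _ i Logic.I erefl))
  (IH _ erefl S'_gt0).
rewrite divr_ge0 ?(ltW S_gt0)// ler_pdivrMr// mul1r lerDl => /(_ isT S'_ge0).
congr (C _); rewrite scalerDr !scalerA [(_ + S')^-1 * a i]mulrC.
congr (_ + _ *: _); rewrite -/S'; field.
by rewrite !gt_eqF.
Qed.

Lemma lincombD a b : lincomb (fun i => a i + b i) = lincomb a + lincomb b.
Proof. by rewrite -big_split; apply: eq_bigr => i _; rewrite scalerDl. Qed.

Lemma lincomb_delta i : lincomb (fun k => (k == i)%:R) = v i.
Proof.
rewrite /lincomb (bigD1 i)//= eqxx scale1r big1 ?addr0// => k /negPf->.
by rewrite scale0r.
Qed.

Lemma sum_delta (i : 'I_m) : \sum_k (k == i)%:R = 1 :> R.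
Proof.
by rewrite (bigD1 i)//= eqxx big1 ?addr0// => k /negPf->.
Qed.

Hypothesis n_gt0 : (0 < n)%N.

(** The missing weight is shared equally by a vertex and its opposite, which contributes zero to the
    combination. *)
Lemma facet_polytope_lincomb (a : 'I_m -> R) : (forall i, 0 <= a i) ->
  \sum_i a i <= 1 -> facet_polytope (lincomb a).
Proof.
move=> a_ge0; set S := \sum_i a i => S_le1.
have : (0 < #|facet_of j0|)%N by rewrite card_facet.
case/card_gt0P => k _.
pose b (i : 'I_m) : R := (1 - S) / 2 * ((i == k)%:R + (i == opp k)%:R).
have b_ge0 i : 0 <= b i by rewrite mulr_ge0// ?divr_ge0 ?subr_ge0// addr_ge0.
have b0 : lincomb b = 0.
  by rewrite lincombZ lincombD !lincomb_delta v_opp subrr scaler0.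
rewrite -[lincomb a]addr0 -b0 -lincombD.
apply: convex_hull_lincomb => [i|]; first by rewrite addr_ge0.
rewrite big_split /= -/S /b -mulr_sumr big_split /= !sum_delta.
by field.
Qed.

(** For the converse, [y] lies in the cone over some facet [j], where its total weight is
    [dotv (c j) y], hence at most 1. *)
Lemma facet_polytopeP y : facet_polytope y <-> forall j, dotv (c j) y <= 1.
Proof.
split=> [yP j|yP].
  apply: (yP [set y | dotv (c j) y <= 1]); split=> [|_ [i _ <-]]; last exact: c_le1.
  apply/convex_setP => x z l; rewrite /= => x1 z1 l0 l1.
  rewrite dotvDr !dotvZr /=.
  rewrite [leRHS](_ : 1 = l * 1 + (1 - l) * 1); last by ring.
  by rewrite lerD// ler_wpM2l// subr_ge0.
have [j [a [[a_ge0 a0] yE]]] := cone_cover j0 y; rewrite yE.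
by apply: facet_polytope_lincomb => //; rewrite -(dotv_facet a0) -yE.
Qed.

Lemma facet_polytope_v i : facet_polytope (v i).
Proof. by apply/facet_polytopeP => j; apply: c_le1. Qed.

Lemma facet_polytope_polytope : polytope facet_polytope.
Proof. by exists (range v) => //; apply: finite_image. Qed.

Lemma facet_polytope_opp x : facet_polytope x -> facet_polytope (- x).
Proof.
move=> xP; have [j [a [[a_ge0 a0] xE]]] := cone_cover j0 x.
have -> : - x = lincomb (fun i => \sum_(k | opp k == i) a k).
  rewrite xE /lincomb -sumrN (partition_big opp xpredT)//=.
  apply: eq_bigr => i _; rewrite scaler_suml; apply: eq_bigr => k /eqP<-.
  by rewrite v_opp scalerN.
apply: facet_polytope_lincomb => [i|]; first by apply: sumr_ge0.
have := partition_big opp xpredT (F := a) (P := xpredT) (fun _ _ => isT).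
move=> /= <-; rewrite -(dotv_facet a0) -xE.
by move/facet_polytopeP: xP.
Qed.

Lemma facet_polytope_symmetric : centrally_symmetric facet_polytope.
Proof.
apply/seteqP; split=> [_ [x xP <-]|x xP]; first exact: facet_polytope_opp.
by exists (- x); [exact: facet_polytope_opp|rewrite opprK].
Qed.

Lemma centre_facet_polytope : centre facet_polytope 0.
Proof. by move=> x xP; rewrite mul0rn add0r; apply: facet_polytope_opp. Qed.

Lemma facet_span_v x : (forall i, dotv x (v i) = 0) -> x = 0.
Proof.
move=> x0; apply/eqP; rewrite -dotvv_eq0; have [a _ xE] := facet_span j0 x.
by rewrite {2}xE dotv_lincomb big1// => i _; rewrite x0 mulr0.
Qed.

(** By central symmetry a bound [b <= 0] forces [d] to vanish at every vertex, and the vertices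
    span. *)
Lemma face_bound_gt0 d b : (forall x, facet_polytope x -> dotv d x <= b) ->
  d != 0 -> 0 < b.
Proof.
move=> dP; apply: contraNT; rewrite -leNgt => b_le0.
apply/eqP/facet_span_v => i; apply/eqP; rewrite eq_le.
rewrite (le_trans (dP _ (facet_polytope_v i)) b_le0) /=.
rewrite -oppr_le0 -dotvNr -v_opp.
exact: (le_trans (dP _ (facet_polytope_v _)) b_le0).
Qed.

(** Each vertex value is at most [b > 0] and the total weight is at most 1, so the value [b] is
    reached only if no weight is missing and no vertex with nonzero weight lies below [b]. *)
Lemma face_lincomb d b (a : 'I_m -> R) :
  (forall x, facet_polytope x -> dotv d x <= b) -> 0 < b ->
  (forall i, 0 <= a i) -> \sum_i a i <= 1 -> dotv d (lincomb a) = b ->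
  \sum_i a i = 1 /\ forall i, a i != 0 -> dotv d (v i) = b.
Proof.
move=> dP b_gt0 a_ge0 a_le1 db.
have dv i : dotv d (v i) <= b by apply: dP; apply: facet_polytope_v.
have sum1 : \sum_i a i = 1.
  apply/eqP; rewrite eq_le a_le1 /= -(ler_pM2r b_gt0) mul1r -{1}db.
  by rewrite dotv_lincomb mulr_suml; apply: ler_sum => i _; rewrite ler_wpM2l.
split=> // i ai0.
have /eqP : \sum_i a i * (b - dotv d (v i)) = 0.
  under eq_bigr do rewrite mulrBr.
  by rewrite sumrB -dotv_lincomb db -mulr_suml sum1 mul1r subrr.
rewrite psumr_eq0 => [/allP/(_ i)|k _]; last by rewrite mulr_ge0// subr_ge0.
rewrite mem_index_enum mulf_eq0 (negPf ai0) subr_eq0 => /(_ isT)/eqP.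
by move=> ->.
Qed.

Lemma polytope_lincomb x : facet_polytope x -> exists j (a : 'I_m -> R),
  [/\ cone_coord j a, x = lincomb a & \sum_i a i <= 1].
Proof.
move=> xP; have [j [a [aj xE]]] := cone_cover j0 x; exists j, a; split=> //.
by case: aj => _ a0; rewrite -(dotv_facet a0) -xE; move/facet_polytopeP: xP.
Qed.

(* A face [s] is the intersection of the facets that contain it, and is
   therefore exposed by the sum of their functionals. *)
Lemma facet_complex_exposed s : s \in facet_complex ->
  exists d b, [/\ 0 < b, forall i, i \in s -> dotv d (v i) = b
    & forall i, i \notin s -> dotv d (v i) < b].
Proof.
move=> /facet_complexP[j sj].
pose D := [set j | s \subset facet_of j]%SET.
have jD : j \in D by rewrite finset.inE.
exists (\sum_(j in D) c j), #|D|%:R; split=> [|i si|i si].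
- by rewrite ltr0n; apply/card_gt0P; exists j.
- rewrite dotv_suml (eq_bigr (fun=> 1)) ?sumr_const// => k.
  by rewrite finset.inE => /fintype.subsetP sk; apply/in_facet/sk.
- rewrite dotv_suml -sumr_const.
  have [k kD ik] : exists2 k, k \in D & i \notin facet_of k.
    have [ij|] := boolP (i \in facet_of j); last by exists j.
    have [k /fintype.subsetP sub ik] := facet_ridge ij; exists k => //.
    rewrite finset.inE; apply/fintype.subsetP => l ls; apply: sub.
    rewrite finset.in_setD1 (fintype.subsetP sj)// andbT.
    by apply: contraNneq si => <-.
  rewrite (bigD1 k)//= [ltRHS](bigD1 k)//= ltr_leD ?out_facet//.
  by apply: ler_sum => l _; apply: c_le1.
Qed.

Lemma exposing_face d b x : 0 < b -> (forall i, dotv d (v i) <= b) ->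
  facet_polytope x -> dotv d x <= b.
Proof.
move=> b_gt0 dv /polytope_lincomb[j [a [[a_ge0 _] -> a_le1]]].
rewrite dotv_lincomb; apply: (@le_trans _ _ (\sum_i a i * b)).
  by apply: ler_sum => i _; rewrite ler_wpM2l.
by rewrite -mulr_suml ler_piMl// ltW.
Qed.

Lemma facet_boundary_complex : boundary_complex facet_polytope v = facet_complex.
Proof.
apply/setP => s; rewrite finset.inE; apply/asboolP/idP => [|sL].
  move=> [F [[d [b [dP FE]]] FP] sE].
  (* The empty set is split off because the barycentre used below divides by [#|s|]. *)
  have [s0|s_neq0] := eqVneq s finset.set0.
    by rewrite s0; apply/facet_complexP; exists j0; rewrite finset.sub0set.
  have sF i : i \in s -> dotv d (v i) = b.
    by rewrite sE finset.inE FE => /set_mem[].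
  have [k ks] := finset.set0Pn _ s_neq0.
  have d_neq0 : d != 0.
    apply: contra_notN FP => /eqP d0; rewrite FE -(sF _ ks) d0.
    by apply/seteqP; split=> [x []//|x xP]; split=> //=; rewrite !dotv0l.
  have b_gt0 := face_bound_gt0 dP d_neq0.
  have s_gt0 : 0 < #|s|%:R :> R by rewrite ltr0n card_gt0.
  (* The barycentre of [s] lies on the face. Its coordinates in the cone over some facet [j] have
     sum 1, so [c j] takes the value 1 there, and the equality case puts all of [s] in the facet
     [j]. *)
  pose a (i : 'I_m) : R := (i \in s)%:R / #|s|%:R.
  have a_ge0 i : 0 <= a i by rewrite divr_ge0.
  have a1 : \sum_i a i = 1.
    by rewrite -mulr_suml -natr_sum -big_mkcond /= sum1_card divff ?gt_eqF.
  have daE : dotv d (lincomb a) = b.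
    rewrite dotv_lincomb -[RHS]mul1r -a1 mulr_suml; apply: eq_bigr => i _.
    by rewrite /a; case: (boolP (i \in s)) => [/sF->//|_]; rewrite !mul0r.
  have aP : facet_polytope (lincomb a).
    by apply: facet_polytope_lincomb => //; rewrite a1.
  have [j [a' [[a'_ge0 a'0] aE a'_le1]]] := polytope_lincomb aP.
  rewrite aE in daE.
  have [a'1 _] := face_lincomb dP b_gt0 a'_ge0 a'_le1 daE.
  apply/facet_complexP; exists j; apply/fintype.subsetP => i si.
  have := @dotv_lincomb_eq j a a_ge0; rewrite aE dotv_facet// a'1 a1.
  move=> /(_ erefl i); apply: contraPT => ij /(_ ij)/eqP.
  by rewrite /a si mul1r invr_eq0 gt_eqF.
have [d [b [b_gt0 d_in d_out]]] := facet_complex_exposed sL.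
have dv i : dotv d (v i) <= b.
  by have [/d_in->//|/d_out/ltW] := boolP (i \in s).
exists (facet_polytope `&` [set x | dotv d x = b]).
  split; first by exists d, b; split=> // x; apply: exposing_face.
  move=> /seteqP[_ /(_ 0)]; case=> [|_ /= /eqP].
    by apply/facet_polytopeP => j; rewrite dotv0r ler01.
  by rewrite dotv0r lt_eqF.
apply/setP => i; rewrite finset.inE; apply/idP/idP => [si|/set_mem[_ /= dvi]].
  by apply/mem_set; split; [exact: facet_polytope_v|exact: d_in].
by apply: contraPT dvi => /d_out; rewrite lt_neqAle => /andP[/eqP].
Qed.

Hypothesis v_covered : forall i, exists j, i \in facet_of j.

Lemma facet_complex1 i : [set i]%SET \in facet_complex.
Proof.
by have [j ij] := v_covered i; apply/facet_complexP; exists j; rewrite finset.sub1set.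
Qed.

Lemma facet_simplicial_complex : simplicial_complex facet_complex.
Proof.
by split=> [s t|i]; [exact: facet_complexS|exact: facet_complex1].
Qed.

Lemma facet_vertex_inj : injective v.
Proof.
move=> i k vik; have [d [b [_ d_in d_out]]] := facet_complex_exposed (facet_complex1 i).
apply/eqP; apply: contraT => ik; have := d_out k.
by rewrite finset.inE eq_sym ik -vik d_in ?finset.inE// ltxx => /(_ isT).
Qed.

Lemma facet_polytope_vertices :
  set_bij [set: 'I_m] (vertices facet_polytope) v.
Proof.
split=> [i _|i k _ _ /facet_vertex_inj//|x [d [b [dP FE]]]].
  have [d [b [b_gt0 d_in d_out]]] := facet_complex_exposed (facet_complex1 i).
  have di : dotv d (v i) = b by apply: d_in; rewrite finset.inE.
  have dv k : dotv d (v k) <= b.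
    by have [/d_in->//|/d_out/ltW] := boolP (k \in [set i]%SET).
  have dP x : facet_polytope x -> dotv d x <= b by apply: exposing_face.
  exists d, b; split=> //; apply/seteqP; split=> [_ ->|x [xP /= dx]].
    by split=> //; apply: facet_polytope_v.
  have [j [a [[a_ge0 _] xE a_le1]]] := polytope_lincomb xP.
  rewrite xE in dx *; have [a1 av] := face_lincomb dP b_gt0 a_ge0 a_le1 dx.
  rewrite -(lincomb_delta i).
  have a0 k : k != i -> a k = 0.
    move=> ki; apply/eqP; apply: contraTT isT => /av dvk.
    by have := d_out k; rewrite finset.inE ki dvk ltxx => /(_ isT).
  apply: eq_bigr => k _; congr (_ *: _); have [->|/a0//] := eqVneq k i.
  by rewrite -a1 (bigD1 i)//= big1 ?addr0.
have [xP dx] : (facet_polytope `&` [set x | dotv d x = b]) x by rewrite -FE.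
have F1 y : facet_polytope y -> dotv d y = b -> y = x.
  by move=> yP dy; have : [set x] y by rewrite FE.
have [j [a [[a_ge0 _] xE a_le1]]] := polytope_lincomb xP.
(* A zero functional can expose a single point only if the polytope is that point; any [v i] is then
   equal to [x]. *)
have [d0|d_neq0] := eqVneq d 0.
  have b0 : b = 0 by rewrite -dx d0 /= dotv0l.
  suff [i _] : exists i : 'I_m, True.
    by exists i => //; apply: F1; [exact: facet_polytope_v|rewrite d0 dotv0l].
  have : (0 < #|facet_of j0|)%N by rewrite card_facet.
  by case/card_gt0P => i _; exists i.
have b_gt0 := face_bound_gt0 dP d_neq0.
rewrite /= xE in dx; have [a1 av] := face_lincomb dP b_gt0 a_ge0 a_le1 dx.
have [i ai] : exists i, a i != 0.
  apply/existsP; apply: contraPT a1 => /existsPn a0; rewrite big1.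
    by move/esym/eqP; rewrite oner_eq0.
  by move=> i _; apply/eqP; have := a0 i; rewrite negbK.
by exists i => //; apply: F1; [exact: facet_polytope_v|exact: av].
Qed.

End FacetSystem.

Section FacetSystemMore.
Variables (R : realType) (n m : nat) (J : finType).
Variables (v : 'I_m -> 'rV[R]_n) (c : J -> 'rV[R]_n) (j0 : J).
Hypothesis sys : facet_system v c.
Variable opp : 'I_m -> 'I_m.
Hypotheses (v_opp : forall i, v (opp i) = - v i) (n_gt0 : (0 < n)%N).

(** The origin and the [n] vertices of one facet are affinely independent. *)
Lemma facet_affine_dimension : affine_dimension (facet_polytope v) n.
Proof.
have [_ card_facet _] := sys; split; last first.
  move=> [q _]; rewrite /affinely_independent /row_free => /eqP rk.
  by have := rank_leq_col (\matrix_(i < n.+1) (q (lift ord0 i) - q ord0)); rewrite rk ltnn.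
pose w (k : 'I_n) : 'I_m := enum_val (cast_ord (esym (card_facet j0)) k).
have wF k : w k \in facet_of v c j0 by exact: enum_valP.
have w_inj : injective w by move=> k l /enum_val_inj/cast_ord_inj.
pose q (i : 'I_n.+1) : 'rV[R]_n := if unlift ord0 i is Some k then v (w k) else 0.
exists q.
  move=> i; rewrite /q; case: unliftP => [k _|_]; first exact: (facet_polytope_v sys j0 v_opp).
  by apply/(facet_polytopeP sys j0 v_opp n_gt0) => j; rewrite dotv0r.
apply: inj_row_free => u; rewrite mulmx_sum_row => u0.
pose a (i : 'I_m) : R := \sum_(k | w k == i) u 0 k.
have aw k : a (w k) = u 0 k.
  by rewrite /a (big_pred1 k)// => l; exact: (inj_eq w_inj).
have a0 i : i \notin facet_of v c j0 -> a i = 0.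
  by move=> ij; apply: big_pred0 => k; apply: contraNF ij => /eqP <-.
apply/rowP => k; rewrite mxE -aw; apply: (facet_free sys a0).
rewrite -[RHS]u0 /lincomb.
transitivity (\sum_i \sum_(k | w k == i) u 0 k *: v (w k)).
  by apply: eq_bigr => i _; rewrite scaler_suml; apply: eq_bigr => l /eqP->.
rewrite [RHS](partition_big w xpredT)//=.
apply: eq_bigr => i _; apply: eq_bigr => l _.
by rewrite rowK /q liftK unlift_none subr0.
Qed.

Lemma linear_lincomb (f : 'rV[R]_n -> 'rV[R]_n) (a : 'I_m -> R) : linear f ->
  f (lincomb v a) = \sum_i a i *: f (v i).
Proof.
move=> fl; have f0 : f 0 = 0.
  by have := fl (-1) 0 0; rewrite scaler0 addr0 scaleN1r addNr.
rewrite /lincomb; elim/big_rec2: _ => // i x y _ <-.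
exact: fl.
Qed.

(** A linear map that permutes the vertices permutes the weights of a convex combination; [g]
    inverts [f] on vertices and supplies preimages. *)
Lemma facet_polytope_linear (f g : 'rV[R]_n -> 'rV[R]_n) (s : 'S_m) :
  linear f -> linear g -> (forall i, f (v i) = v (s i)) ->
  (forall i, g (v i) = v (s^-1%g i)) -> f @` facet_polytope v = facet_polytope v.
Proof.
move=> fl gl fv gv.
have stable h (t : 'S_m) : linear h -> (forall i, h (v i) = v (t i)) ->
    forall x, facet_polytope v x -> facet_polytope v (h x).
  move=> hl hv x /(polytope_lincomb sys j0 v_opp n_gt0)[j [a [[a0 _] -> a1]]].
  rewrite (linear_lincomb _ hl).
  have -> : \sum_i a i *: h (v i) = lincomb v (fun i => a (t^-1%g i)).
    rewrite /lincomb [RHS](reindex_inj (@perm_inj _ t)) /=.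
    by apply: eq_bigr => i _; rewrite permK hv.
  apply: (facet_polytope_lincomb sys j0 v_opp n_gt0) => //.
  by rewrite (reindex_inj (@perm_inj _ t)) /=; under eq_bigr do rewrite permK.
apply/seteqP; split=> [_ [x xP <-]|x xP]; first exact: (stable f s).
exists (g x); first exact: (stable g s^-1%g).
have [j [a [_ xE _]]] := polytope_lincomb sys j0 v_opp n_gt0 xP.
rewrite xE (linear_lincomb _ gl).
have -> : \sum_i a i *: g (v i) = lincomb v (fun i => a (s i)).
  rewrite /lincomb [LHS](reindex_inj (@perm_inj _ s)) /=.
  by apply: eq_bigr => i _; rewrite gv permK.
rewrite (linear_lincomb _ fl) /lincomb [RHS](reindex_inj (@perm_inj _ s)) /=.
by apply: eq_bigr => i _; rewrite fv.
Qed.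

End FacetSystemMore.

(** * Continuity and compactness *)

Section TopologyFacts.

Lemma continuous_rowP (R : realType) n (T : topologicalType) (f : T -> 'rV[R]_n) x :
  {for x, continuous f} <-> forall i, {for x, continuous (fun t => f t 0 i)}.
Proof.
split=> [fx i|fx A /= [B Bf BA]].
  by apply: (@continuous_comp _ _ _ f (fun y : 'rV[R]_n => y 0 i)) => //; exact: coord_continuous.
have : \forall t \near x, forall i, B 0 i (f t 0 i).
  by apply: filter_forall => i; apply: (fx i); apply: Bf.
by apply: filterS => t Bt; apply: BA => k i; rewrite ord1; apply: Bt.
Qed.

Lemma continuous_val (X : topologicalType) (A : set X) : continuous (val : A -> X).
Proof. exact: (@initial_continuous A X set_val). Qed.

Lemma continuous_subtypeP (T X : topologicalType) (A : set X) (f : T -> A) t :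
  {for t, continuous f} <-> {for t, continuous (fun t => val (f t))}.
Proof.
split=> [cf|cf U].
  by apply: (@continuous_comp _ _ _ f val) => //; apply: continuous_val.
rewrite /= nbhsE => -[W [[W' oW' <-] W'x] WU].
have W't : nbhs (val (f t)) W' by apply: open_nbhs_nbhs; split.
have fW' : \forall u \near t, W' (val (f u)) by exact: cf.
suff : \forall u \near t, U (f u) by [].
by apply: filterS fW' => u W'u; apply: WU.
Qed.

Lemma hausdorff_subtype (X : topologicalType) (A : set X) :
  hausdorff_space X -> hausdorff_space A.
Proof.
move=> hX x y xy; apply: val_inj; apply: hX => U V Ux Vy.
have [z [Uz Vz]] := xy _ _ (continuous_val Ux) (continuous_val Vy).
by exists (val z).
Qed.

Lemma compact_subtype (X : topologicalType) (A : set X) :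
  compact A -> compact [set: A].
Proof.
move=> cA F FF _.
have FA : (val @ F) A.
  by apply: (@filterS _ F _ setT) => [x _|]; [exact: (set_mem (valP x))|exact: filterT].
have [x [Ax xF]] := cA (val @ F) _ FA.
exists (SigSub (mem_set Ax)); split=> // U V FU.
rewrite nbhsE => -[W [[W' oW' <-] W'x] WV].
have FU' : (val @ F) (val @` U).
  by apply: (@filterS _ F _ U) => // z Uz; exists z.
have [|_ [[z Uz <-] W'z]] := xF _ W' FU'.
  by apply: open_nbhs_nbhs; split.
by exists z; split=> //; apply: WV.
Qed.

Lemma compact_bij_continuous (X Y : topologicalType) (f : X -> Y) (g : Y -> X) :
  compact [set: X] -> hausdorff_space Y -> continuous f ->
  cancel f g -> cancel g f -> continuous g.
Proof.
move=> cX hY cf fK gK; apply/continuous_closedP => A clA.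
have -> : g @^-1` A = f @` A.
  apply/seteqP; split=> [y Ay|_ [x Ax <-]]; first by exists (g y).
  by rewrite /= fK.
apply: (compact_closed hY); apply: continuous_compact.
  exact: continuous_subspaceT.
exact: (subclosed_compact clA cX).
Qed.

Lemma homeomorphic_compact (X Y : topologicalType) (f : X -> Y) :
  compact [set: X] -> hausdorff_space Y -> continuous f -> bijective f ->
  homeomorphic X Y.
Proof.
move=> cX hY cf [g fK gK]; exists f, g; split=> //.
exact: (compact_bij_continuous cX).
Qed.

Lemma hausdorff_rV (R : realType) n : hausdorff_space 'rV[R]_n.
Proof. exact: norm_hausdorff. Qed.

Variables (R : realType) (n : nat).

Lemma continuous_sum (V : normedModType R) (T : topologicalType) (I : Type)
    (r : seq I) (P : pred I) (f : I -> T -> V) x :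
  (forall i, P i -> {for x, continuous (f i)}) ->
  {for x, continuous (fun t => \sum_(i <- r | P i) f i t)}.
Proof.
by move=> cf; apply: cvg_big => //; exact: add_continuous.
Qed.

Lemma continuous_dotv (T : topologicalType) (f g : T -> 'rV[R]_n) x :
  {for x, continuous f} -> {for x, continuous g} ->
  {for x, continuous (fun t => dotv (f t) (g t))}.
Proof.
move=> /continuous_rowP cf /continuous_rowP cg.
by apply: continuous_sum => i _; exact: continuousM (cf i) (cg i).
Qed.

Lemma continuous_enorm : continuous (@enorm R n).
Proof.
move=> x; apply: continuous_comp; last exact: sqrt_continuous.
by apply: continuous_dotv.
Qed.

Lemma coord_le_enorm (x : 'rV[R]_n) i : `|x 0 i| <= enorm x.
Proof.
rewrite -sqrtr_sqr ler_wsqrtr// expr2 /dotv (bigD1 i)//= lerDl.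
by apply: sumr_ge0 => k _; rewrite -expr2 sqr_ge0.
Qed.

Lemma bounded_coord_compact (A : set 'rV[R]_n) (M : R) : closed A ->
  (forall x i, A x -> `|x 0 i| <= M) -> compact A.
Proof.
move=> clA AM.
have cM : compact [set x : 'rV[R]_n | forall i, x ord0 i \in `[- M, M]].
  apply: (@rV_compact _  _ (fun=> `[- M, M]%classic)).
  by move=> _; apply: segment_compact.
by apply: (subclosed_compact clA cM) => x Ax i /=; rewrite in_itv /= -ler_norml AM.
Qed.

End TopologyFacts.

Lemma compact_sphere (R : realType) n : compact (sphere R n).
Proof.
apply: (@bounded_coord_compact _ _ _ 1) => [|x i x1].
  apply: (@closed_comp _ _ (@enorm R n.+1) [set 1]) => [x _|].
    exact: continuous_enorm.
  exact: closed_eq.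
by rewrite -x1 coord_le_enorm.
Qed.

Lemma closed_realization (R : realType) m (K : {set {set 'I_m}}) :
  (forall s t : {set 'I_m}, s \in K -> t \subset s -> t \in K) ->
  closed (realization R K).
Proof.
move=> Ksub.
(* The support condition is recast as a finite union of coordinate subspaces, one for each face,
   which is closed. The two agree because faces are stable under taking subsets. *)
have -> : realization R K =
    (\bigcap_(i in [set: 'I_m]) [set x | 0 <= x 0 i]) `&` [set x | \sum_i x 0 i = 1]
    `&` \bigcup_(s in [set s | s \in K])
      \bigcap_(i in [set i | i \notin s]) [set x | x 0 i = 0].
  apply/seteqP; split=> [x [x0 x1 xK]|x [[x0 x1] [s sK xs]]].
    split; first by split=> // i _; apply: x0.
    exists [set i | x 0 i != 0]%SET => // i /=.
    by rewrite finset.inE negbK => /eqP.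
  split=> // [i|]; first exact: x0.
  apply: (Ksub _ _ sK); apply/fintype.subsetP => i; rewrite finset.inE.
  by apply: contraNT => /xs/eqP.
apply: closedI; first apply: closedI.
- apply: closed_bigI => i _.
  apply: (@closed_comp _ _ (fun x : 'rV[R]_m => x 0 i) [set y | 0 <= y]) => [x _|].
    exact: coord_continuous.
  exact: closed_ge.
- apply: (@closed_comp _ _ (fun x : 'rV[R]_m => \sum_i x 0 i) [set 1]) => [x _|].
    by apply: continuous_sum => i _; exact: coord_continuous.
  exact: closed_eq.
apply: closed_bigcup => [|s _]; first exact: finite_finset.
apply: closed_bigI => i _.
apply: (@closed_comp _ _ (fun x : 'rV[R]_m => x 0 i) [set 0]) => [x _|].
  exact: coord_continuous.
exact: closed_eq.
Qed.

Lemma compact_realization (R : realType) m (K : {set {set 'I_m}}) :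
  (forall s t : {set 'I_m}, s \in K -> t \subset s -> t \in K) ->
  compact (realization R K).
Proof.
move=> Ksub; apply: (@bounded_coord_compact _ _ _ 1) => [|x i [x0 x1 _]].
  exact: closed_realization.
by rewrite ger0_norm// -x1 (bigD1 i)//= lerDl sumr_ge0.
Qed.

Section Normalization.
Variables (R : realType) (n : nat).
Implicit Types x y : 'rV[R]_n.+1.

Lemma enorm_gt0 x : (0 < enorm x) = (x != 0).
Proof. by rewrite sqrtr_gt0 dotvv_gt0. Qed.

Lemma enorm_ge0 x : 0 <= enorm x. Proof. exact: sqrtr_ge0. Qed.

Lemma enormZ (a : R) x : 0 <= a -> enorm (a *: x) = a * enorm x.
Proof.
move=> a0; rewrite /enorm dotvZl dotvZr mulrA sqrtrM ?mulr_ge0//.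
by rewrite -expr2 sqrtr_sqr ger0_norm.
Qed.

Lemma enormN x : enorm (- x) = enorm x.
Proof. by rewrite /enorm dotvNl dotvNr opprK. Qed.

(* The junk value at [x = 0] is the first basis vector. *)
Definition normalize x : 'rV[R]_n.+1 :=
  if x == 0 then delta_mx 0 0 else (enorm x)^-1 *: x.

Lemma normalize_sphere x : sphere R n (normalize x).
Proof.
rewrite /sphere /= /normalize; case: eqVneq => [_|x0].
  apply/enorm_eq1; rewrite /dotv (bigD1 0)//= big1 ?mxE ?addr0 ?mulr1// => i i0.
  by rewrite mxE eqxx (negPf i0) mul0r.
by rewrite enormZ ?invr_ge0 ?enorm_ge0// mulVf// gt_eqF ?enorm_gt0.
Qed.

Definition normalizeS x : sphere R n := SigSub (mem_set (normalize_sphere x)).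

Lemma normalizeZ (a : R) x : 0 < a -> normalize (a *: x) = normalize x.
Proof.
move=> a0; rewrite /normalize scaler_eq0 gt_eqF//=; case: ifPn => // x0.
rewrite enormZ ?ltW// scalerA invfM mulrAC mulVf ?mul1r// gt_eqF//.
Qed.

Lemma normalizeN x : x != 0 -> normalize (- x) = - normalize x.
Proof. by move=> x0; rewrite /normalize oppr_eq0 (negPf x0) enormN scalerN. Qed.

Lemma normalize_id x : sphere R n x -> normalize x = x.
Proof.
rewrite /sphere /= /normalize => x1; case: eqVneq => [x0|_].
  by have /eqP := x1; rewrite x0 /enorm dotv0l sqrtr0 eq_sym oner_eq0.
by rewrite x1 invr1 scale1r.
Qed.

Lemma sphere_neq0 x : sphere R n x -> x != 0.
Proof. by rewrite /sphere /= => x1; rewrite -enorm_gt0 x1. Qed.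

Lemma continuous_normalize (T : topologicalType) (f : T -> 'rV[R]_n.+1) t :
  {for t, continuous f} -> f t != 0 ->
  {for t, continuous (fun t => normalize (f t))}.
Proof.
move=> cf ft0.
have cN : {for t, continuous (fun t => (enorm (f t))^-1 *: f t)}.
  apply: continuousZ => //; apply: continuousV.
    by rewrite gt_eqF ?enorm_gt0.
  by apply: continuous_comp => //; exact: continuous_enorm.
have ftE : normalize (f t) = (enorm (f t))^-1 *: f t.
  by rewrite /normalize (negPf ft0).
rewrite /prop_for /continuous_at ftE.
apply: cvg_trans cN; apply: near_eq_cvg.
have : \forall u \near t, 0 < enorm (f u).
  have ce : {for t, continuous (fun u => enorm (f u))}.
    by apply: continuous_comp => //; exact: continuous_enorm.
  by apply: (ce [set y | 0 < y]); apply: lt_nbhsr; rewrite enorm_gt0.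
by apply: filterS => u; rewrite enorm_gt0 /normalize => /negPf->.
Qed.

Lemma continuous_normalizeS (T : topologicalType) (f : T -> 'rV[R]_n.+1) t :
  {for t, continuous f} -> f t != 0 ->
  {for t, continuous (fun t => normalizeS (f t))}.
Proof. by move=> cf ft; apply/continuous_subtypeP; exact: continuous_normalize. Qed.

End Normalization.

(** * Spheres of dimension at least two are simply connected *)

Section Clamp.
Variable R : realType.

(** Precomposition with this retraction onto the unit interval turns continuity within the interval
    into continuity everywhere; it also schedules the two stages of the homotopy below. *)
Definition clamp (t : R) : R := Num.min (Num.max t 0) 1.

Lemma clamp_itv t : 0 <= clamp t <= 1.
Proof. by rewrite /clamp le_min ge_min lexx orbT le_max lexx orbT ler01. Qed.

Lemma clamp_id t : 0 <= t <= 1 -> clamp t = t.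
Proof. by move=> /andP[t0 t1]; rewrite /clamp max_l// min_l. Qed.

Lemma clamp_le0 t : t <= 0 -> clamp t = 0.
Proof. by move=> t0; rewrite /clamp max_r// min_l. Qed.

Lemma clamp_ge1 t : 1 <= t -> clamp t = 1.
Proof. by move=> t1; rewrite /clamp max_l ?min_r// (le_trans ler01). Qed.

Lemma continuous_clamp (T : topologicalType) (f : T -> R) x :
  {for x, continuous f} -> {for x, continuous (fun t => clamp (f t))}.
Proof.
move=> cf; apply: (@continuous_min R T (fun t => Num.max (f t) 0) (cst 1)).
  by apply: (@continuous_max R T f (cst 0)) => //; exact: cst_continuous.
exact: cst_continuous.
Qed.

End Clamp.

Lemma continuous_comp_within (T X Y : topologicalType) (A : set X) (f : X -> Y)
    (g : T -> X) : {within A, continuous f} -> continuous g ->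
  (forall t, A (g t)) -> continuous (f \o g).
Proof.
move=> /subspace_sigL_continuousP cf cg Ag.
pose g' t : A := SigSub (mem_set (Ag t)).
have -> : f \o g = sigL A f \o g' by apply/funext => t.
move=> t; apply: continuous_comp; last exact: cf.
by apply/continuous_subtypeP; exact: cg.
Qed.

Section Orthogonal.
Variables (R : realType) (n : nat).

Lemma dotv_mulmx d (x y : 'rV[R]_d) : (x *m y^T) 0 0 = dotv x y.
Proof. by rewrite mxE; apply: eq_bigr => i _; rewrite !mxE. Qed.

(** Two linear equations in at least three unknowns; this is where the dimension of the sphere, at
    least two, enters. *)
Lemma exists_orthogonal (x y : 'rV[R]_n.+3) :
  exists u, [/\ u != 0, dotv u x = 0 & dotv u y = 0].
Proof.
pose A := row_mx x^T y^T.
have kA0 : kermx A != 0.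
  rewrite -mxrank_eq0 mxrank_ker -lt0n subn_gt0.
  exact: leq_ltn_trans (rank_leq_col _) _.
exists (nz_row (kermx A)).
have : nz_row (kermx A) *m A = 0 by apply/sub_kermxP; exact: nz_row_sub.
rewrite mul_mx_row -[0]row_mx0 => /eq_row_mx[ux uy].
by rewrite nz_row_eq0 -!dotv_mulmx ux uy !mxE.
Qed.

(* The points of the moment curve that lie in a given hyperplane are the roots
   of a nonzero polynomial. *)
Lemma exists_nonorthogonal (N : nat) (u : nat -> 'rV[R]_n.+1) :
  (forall k, u k != 0) -> exists p, forall k, (k < N)%N -> dotv (u k) p != 0.
Proof.
move=> u0; pose q k : {poly R} := \poly_(i < n.+1) u k 0 (inord i).
have qE k x : (q k).[x] = dotv (u k) (\row_i x ^+ i).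
  by rewrite horner_poly; apply: eq_bigr => i _; rewrite inord_val mxE.
have q0 k : q k != 0.
  apply: contra (u0 k) => /eqP qk0; apply/eqP/rowP => i; rewrite mxE.
  by have := coef_poly n.+1 (fun i => u k 0 (inord i)) i;
    rewrite -/(q k) qk0 coef0 ltn_ord inord_val => <-.
pose Q := \prod_(k < N) q k.
have Q0 : Q != 0 by apply/prodf_neq0 => k _.
have [x Qx] : exists x, ~~ root Q x.
  apply/not_existsP => Qroot.
  have := @max_poly_roots _ Q [seq i%:R | i <- iota 0 (size Q)] Q0.
  rewrite size_map size_iota ltnn; apply/not_implyP; split.
    by apply/allP => x _; apply/negPn/negP/Qroot.
  rewrite map_inj_uniq ?iota_uniq//; last by move=> i j /eqP; rewrite eqr_nat => /eqP.
  by move=> /(_ isT).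
exists (\row_i x ^+ i) => k kN; apply: contra Qx; rewrite -qE => qk0.
by rewrite /root horner_prod; apply/prodf_eq0; exists (Ordinal kN).
Qed.

End Orthogonal.

(** * Stereographic projection from a pole *)

Section Stereographic.
Variables (R : realType) (n : nat) (p : 'rV[R]_n.+1).
Hypothesis p1 : dotv p p = 1.
Implicit Types z u : 'rV[R]_n.+1.

Definition stereo z := (1 - dotv z p)^-1 *: (z - dotv z p *: p).

(* A positive multiple of the inverse stereographic projection. *)
Definition stereo_inv u := 2 *: u + (dotv u u - 1) *: p.

Lemma stereo_orthogonal z : dotv (stereo z) p = 0.
Proof. by rewrite dotvZl dotvDl dotvNl dotvZl p1 mulr1 subrr mulr0. Qed.

Lemma stereo_inv_neq0 u : dotv u p = 0 -> stereo_inv u != 0.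
Proof.
move=> up; rewrite -dotvv_gt0 /stereo_inv.
rewrite !(dotvDl, dotvDr, dotvZl, dotvZr) (dotvC p u) up p1.
have := dotvv_ge0 u; set a := dotv u u => a0.
rewrite [ltRHS](_ : _ = (a + 1) ^+ 2); last by ring.
by rewrite exprn_gt0// ltr_pwDr.
Qed.

Lemma dotv_lt1 z : dotv z z = 1 -> z != p -> dotv z p < 1.
Proof.
move=> z1; rewrite -subr_eq0 -dotvv_gt0 !(dotvDl, dotvDr, dotvNl, dotvNr).
by rewrite (dotvC p z) z1 p1; lra.
Qed.

Lemma stereoK z : dotv z z = 1 -> z != p -> normalize (stereo_inv (stereo z)) = z.
Proof.
move=> z1 zp; have d1 := dotv_lt1 z1 zp; set d := dotv z p in d1.
have e : stereo_inv (stereo z) = (2 / (1 - d)) *: z.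
  rewrite /stereo_inv.
  have -> : dotv (stereo z) (stereo z) = (1 + d) / (1 - d).
    rewrite /stereo !(dotvDl, dotvDr, dotvNl, dotvNr, dotvZl, dotvZr).
    rewrite (dotvC p z) z1 p1 -/d; field.
    by rewrite subr_eq0 gt_eqF.
  rewrite /stereo -/d; apply/rowP => i; rewrite !mxE; field.
  by rewrite subr_eq0 gt_eqF.
rewrite e normalizeZ ?divr_gt0 ?subr_gt0//.
by apply: normalize_id; apply/enorm_eq1.
Qed.

Lemma continuous_stereo (T : topologicalType) (f : T -> 'rV[R]_n.+1) t :
  {for t, continuous f} -> dotv (f t) p != 1 ->
  {for t, continuous (fun t => stereo (f t))}.
Proof.
move=> cf ft.
have cd : {for t, continuous (fun t => dotv (f t) p)}.
  by apply: continuous_dotv => //; exact: cst_continuous.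
apply: (@continuousZ _ _ _ (fun t => (1 - dotv (f t) p)^-1) (fun t => f t - dotv (f t) p *: p)).
  apply: (@continuousV _ _ (fun t => 1 - dotv (f t) p)).
    by rewrite subr_eq0 eq_sym.
  by apply: continuousB => //; exact: cst_continuous.
apply: continuousB; first exact: cf.
by apply: continuousZ; [exact: cd|exact: cst_continuous].
Qed.

Lemma continuous_stereo_inv (T : topologicalType) (f : T -> 'rV[R]_n.+1) t :
  {for t, continuous f} -> {for t, continuous (fun t => stereo_inv (f t))}.
Proof.
move=> cf; apply: continuousD.
  by apply: continuousZ => //; exact: cst_continuous.
apply: continuousZ; last exact: cst_continuous.
apply: continuousB; last exact: cst_continuous.
exact: continuous_dotv.
Qed.

End Stereographic.

(** * Tent functions for piecewise linear interpolation *)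

Section Hat.
Variable R : realType.

Definition hat (k : nat) (x : R) : R := Num.max 0 (1 - `|x - k%:R|).

Lemma hat_ge0 k x : 0 <= hat k x. Proof. by rewrite le_max lexx. Qed.

Lemma hat_gt0 k x : (0 < hat k x) = (`|x - k%:R| < 1).
Proof. by rewrite lt_max ltxx subr_gt0. Qed.

Lemma hat_nat k l : hat k l%:R = (k == l)%:R.
Proof.
rewrite /hat; have [->|kl] := eqVneq; first by rewrite subrr normr0 subr0 max_r.
rewrite max_l// subr_le0; case: (ltngtP k l) kl => // kl _.
  have : (k.+1%:R <= l%:R :> R) by rewrite ler_nat.
  rewrite -natr1 => kl'; rewrite ger0_norm; lra.
have : (l.+1%:R <= k%:R :> R) by rewrite ler_nat.
rewrite -natr1 => kl'; rewrite ler0_norm; lra.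
Qed.

Lemma continuous_hat k : continuous (hat k).
Proof.
move=> x; apply: (@continuous_max R R (cst 0) (fun x => 1 - `|x - k%:R|)).
  exact: cst_continuous.
apply: continuousB; first exact: cst_continuous.
by apply: cvg_norm; apply: cvgB; [exact: cvg_id|exact: cvg_cst].
Qed.

(** Only the tents at the two integers around [x] are positive, so an interpolated curve stays in
    the plane of two consecutive samples. *)
Lemma hat_support (x : R) k : 0 <= x -> 0 < hat k x ->
  k = Num.truncn x \/ k = (Num.truncn x).+1.
Proof.
move=> x0; rewrite hat_gt0 ltr_norml => /andP[xk kx].
have /andP[tx xt] := truncn_itv x0; set t := Num.truncn x in tx xt *.
have kt : (t <= k)%N.
  by rewrite -ltnS -(ltr_nat R) -natr1; lra.
have tk : (k <= t.+1)%N.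
  by rewrite -ltnS -(ltr_nat R) -[t.+2%:R]natr1; lra.
case: (ltngtP k t.+1) tk => // [|->]; [|by right]; rewrite ltnS => kt' _.
by left; apply/eqP; rewrite eqn_leq kt kt'.
Qed.

Lemma hat_truncn (x : R) : 0 <= x -> 0 < hat (Num.truncn x) x.
Proof.
by move=> x0; have /andP[tx xt] := truncn_itv x0;
  rewrite hat_gt0 ger0_norm; move: xt; rewrite -natr1; lra.
Qed.

End Hat.

(** Positivity is an open condition around each diagonal point; compactness of the interval makes
    its radius uniform. *)
Lemma compact_near_diagonal (R : realType) d (c : R -> 'rV[R]_d) :
  continuous c -> (forall t, 0 < dotv (c t) (c t)) ->
  exists N : nat, forall s t, 0 <= s <= 1 -> `|s - t| < N.+1%:R^-1 ->
    0 < dotv (c s) (c t).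
Proof.
move=> cc c0.
have /compact_near_coveringP := @segment_compact R 0 1.
move=> /(_ R (0^'+) (fun e s => forall t, `|s - t| < e -> 0 < dotv (c s) (c t)) _).
case=> [s _|e /= e0 He].
  have cd : {for (s, s), continuous (fun z : R * R => dotv (c z.1) (c z.2))}.
    apply: continuous_dotv.
      by apply: (@continuous_comp _ _ _ fst c); [exact: cvg_fst|exact: cc].
    by apply: (@continuous_comp _ _ _ snd c); [exact: cvg_snd|exact: cc].
  have /cd := lt_nbhsr (c0 s).
  move=> [[U V] /= [/nbhs_ballP[a /= a0 aU] /nbhs_ballP[b /= b0 bV]] UV].
  (* Half of the smaller radius, since the distances from [s] to [x] and from [x] to [t] add up. *)
  pose r := Num.min a b / 2.
  have r0 : 0 < r by rewrite divr_gt0// lt_min a0.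
  have ra : r + r <= a by rewrite -splitr ge_min lexx.
  have rb : r + r <= b by rewrite -splitr ge_min lexx orbT.
  exists (ball s r, [set e | e < r]) => /=.
    split; first exact: nbhsx_ballx.
    by apply: nbhs_right_lt.
  move=> [x e] /= [xs er] t xt; apply: (UV (x, t)); split=> /=.
    by apply: aU; apply: le_ball xs; lra.
  apply: bV; rewrite /ball /= in xs *.
  rewrite (_ : s - t = (s - x) + (x - t)); last by ring.
  by rewrite (le_lt_trans (ler_normD _ _))//; lra.
exists (Num.truncn e^-1); set N := Num.truncn e^-1 => s t s01 st.
have N_lt : N.+1%:R^-1 < e.
  rewrite invf_plt ?posrE//.
  by have /andP[] := truncn_itv (ltW (eqbRL (invr_gt0 e) e0)).
by apply: (He N.+1%:R^-1) => //=; rewrite sub0r normrN ger0_norm.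
Qed.

(** * Contracting a loop on the sphere *)

Section SphereLoop.
Variables (R : realType) (n : nat).
Variable (c : R -> 'rV[R]_n.+3).
Hypothesis c_cont : continuous c.
Hypothesis c_unit : forall t, dotv (c t) (c t) = 1.
Hypothesis c_loop : c 0 = c 1.

Definition pl_loop (N : nat) (t : R) : 'rV[R]_n.+3 :=
  \sum_(k < N.+1) hat k (N%:R * clamp t) *: c (k%:R / N%:R).

Lemma continuous_pl_loop N : continuous (pl_loop N).
Proof.
move=> t; apply: continuous_sum => k _.
apply: continuousZ; last exact: cst_continuous.
apply: (@continuous_comp _ _ _ (fun t => N%:R * clamp t) (hat k)).
  apply: continuousM; first exact: cst_continuous.
  by apply: continuous_clamp; exact: cvg_id.
exact: continuous_hat.
Qed.

Lemma pl_loop_nat N (i : 'I_N.+1) : (0 < N)%N ->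
  pl_loop N (i%:R / N%:R) = c (i%:R / N%:R).
Proof.
move=> N0; have N0' : N%:R != 0 :> R by rewrite pnatr_eq0 -lt0n.
rewrite /pl_loop clamp_id; last first.
  by rewrite divr_ge0//= ler_pdivrMr ?ltr0n// mul1r ler_nat -ltnS.
rewrite mulrCA divff// mulr1 (bigD1 i)//= hat_nat eqxx scale1r big1 ?addr0//.
by move=> k ki; rewrite hat_nat (inj_eq val_inj) (negPf ki) scale0r.
Qed.

(** Every sample with positive weight at time [t] is taken close to [t], so it makes an acute angle
    with [c t]; the sample of index [truncn] does have positive weight. In particular the polygon
    and its segments to [c] avoid the origin. *)
Lemma pl_loop_approx : exists2 N, (0 < N)%N &
  forall t, 0 < dotv (pl_loop N t) (c (clamp t)).
Proof.
have [N Nc] : exists N : nat, forall s t, 0 <= s <= 1 -> `|s - t| < N.+1%:R^-1 ->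
    0 < dotv (c s) (c t).
  by apply: compact_near_diagonal => // t; rewrite c_unit.
exists N.+1 => // t; have /andP[t0 t1] := clamp_itv t.
set x := clamp t in t0 t1 *; have N0 : 0 < N.+1%:R :> R by [].
have Nx0 : 0 <= N.+1%:R * x by rewrite mulr_ge0.
have near_gt0 (k : 'I_N.+2) : 0 < hat k (N.+1%:R * x) ->
    0 < dotv (c (k%:R / N.+1%:R)) (c x).
  rewrite hat_gt0 dotvC => kx; apply: Nc; first by rewrite t0.
  rewrite -(ltr_pM2l N0) mulfV ?gt_eqF// -{1}(ger0_norm (ltW N0)) -normrM.
  by rewrite mulrBr mulrCA divff ?gt_eqF// mulr1.
rewrite /pl_loop dotv_suml -/x.
have tk : (Num.truncn (N.+1%:R * x) < N.+2)%N.
  rewrite ltnS -(ler_nat R); have /andP[tx _] := truncn_itv Nx0.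
  by rewrite (le_trans tx)// ler_piMr.
rewrite (bigD1 (Ordinal tk))//= ltr_pwDl//.
  by rewrite dotvZl mulr_gt0 ?hat_truncn// (near_gt0 (Ordinal tk))//= hat_truncn.
apply: sumr_ge0 => k _; rewrite dotvZl.
have [h0|h0] := ltrP 0 (hat k (N.+1%:R * x)); first by rewrite mulr_ge0 ?ltW// near_gt0.
have -> : hat k (N.+1%:R * x) = 0 by apply/eqP; rewrite eq_le h0 hat_ge0.
by rewrite mul0r.
Qed.

(* The loop is contained in finitely many planes, hence misses a point. *)
Lemma pl_loop_avoid N : (0 < N)%N -> exists2 p : 'rV[R]_n.+3, dotv p p = 1 &
  forall t, pl_loop N t != 0 -> normalize (pl_loop N t) != p.
Proof.
move=> N0; pose f (k : nat) := c (k%:R / N%:R).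
have /choice[u uP] : forall k, exists u,
    [/\ u != 0, dotv u (f k) = 0 & dotv u (f k.+1) = 0].
  by move=> k; exact: exists_orthogonal.
(* [u k] is normal to the plane of the [k]-th edge and [p] is orthogonal to none of these normals,
   so no nonzero point of an edge is proportional to [p]. The index [N] is included because [truncn]
   takes that value at the end of the loop. *)
have [p pP] := @exists_nonorthogonal R n.+2 N.+1 u (fun k => let: And3 h _ _ := uP k in h).
have p0 : p != 0.
  by apply: contraTneq (pP 0%N isT) => ->; rewrite dotv0r eqxx.
exists (normalize p); first exact/enorm_eq1/normalize_sphere.
move=> t q0; have /andP[t0 t1] := clamp_itv t.
have Nx0 : 0 <= N%:R * clamp t by rewrite mulr_ge0.
set k := Num.truncn (N%:R * clamp t).
have kN : (k < N.+1)%N.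
  rewrite ltnS -(ler_nat R); have /andP[tx _] := truncn_itv Nx0.
  by rewrite (le_trans tx)// ler_piMr.
have uq : dotv (u k) (pl_loop N t) = 0.
  rewrite dotv_sumr big1// => l _; rewrite dotvZr.
  have [h0|h0] := ltrP 0 (hat l (N%:R * clamp t)); last first.
    have -> : hat l (N%:R * clamp t) = 0 by apply/eqP; rewrite eq_le h0 hat_ge0.
    by rewrite mul0r.
  have [_ u1 u2] := uP k.
  by case: (hat_support Nx0 h0) => ->; rewrite -/k -/(f _) ?u1 ?u2 mulr0.
apply: contraNneq (pP k kN) => /(congr1 (dotv (u k))).
rewrite /normalize (negPf q0) (negPf p0) !dotvZr uq mulr0 => /esym/eqP.
by rewrite mulf_eq0 invr_eq0 gt_eqF ?enorm_gt0.
Qed.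

(** In the first half of the time, straight segments from the loop to the polygon are normalized. In
    the second half the normalized polygon, which misses [p], is contracted linearly in the
    stereographic chart at [p]. Both stages fix the base point because the loop and the polygon
    agree at the two ends. *)
Lemma sphere_loop_contract : exists H : R * R -> 'rV[R]_n.+3,
  [/\ continuous H, forall z, sphere R n.+2 (H z),
      forall t, 0 <= t <= 1 -> H (0, t) = c t,
      forall t, 0 <= t <= 1 -> H (1, t) = c 0
    & forall s, H (s, 0) = c 0 /\ H (s, 1) = c 0].
Proof.
have [N N0 qc] := pl_loop_approx; have [p p1 qp] := pl_loop_avoid N0.
pose q := pl_loop N.
have q_neq0 t : q t != 0.
  by apply: contraTneq (qc t) => q0; rewrite -/(q t) q0 dotv0l ltxx.
have N0' : N%:R != 0 :> R by rewrite pnatr_eq0 -lt0n.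
have q00 : q 0 = c 0 by have := pl_loop_nat ord0 N0; rewrite mul0r.
have q01 : q 1 = c 1 by have := pl_loop_nat ord_max N0; rewrite divff.
have normc t : normalize (c t) = c t by apply: normalize_id; apply/enorm_eq1.
pose qn t := normalize (q t).
have qn1 t : dotv (qn t) (qn t) = 1 by apply/enorm_eq1/normalize_sphere.
have qn_cont : continuous qn.
  by move=> t; apply: continuous_normalize => //; exact: continuous_pl_loop.
have qn0 : qn 0 = c 0 by rewrite /qn q00 normc.
have qn01 : qn 1 = c 0 by rewrite /qn q01 normc c_loop.
pose sg1 (s : R) := clamp (2 * s); pose sg2 (s : R) := clamp (2 * s - 1).
pose h1 (z : R * R) := (1 - sg1 z.1) *: c (clamp z.2) + sg1 z.1 *: q (clamp z.2).
pose h2 (z : R * R) := (1 - sg2 z.1) *: stereo p (qn (clamp z.2))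
  + sg2 z.1 *: stereo p (c 0).
have h1_neq0 z : h1 z != 0.
  have /andP[s0 s1] := clamp_itv (2 * z.1).
  suff : 0 < dotv (h1 z) (c (clamp z.2)).
    by apply: contraTneq => ->; rewrite dotv0l ltxx.
  have := qc (clamp z.2); rewrite (clamp_id (clamp_itv _)) -/(q _) => qcz.
  rewrite dotvDl !dotvZl c_unit mulr1 -/(sg1 _) in s0 s1 *.
  have [->|sn0] := eqVneq (sg1 z.1) 0; first by rewrite mul0r; lra.
  by rewrite ltr_wpDl ?subr_ge0// mulr_gt0// lt_neqAle eq_sym sn0.
have h2_neq0 z : stereo_inv p (h2 z) != 0.
  apply: stereo_inv_neq0 => //; rewrite /h2 dotvDl dotvZl [X in _ + X]dotvZl.
  by rewrite !stereo_orthogonal// !mulr0 addr0.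
have cont2 (f : R -> 'rV[R]_n.+3) : continuous f ->
    continuous (fun z : R * R => f (clamp z.2)).
  move=> cf z; apply: (@continuous_comp _ _ _ (fun z : R * R => clamp z.2) f).
    by apply: continuous_clamp; exact: cvg_snd.
  exact: cf.
have sg1_cont : continuous (fun z : R * R => sg1 z.1).
  move=> z; apply: (@continuous_clamp R _ (fun z : R * R => 2 * z.1)).
  apply: cvgM; first exact: cvg_cst.
  exact: cvg_fst.
have sg2_cont : continuous (fun z : R * R => sg2 z.1).
  move=> z; apply: (@continuous_clamp R _ (fun z : R * R => 2 * z.1 - 1)).
  apply: cvgB; last exact: cvg_cst.
  by apply: cvgM; [exact: cvg_cst|exact: cvg_fst].
pose H1 z := normalize (h1 z); pose H2 z := normalize (stereo_inv p (h2 z)).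
have H1_cont : continuous H1.
  move=> z; apply: continuous_normalize => //; apply: cvgD.
    apply: cvgZ; last exact: (cont2 c).
    by apply: cvgB; [exact: cvg_cst|exact: sg1_cont].
  by apply: cvgZ; [exact: sg1_cont|apply: (cont2 q); exact: continuous_pl_loop].
have qnp t : dotv (qn t) p != 1 by rewrite lt_eqF// dotv_lt1// qp.
have H2_cont : continuous H2.
  move=> z; apply: (@continuous_normalize R _ _ (fun z => stereo_inv p (h2 z))) => //.
  apply: (@continuous_stereo_inv R _ p _ h2).
  apply: cvgD; last by apply: cvgZ; [exact: sg2_cont|exact: cvg_cst].
  apply: cvgZ; first by apply: cvgB; [exact: cvg_cst|exact: sg2_cont].
  apply: (@continuous_stereo R _ p _ (fun z : R * R => qn (clamp z.2))) => //.
  exact: (cont2 qn).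
have H2_0 z : sg2 z.1 = 0 -> H2 z = qn (clamp z.2).
  move=> s0; rewrite /H2 /h2 s0 subr0 scale1r scale0r addr0 stereoK//.
  exact: qp.
have H2_1 z : sg2 z.1 = 1 -> H2 z = c 0.
  move=> s1; rewrite /H2 /h2 s1 subrr scale0r scale1r add0r stereoK//.
  by rewrite -qn0; exact: qp.
have H1_1 z : sg1 z.1 = 1 -> H1 z = qn (clamp z.2).
  by move=> s1; rewrite /H1 /h1 s1 subrr scale0r scale1r add0r.
(* At every time one of the first two terms is equal to the third one. *)
pose h z := H1 z + H2 z - qn (clamp z.2).
have hE z : h z = H2 z \/ h z = H1 z.
  have [z2|z2] := lerP z.1 (1 / 2).
    right; rewrite /h H2_0 ?addrK//; apply: clamp_le0; lra.
  by left; rewrite /h H1_1 1?addrC ?addKr//; apply: clamp_ge1; lra.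
have hS z : sphere R n.+2 (h z) by case: (hE z) => ->; exact: normalize_sphere.
exists h; split=> // [|t t01|t t01|s].
- move=> z; apply: cvgB; last exact: (cont2 qn).
  by apply: cvgD; [exact: H1_cont|exact: H2_cont].
- have s0 : sg2 0 = 0 by apply: clamp_le0; lra.
  rewrite /h H2_0// addrK /H1 /h1 /sg1 /= clamp_id; last by rewrite mulr0 lexx ler01.
  by rewrite mulr0 subr0 scale1r scale0r addr0 normc clamp_id.
- have s1 : sg1 1 = 1 by apply: clamp_ge1; lra.
  have s2 : sg2 1 = 1 by apply: clamp_ge1; lra.
  by rewrite /h H1_1// H2_1// addrC addKr.
- have c0 : clamp (0 : R) = 0 by apply: clamp_le0.
  have c1 : clamp (1 : R) = 1 by apply: clamp_ge1.
  have end0 u t : c (clamp t) = c 0 -> q (clamp t) = c 0 -> h (u, t) = c 0.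
    move=> ct qt.
    have H1E : H1 (u, t) = c 0.
      by rewrite /H1 /h1 /= ct qt -scalerDl subrK scale1r normc.
    have qnE : qn (clamp t) = c 0 by rewrite /qn qt normc.
    have H2E : H2 (u, t) = c 0.
      rewrite /H2 /h2 /= qnE -scalerDl subrK scale1r stereoK//.
      by rewrite -qn0; exact: qp.
    by rewrite /h H1E H2E qnE addrK.
  by split; apply: end0; rewrite ?c0 ?c1// q01.
Qed.

End SphereLoop.

Lemma sphere_simply_connected (R : realType) n :
  simply_connected R (sphere R n.+2).
Proof.
split.
- by exists (normalizeS (0 : 'rV[R]_n.+3)).
- move=> x y; have [u [u0 ux uy]] := exists_orthogonal (val x) (val y).
  have xS : sphere R n.+2 (val x) := set_mem (valP x).
  have yS : sphere R n.+2 (val y) := set_mem (valP y).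
  (* The bump along [u], orthogonal to both ends, keeps the segment away from the origin even when
     the ends are antipodal. *)
  pose f (t : R) := (1 - t) *: val x + t *: val y + (t * (1 - t)) *: u.
  have f0 : f 0 = val x by rewrite /f subr0 scale1r scale0r mul0r scale0r !addr0.
  have f1 : f 1 = val y.
    by rewrite /f subrr scale1r scale0r mulr0 scale0r add0r addr0.
  have f_neq0 t : f t != 0.
    have [->|t0] := eqVneq t 0; first by rewrite f0; exact: sphere_neq0 xS.
    have [->|t1] := eqVneq t 1; first by rewrite f1; exact: sphere_neq0 yS.
    apply: contraNneq u0 => /(congr1 (dotv u)).
    rewrite /f !dotvDr !dotvZr ux uy !mulr0 !add0r dotv0r => /eqP.
    rewrite !mulf_eq0 (negPf t0) subr_eq0 eq_sym (negPf t1) /=.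
    by rewrite dotvv_eq0.
  exists (fun t => normalizeS (f t)); split.
  + apply: continuous_subspaceT => t; apply: continuous_normalizeS => //.
    have cid : {for t, continuous (fun t : R => t)} by exact: cvg_id.
    have c1t : {for t, continuous (fun t : R => 1 - t)}.
      by apply: cvgB; [exact: cvg_cst|exact: cid].
    apply: cvgD; last by apply: cvgZ; [exact: cvgM|exact: cvg_cst].
    by apply: cvgD; apply: cvgZ => //; exact: cvg_cst.
  + by apply: val_inj; rewrite /= f0 normalize_id.
  + by apply: val_inj; rewrite /= f1 normalize_id.
- move=> c cc c01.
  have clamp_cont : continuous (@clamp R).
    by move=> t; apply: (@continuous_clamp R _ id); exact: cvg_id.
  have clamp01 (t : R) : `[0, 1]%classic (clamp t) by rewrite /= in_itv /= clamp_itv.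
  have cc' := continuous_comp_within cc clamp_cont clamp01.
  have cl_cont : continuous (fun t : R => val (c (clamp t))).
    move=> t; apply: (@continuous_comp _ _ _ (c \o @clamp R) val).
      exact: cc'.
    exact: continuous_val.
  have c0 : clamp (0 : R) = 0 by apply: clamp_le0.
  have c1 : clamp (1 : R) = 1 by apply: clamp_ge1.
  have [|| H [Hc HS H0 H1 H01]] := @sphere_loop_contract R n _ cl_cont.
  + by move=> t; apply/enorm_eq1; exact: (set_mem (valP (c (clamp t)))).
  + by rewrite c0 c1 c01.
  exists (fun z => SigSub (mem_set (HS z))); split.
  + by apply: continuous_subspaceT => z; apply/continuous_subtypeP; exact: Hc.
  + by move=> t; rewrite inE => t01; apply: val_inj; rewrite /= H0// clamp_id.
  + by move=> t; rewrite inE => t01; apply: val_inj; rewrite /= H1// c0.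
  + by move=> s _; have [Hs0 Hs1] := H01 s; split; apply: val_inj; rewrite /= ?Hs0 ?Hs1 c0.
Qed.

Lemma continuous_within_comp (T X Y : topologicalType) (A : set T) (f : T -> X)
    (g : X -> Y) : {within A, continuous f} -> continuous g ->
  {within A, continuous (g \o f)}.
Proof. by move=> cf cg t; exact: (cvg_comp _ _ (cf t) (cg (f t))). Qed.

Lemma simply_connected_homeomorphic (R : realType) (X Y : topologicalType) :
  homeomorphic X Y -> simply_connected R Y -> simply_connected R X.
Proof.
move=> [f [g [cf cg fK gK]]] [[y0 _] pY sY]; split.
- by exists (g y0).
- move=> x y; have [c [cc c0 c1]] := pY (f x) (f y).
  exists (g \o c); split; [|by rewrite /= c0 fK|by rewrite /= c1 fK].
  exact: (continuous_within_comp cc cg).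
- move=> c cc c01; have [| |H [cH H0 H1 H01]] := sY (f \o c).
  + exact: (continuous_within_comp cc cf).
  + by rewrite /= c01.
  exists (g \o H); split=> [|t t01|t t01|s s01] /=.
  + exact: (continuous_within_comp cH cg).
  + by rewrite H0// fK.
  + by rewrite H1// fK.
  + by have [-> ->] := H01 s s01; rewrite /= fK.
Qed.

(** * Two-fold coverings and projective space *)

Lemma inj_surj_bijective (X Y : Type) (f : X -> Y) :
  injective f -> (forall y, exists x, f x = y) -> bijective f.
Proof.
by move=> fI /choice[g gK]; exists g => // x; apply: fI; rewrite gK.
Qed.

Section TwoFoldCovering.
Variables (X Y : topologicalType) (q : X -> Y) (sg : X -> X).
Hypotheses (cX : compact [set: X]) (hX : hausdorff_space X) (hY : hausdorff_space Y).
Hypotheses (q_cont : continuous q) (q_surj : forall y, exists x, q x = y).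
Hypotheses (sg_cont : continuous sg) (sgK : involutive sg).
Hypotheses (sg_free : forall x, sg x <> x).
Hypothesis qP : forall x y, q x = q y <-> (y = x \/ y = sg x).

(** The complement of the image is the image of the complement of the saturated set formed by [O]
    and its translate; that set is compact, so its image is closed. *)
Lemma two_fold_open (O : set X) : open O -> open (q @` O).
Proof.
move=> oO; rewrite -closedC.
have -> : ~` (q @` O) = q @` (~` (O `|` sg @^-1` O)).
  apply/seteqP; split=> [y yO|_ [x xO <-] [z zO /qP[]zx]].
  - have [x qx] := q_surj y; exists x => // -[xO|xO]; apply: yO.
      by exists x.
    by exists (sg x) => //; rewrite -qx; apply/qP; right; rewrite sgK.
  - by apply: xO; left; rewrite zx.
  - by apply: xO; right; rewrite /= zx sgK.
apply: (compact_closed hY); apply: continuous_compact.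
  exact: continuous_subspaceT.
apply: (subclosed_compact _ cX) => //; rewrite closedC; apply: openU => //.
by move/continuousP: sg_cont; apply.
Qed.

Lemma two_fold_covering : covering_map q.
Proof.
split=> //; first by apply/seteqP; split=> // y _; have [x <-] := q_surj y; exists x.
move=> y; have [x qx] := q_surj y.
have xsg : x != sg x by apply/eqP => e; apply: (sg_free (x := x)).
have := hX; rewrite open_hausdorff => /(_ x (sg x) xsg).
move=> [[A B] /= [/set_mem Ax /set_mem Bx] [oA oB AB0]].
pose V := A `&` sg @^-1` B.
have oV : open V by apply: openI => //; move/continuousP: sg_cont; apply.
have Vx : V x by [].
have Vsg z : V z -> ~ V (sg z).
  move=> [Az Bz] [Asz _]; suff : set0 (sg z) by [].
  by rewrite -(eqP AB0).
pose V' := sg @^-1` V.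
have oV' : open V' by move/continuousP: sg_cont; apply.
pose g y := xget x [set z | V z /\ q z = y].
have gP z : (q @` V) z -> V (g z) /\ q (g z) = z.
  by move=> [w Vw qw]; apply: (@xgetPex _ x [set z' | V z' /\ q z' = z]); exists w.
have gq z : V z -> g (q z) = z.
  move=> Vz; have [|Vg qg] := gP (q z); first by exists z.
  by move/qP: qg => [/esym//|zE]; case: (Vsg _ Vg); rewrite -zE.
have oU : open (q @` V) by exact: two_fold_open.
have g_cont : {within q @` V, continuous g}.
  rewrite continuous_open_subspace//; apply/continuous_inP => // O oO.
  have -> : q @` V `&` g @^-1` O = q @` (V `&` O).
    apply/seteqP; split=> [z [Uz Oz]|_ [z [Vz Oz] <-]].
      by have [Vg qg] := gP _ Uz; exists (g z).
    by split; [exists z|rewrite /= gq].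
  by apply: two_fold_open; exact: openI.
exists (q @` V); split=> //; first by exists x.
exists [set V; V']; split.
- by move=> _ [->|->].
- move=> _ _ [->|->] [->|->] [z [z1 z2]] //=.
    by case: (Vsg _ z1).
  by case: (Vsg _ z2).
- apply/seteqP; split=> [z [w Vw /qP[]zE]|z [_ [->|->] Vz]].
  + by exists V; [left|rewrite zE].
  + by exists V'; [right|rewrite /V' /= zE sgK].
  + by exists z.
  + by exists (sg z) => //; apply/qP; right; rewrite sgK.
- move=> _ [->|->]; first by exists g; split.
  exists (sg \o g); split.
  + exact: (continuous_within_comp g_cont sg_cont).
  + move=> z /gP[Vg qg]; rewrite /V' /= sgK; split=> //.
    by rewrite -[in RHS]qg; apply/qP; right; rewrite sgK.
  + move=> z Vz /=; rewrite -[RHS]sgK; congr (sg _).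
    by rewrite -[RHS](gq _ Vz); congr (g _); apply/qP; right.
Qed.

End TwoFoldCovering.

(** The map induced by [g] goes from the compact quotient to the Hausdorff space [Z], so no
    separation property of the quotient has to be proved beforehand. *)
Lemma homeomorphic_RP (R : realType) n (Z : topologicalType) (g : sphere R n -> Z) :
  hausdorff_space Z -> continuous g -> (forall z, exists x, g x = z) ->
  (forall x y, g x = g y <-> antipodal x y) ->
  homeomorphic Z (RP R n).
Proof.
move=> hZ cg sg gP.
have pi_eq (x y : sphere R n) : (\pi_(RP R n) x == \pi_(RP R n) y)%qT = antipodal x y.
  have := @eqmodP _ (antipodal_equiv_rel R n) x y => mP.
  by apply/eqP/idP => [e|e]; apply/mP.
have cf : continuous (g \o repr : RP R n -> Z).
  apply: repr_comp_continuous => // x y; rewrite pi_eq => /gP->.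
  exact: eqxx.
have cRP : compact [set: RP R n].
  have -> : [set: RP R n] = (\pi_(RP R n))%qT @` [set: sphere R n].
    by apply/seteqP; split=> // z _; exists (repr z) => //; rewrite reprK.
  apply: continuous_compact; first exact/continuous_subspaceT/pi_continuous.
  exact/compact_subtype/compact_sphere.
have bf : bijective (g \o repr : RP R n -> Z).
  apply: inj_surj_bijective.
  - by move=> x y /= /gP; rewrite -pi_eq !reprK => /eqP.
  - move=> z; have [x <-] := sg z; exists (\pi_(RP R n) x)%qT => /=.
    by apply/gP; rewrite -pi_eq reprK.
have [f' [g' [cf' cg' fK gK]]] := homeomorphic_compact cRP hZ cf bf.
by exists g', f'; split.
Qed.

(** * The boundary complex as a double covering *)

Lemma continuous_coord_val (R : realType) m (A : set 'rV[R]_m) i :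
  continuous (fun y : A => val y 0 i).
Proof.
by move=> x; apply: (continuous_rowP (val : A -> _) x).1; exact: continuous_val.
Qed.

Section FacetSphere.
Variables (R : realType) (n m r : nat) (J : finType).
Variables (v : 'I_m -> 'rV[R]_n.+1) (c : J -> 'rV[R]_n.+1) (j0 : J).
Hypothesis sys : facet_system v c.
Variable opp : 'I_m -> 'I_m.
Hypotheses (oppK : involutive opp) (v_opp : forall i, v (opp i) = - v i).
Hypothesis facet_opp : forall j, exists j', forall i,
  (i \in facet_of v c j') = (opp i \in facet_of v c j).
Hypothesis facet_acute : forall j i k, i \in facet_of v c j ->
  k \in facet_of v c j -> 0 < dotv (v i) (v k).
Hypothesis opp_free : forall i, opp i != i.
Variable p : 'I_m -> 'I_r.
Hypothesis pP : forall i k, (p i == p k) = (i == k) || (i == opp k).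

Let L := facet_complex v c.
Let K : {set {set 'I_r}} := [set (p @: s)%SET | s : {set 'I_m} in L]%SET.

Lemma realization_cone (x : 'rV[R]_m) : realization R L x ->
  exists2 j, cone_coord v c j (x 0) & \sum_i x 0 i = 1.
Proof.
move=> [x0 x1 /facet_complexP[j xj]]; exists j => //; split=> // i.
by apply: contraNeq => xi; apply: (fintype.subsetP xj); rewrite finset.inE.
Qed.

Lemma cone_realization j (x : 'rV[R]_m) : cone_coord v c j (x 0) ->
  \sum_i x 0 i = 1 -> realization R L x.
Proof.
move=> [x0 xj] x1; split=> //; apply/facet_complexP; exists j.
by apply/fintype.subsetP => i; rewrite finset.inE; apply: contraNT => /xj->.
Qed.

Lemma realization_lincomb_neq0 x : realization R L x -> lincomb v (x 0) != 0.
Proof.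
move=> /realization_cone[j [_ xj] x1].
have := dotv_facet (c := c) xj; rewrite x1; apply: contra_eqN => /eqP->.
by rewrite dotv0r eq_sym oner_eq0.
Qed.

Definition radial (x : realization R L) : sphere R n :=
  normalizeS (lincomb v (val x 0)).

Lemma radial_continuous : continuous radial.
Proof.
move=> x; apply: continuous_normalizeS; last first.
  exact: realization_lincomb_neq0 (set_mem (valP x)).
apply: continuous_sum => i _; apply: continuousZ; last exact: cst_continuous.
exact: continuous_coord_val.
Qed.

(** Points in the same direction have proportional cone coordinates by [cone_coord_uniq], and the
    barycentric sum 1 fixes the factor. *)
Lemma radial_inj : injective radial.
Proof.
move=> x y /(congr1 val) /=; rewrite /normalize.
have xR := set_mem (valP x); have yR := set_mem (valP y).
rewrite (negPf (realization_lincomb_neq0 xR)) (negPf (realization_lincomb_neq0 yR)).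
have := realization_lincomb_neq0 xR; have := realization_lincomb_neq0 yR.
rewrite -!enorm_gt0; set a := enorm _ => a0; set b := enorm _ => b0 xy.
have [j [x0 xj] x1] := realization_cone xR.
have [j' [y0 yj] y1] := realization_cone yR.
have := cone_coord_uniq sys (j := j) (j' := j')
  (a := fun i => b^-1 * val x 0 i) (b := fun i => a^-1 * val y 0 i).
rewrite !lincombZ => e.
have {e xy} e : forall i, b^-1 * val x 0 i = a^-1 * val y 0 i.
  apply: e => //; split=> i.
  - by rewrite mulr_ge0// invr_ge0 ltW.
  - by move/xj->; rewrite mulr0.
  - by rewrite mulr_ge0// invr_ge0 ltW.
  - by move/yj->; rewrite mulr0.
have : b^-1 * \sum_i val x 0 i = a^-1 * \sum_i val y 0 i.
  by rewrite !mulr_sumr; apply: eq_bigr.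
rewrite x1 y1 !mulr1 => ab; apply: val_inj; apply/rowP => i.
by have := e i; rewrite ab => /mulfI; apply; rewrite invr_eq0 gt_eqF.
Qed.

Lemma radial_surj y : exists x, radial x = y.
Proof.
have [j [a [[a0 aj] yE]]] := cone_cover sys j0 (val y).
have yS : sphere R n (val y) := set_mem (valP y).
have y0 := sphere_neq0 yS.
have S0 : 0 < \sum_i a i.
  rewrite lt_neqAle sumr_ge0// andbT eq_sym psumr_eq0//.
  apply: contra y0 => /allP a_eq0; rewrite yE /lincomb big1// => i _.
  by rewrite (eqP (a_eq0 i _)) ?mem_index_enum// scale0r.
pose x : 'rV[R]_m := \row_i ((\sum_i a i)^-1 * a i).
have xR : realization R L x.
  apply: (@cone_realization j).
    split=> i; rewrite mxE; first by rewrite mulr_ge0// invr_ge0 ltW.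
    by move/aj->; rewrite mulr0.
  under eq_bigr do rewrite mxE.
  by rewrite -mulr_sumr mulVf// gt_eqF.
exists (SigSub (mem_set xR)); apply: val_inj; rewrite /=.
have -> : lincomb v (x 0) = (\sum_i a i)^-1 *: val y.
  by rewrite yE -lincombZ; apply: eq_bigr => i _; rewrite mxE.
by rewrite normalizeZ ?invr_gt0// normalize_id.
Qed.

Lemma L_sub (s t : {set 'I_m}) : s \in L -> t \subset s -> t \in L.
Proof. exact: facet_complexS. Qed.

Lemma radial_bij : bijective radial.
Proof. exact: inj_surj_bijective radial_inj radial_surj. Qed.

Lemma homeomorphic_sphere : homeomorphic (realization R L) (sphere R n).
Proof.
apply: homeomorphic_compact radial_continuous radial_bij.
  exact/compact_subtype/compact_realization/L_sub.
exact/hausdorff_subtype/hausdorff_rV.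
Qed.

Lemma opp_realization (x : realization R L) :
  realization R L (\row_i val x 0 (opp i)).
Proof.
have [j [x0 xj] x1] := realization_cone (set_mem (valP x)).
have [j' jj'] := facet_opp j; apply: (@cone_realization j').
  by split=> i; rewrite mxE// jj'; exact: xj.
rewrite -x1 [RHS](reindex_inj (inv_inj oppK)).
by apply: eq_bigr => i _; rewrite mxE.
Qed.

Definition antipode (x : realization R L) : realization R L :=
  SigSub (mem_set (opp_realization x)).

Lemma antipodeK : involutive antipode.
Proof. by move=> x; apply: val_inj; apply/rowP => i; rewrite !mxE oppK. Qed.

Lemma antipode_continuous : continuous antipode.
Proof.
move=> x; apply/continuous_subtypeP; apply/continuous_rowP => i /=.
rewrite (_ : (fun _ => _) = (fun y : realization R L => val y 0 (opp i))).
  exact: continuous_coord_val.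
by apply/funext => y; rewrite /= mxE.
Qed.

Lemma radial_antipode x : val (radial (antipode x)) = - val (radial x).
Proof.
rewrite /= -normalizeN ?(realization_lincomb_neq0 (set_mem (valP x)))//.
congr normalize; rewrite /lincomb (reindex_inj (inv_inj oppK)) -sumrN.
by apply: eq_bigr => i _; rewrite mxE oppK v_opp scalerN.
Qed.

Lemma antipode_free x : antipode x <> x.
Proof.
move=> e; have := radial_antipode x; rewrite e => /eqP.
rewrite -addr_eq0 -mulr2n -scaler_nat scaler_eq0 pnatr_eq0 /=.
by rewrite (negPf (sphere_neq0 (set_mem (valP (radial x))))).
Qed.

Lemma realization_map_p (x : 'rV[R]_m) l :
  realization_map p x 0 (p l) = x 0 l + x 0 (opp l).
Proof.
rewrite mxE (bigD1 l)//= (bigD1 (opp l)) /=; last first.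
  by rewrite pP eqxx orbT opp_free.
by rewrite big1 ?addr0// => i; rewrite pP -andbA; case: eqVneq => //= _;
  case: eqVneq.
Qed.

Lemma realization_map_supp (x : 'rV[R]_m) : (forall i, 0 <= x 0 i) ->
  [set k | realization_map p x 0 k != 0]%SET = (p @: [set i | x 0 i != 0])%SET.
Proof.
move=> x0; apply/setP => k; rewrite finset.inE mxE psumr_neq0//.
apply/hasP/imsetP => [[i _ /andP[/eqP ki xi]]|[i]].
  by exists i => //; rewrite finset.inE gt_eqF.
rewrite finset.inE => xi ->; exists i; rewrite ?mem_index_enum//= eqxx /=.
by rewrite lt_neqAle eq_sym xi x0.
Qed.

Lemma realization_map_in (x : realization R L) :
  realization R K (realization_map p (val x)).
Proof.
have [x0 x1 xL] := set_mem (valP x); split=> [k||].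
- by rewrite mxE sumr_ge0.
- rewrite -x1 (partition_big p xpredT)//=.
  by apply: eq_bigr => k _; rewrite mxE.
- by rewrite realization_map_supp//; apply: imset_f.
Qed.

Definition cover (x : realization R L) : realization R K :=
  SigSub (mem_set (realization_map_in x)).

Lemma cover_continuous : continuous cover.
Proof.
move=> x; apply/continuous_subtypeP; apply/continuous_rowP => k /=.
rewrite (_ : (fun _ => _) =
    (fun y : realization R L => \sum_(i | p i == k) val y 0 i)); last first.
  by apply/funext => y; rewrite /= mxE.
by apply: continuous_sum => i _; exact: continuous_coord_val.
Qed.

(* Acuteness forbids a face from meeting both [l] and [opp l] in the link of
   [i], so that a common vertex pins down the lifts of all the others. *)
Lemma cover_inj_at (x y : realization R L) i : cover x = cover y ->
  val x 0 i != 0 -> val y 0 i != 0 -> x = y.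
Proof.
move=> /(congr1 val) /= exy xi yi; apply: val_inj; apply/rowP => l.
have acute (z : realization R L) k : val z 0 i != 0 -> val z 0 k != 0 ->
    0 < dotv (v i) (v k).
  have [_ _ /facet_complexP[j /fintype.subsetP zj]] := set_mem (valP z) => zi zk.
  by apply: (@facet_acute j); apply: zj; rewrite finset.inE.
have acuteN (z : realization R L) k : val z 0 i != 0 -> 0 < dotv (v i) (v k) ->
    val z 0 (opp k) = 0.
  move=> zi ik; apply/eqP; apply: contraTT ik => /(acute _ _ zi).
  by rewrite v_opp dotvNr oppr_gt0 -leNgt => /ltW.
have := congr1 (fun z : 'rV[R]_r => z 0 (p l)) exy; rewrite !realization_map_p.
have [xl|xl] := eqVneq (val x 0 l) 0; last first.
  by rewrite !(acuteN _ l _ (acute x l xi xl))// !addr0.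
have [yl|yl] := eqVneq (val y 0 l) 0; first by rewrite xl yl.
by rewrite !(acuteN _ l _ (acute y l yi yl))// !addr0.
Qed.

Lemma cover_antipode x : cover (antipode x) = cover x.
Proof.
apply: val_inj; apply/rowP => k; rewrite !mxE /=.
rewrite [RHS](reindex_inj (inv_inj oppK)) /=.
apply: eq_big => i; first by have /eqP-> : p (opp i) == p i by rewrite pP eqxx orbT.
by rewrite mxE.
Qed.

Lemma coverP x y : cover x = cover y <-> (y = x \/ y = antipode x).
Proof.
split=> [exy|[->//|->]]; last by rewrite cover_antipode.
have [x0 x1 _] := set_mem (valP x).
have [i xi] : exists i, val x 0 i != 0.
  apply/existsP; apply: contraPT x1 => /existsPn xz; rewrite big1.
    by move/esym/eqP; rewrite oner_eq0.
  by move=> i _; apply/eqP; have := xz i; rewrite negbK.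
have xp : realization_map p (val x) 0 (p i) != 0.
  by rewrite realization_map_p paddr_eq0// (negPf xi).
have : realization_map p (val y) 0 (p i) != 0.
  by have /(congr1 val) /= <- := exy.
(* Without weight at [i], [y] has weight at [opp i]; then [antipode y] shares the vertex [i] with
   [x]. *)
rewrite realization_map_p; have [yi|yi _] := eqVneq (val y 0 i) 0.
  rewrite yi add0r => yoi; right; rewrite -[y]antipodeK; congr antipode.
  apply/esym/(cover_inj_at (i := i)) => //; first by rewrite cover_antipode.
  by rewrite /= mxE.
by left; apply/esym/(cover_inj_at (i := i)).
Qed.

(** A face [s] over the support of [z] never contains both [i] and [opp i], whose angle is not
    acute, so the weights of [z] lift unchanged to [s]. *)
Lemma cover_surj z : exists x, cover x = z.
Proof.
have [z0 z1 /imsetP[s /facet_complexP[j sj] zs]] := set_mem (valP z).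
have /fintype.subsetP sj' := sj.
have oppj i : i \in facet_of v c j -> opp i \notin facet_of v c j.
  move=> ij; apply/negP => oj; have := facet_acute ij oj.
  by rewrite v_opp dotvNr oppr_gt0 ltNge dotvv_ge0.
pose x : 'rV[R]_m := \row_i (if i \in s then val z 0 (p i) else 0).
have xz : realization_map p x = val z.
  apply/rowP => k; have [zk|zk] := eqVneq (val z 0 k) 0.
    rewrite mxE zk big1// => i /eqP ik; rewrite mxE ik zk.
    by case: ifP.
  have : k \in (p @: s)%SET by rewrite -zs finset.inE.
  case/imsetP => i si ->; rewrite realization_map_p !mxE si.
  have /negPf-> : opp i \notin s.
    by apply: contra (oppj _ (sj' _ si)) => /sj'.
  by rewrite addr0.
have x0 i : 0 <= x 0 i by rewrite mxE; case: ifP.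
have xR : realization R L x.
  apply: (@cone_realization j).
    split=> // i ij; rewrite mxE; case: ifPn => // si.
    by rewrite (sj' _ si) in ij.
  rewrite -z1 -xz (partition_big p xpredT)//=.
  by apply: eq_bigr => k _; rewrite mxE.
by exists (SigSub (mem_set xR)); apply: val_inj; rewrite /= xz.
Qed.

Let cL : compact [set: realization R L].
Proof. exact/compact_subtype/compact_realization/L_sub. Qed.

Let hK : hausdorff_space (realization R K).
Proof. exact/hausdorff_subtype/hausdorff_rV. Qed.

Lemma cover_covering : covering_map cover.
Proof.
apply: (@two_fold_covering _ _ cover antipode) => //.
- exact/hausdorff_subtype/hausdorff_rV.
- exact: cover_continuous.
- exact: cover_surj.
- exact: antipode_continuous.
- exact: antipodeK.
- exact: antipode_free.
- exact: coverP.
Qed.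

(** Transported to the sphere by the inverse of [radial], the map [cover] identifies exactly the
    antipodal points. *)
Lemma quotient_homeomorphic_RP : homeomorphic (realization R K) (RP R n).
Proof.
have [psi radK psiK] := radial_bij.
have psi_cont : continuous psi.
  apply: (compact_bij_continuous cL _ radial_continuous radK psiK).
  exact/hausdorff_subtype/hausdorff_rV.
apply: (homeomorphic_RP (g := cover \o psi)) => //.
- by move=> y; apply: continuous_comp; [exact: psi_cont|exact: cover_continuous].
- move=> z; have [x <-] := cover_surj z; exists (radial x).
  by rewrite /= radK.
move=> x y /=; rewrite coverP /antipodal; split.
  move=> [/(can_inj psiK)->|]; first by rewrite eqxx.
  move=> /(congr1 radial); rewrite psiK => ->.
  by rewrite radial_antipode psiK opprK eqxx orbT.
case/orP => /eqP xy; [left; congr psi|right].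
  by apply: val_inj.
rewrite -[RHS]radK; congr psi; apply: val_inj.
by rewrite radial_antipode psiK xy opprK.
Qed.

Lemma facet_universal_covering : simplicial_complex L ->
  simply_connected R (sphere R n) -> universal_covering R L K p.
Proof.
move=> Lsimp Ssc; split=> //.
- by move=> s sL; apply: imset_f.
- exact: simply_connected_homeomorphic homeomorphic_sphere Ssc.
- by exists cover; [|exact: cover_covering].
Qed.

End FacetSphere.

(** * Combinatorial data *)

(* The vertices of the polytope are the subsets of odd size of ['I_6].  The
   [k]-th one, [k < 32], has the binary digits of [k] as the indicators of
   0, ..., 4, and the membership of 5 is determined by parity. *)
Definition odd_bits (k : nat) : seq bool :=
  let b := [:: odd k; odd k./2; odd k./2./2; odd k./2./2./2; odd k./2./2./2./2] in
  rcons b (~~ foldr addb false b).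

Definition vmem (k i : nat) : bool := nth false (odd_bits k) i.

Definition vcard (k : nat) : nat := count id (odd_bits k).

Definition root5 := (int * int)%type.

(* A pair [(a, b)] stands for [a + b * sqrt 5]; functionals on the hyperplane of
   sum zero in dimension 6 are given by their coordinates times 12. *)
Definition functional1 (i j : nat) : seq root5 :=
  mkseq (fun x => if x == i then (0, 2%:Z) else if x == j then (8%:Z, - 2%:Z)
    else (- 2%:Z, 0)) 6.

(** Ordered triples of distinct indices give 120 of these, and ordered pairs give 30 of the first
    kind: the lengths of the two simplex orbits. *)
Definition functional2 (i j n : nat) : seq root5 :=
  mkseq (fun x => if x == i then (0, 2%:Z) else if x == j then (0, - 2%:Z)
    else if x == n then (9%:Z, - 3%:Z) else (- 3%:Z, 1)) 6.

Definition half_functionals : seq (seq root5) :=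
  flatten [seq functional1 ij.1 ij.2 ::
      [seq functional2 ij.1 ij.2 n | n <- iota 0 6 & (n != ij.1) && (n != ij.2)]
    | ij <- [seq (i, j) | i <- iota 0 6, j <- iota 0 6] & ij.1 != ij.2].

Definition functionals : seq (seq root5) :=
  half_functionals ++ [seq [seq (- ab.1, - ab.2) | ab <- c] | c <- half_functionals].

Definition vsum (c : seq root5) (k : nat) : root5 :=
  foldr (fun x ab => if vmem k x then ((nth (0, 0) c x).1 + ab.1,
    (nth (0, 0) c x).2 + ab.2) else ab) (0, 0) (iota 0 6).

(* A positive multiple of the value of the functional at the vertex, minus 1;
   vertices of size 1 and 5 are scaled by [3 / sqrt 5]. *)
Definition excess (c : seq root5) (k : nat) : root5 :=
  let ab := vsum c k in
  if vcard k == 3%N then (ab.1 - 6%:Z, ab.2) else (5%:Z * ab.2 - 10%:Z, ab.1).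

(* Sufficient for [a + b * sqrt 5 < 0], as [11 / 5 < sqrt 5 < 9 / 4]. *)
Definition root5_neg (ab : root5) : bool :=
  (4%:Z * ab.1 + 9%:Z * ab.2 < 0) && (5%:Z * ab.1 + 11%:Z * ab.2 < 0).

Definition facet_list (c : seq root5) : seq nat :=
  [seq k <- iota 0 32 | excess c k == (0, 0)].

Definition facet_lists : seq (seq nat) := [seq facet_list c | c <- functionals].

(** Six times the inner product of the projections of two sign vectors to the hyperplane of sum
    zero, which keeps it an integer. *)
Definition vgram (k l : nat) : int :=
  let sg (b : bool) : int := if b then 1 else -1 in
  6%:Z * foldr (fun x s => sg (vmem k x) * sg (vmem l x) + s) 0 (iota 0 6)
  - foldr (fun x s => sg (vmem k x) + s) 0 (iota 0 6)
    * foldr (fun x s => sg (vmem l x) + s) 0 (iota 0 6).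

Lemma functionals_excess :
  all (fun c => all (fun k => (excess c k == (0, 0)) || root5_neg (excess c k))
    (iota 0 32)) functionals.
Proof. by vm_compute. Qed.

Lemma functionals_sum0 : all (fun c => (foldr (fun x s => (nth (0, 0) c x).1 + s) 0 (iota 0 6) == 0)
    && (foldr (fun x s => (nth (0, 0) c x).2 + s) 0 (iota 0 6) == 0)) functionals.
Proof. by vm_compute. Qed.

Lemma size_functionals : size functionals = 300%N.
Proof. by vm_compute. Qed.

Definition facet_table_value := Eval vm_compute in facet_lists.

(* Sealed, so that conversion never tries to unfold the 300 lists. *)
Lemma facet_table_sealed : {t : seq (seq nat) | t = facet_table_value}.
Proof. by exists facet_table_value. Qed.

Definition facet_table : seq (seq nat) := sval facet_table_sealed.

Lemma facet_tableE : facet_table = facet_table_value.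
Proof. exact: svalP facet_table_sealed. Qed.

Lemma facet_listsE : facet_lists = facet_table.
Proof. by rewrite facet_tableE; vm_compute. Qed.

Lemma facet_table_size : all (fun F => size F == 5%N) facet_table.
Proof. by rewrite facet_tableE; vm_compute. Qed.

Lemma facet_table_ridge :
  all (fun F => all (fun k => has (fun F' => (k \notin F') &&
    all (fun l => (l == k) || (l \in F')) F) facet_table) F) facet_table.
Proof. by rewrite facet_tableE; vm_compute. Qed.

Lemma facet_table_cover :
  all (fun k => has (fun F => k \in F) facet_table) (iota 0 32).
Proof. by rewrite facet_tableE; vm_compute. Qed.

Lemma facet_table_opp : all (fun F => has (fun F' =>
    all (fun k => (k \in F') == ((31 - k)%N \in F)) (iota 0 32)) facet_table) facet_table.
Proof. by rewrite facet_tableE; vm_compute. Qed.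

Lemma facet_table_acute : all (fun F => all (fun k => all (fun l =>
    0 < vgram k l) F) F) facet_table.
Proof. by rewrite facet_tableE; vm_compute. Qed.

(** * Symmetries of the 32 vertices *)

Lemma odd_bits_mkseq k : odd_bits k = mkseq (vmem k) 6.
Proof. by []. Qed.

Lemma vmem_inj (k l : 'I_32) : (forall i : 'I_6, vmem k i = vmem l i) -> k = l.
Proof.
move=> kl; apply: val_inj => /=.
have : all (fun k => all (fun l => (odd_bits k == odd_bits l) ==> (k == l))
    (iota 0 32)) (iota 0 32) by vm_compute.
move=> /allP/(_ k); rewrite mem_iota ltn_ord => /(_ isT)/allP/(_ l).
rewrite mem_iota ltn_ord => /(_ isT)/implyP kl'; apply/eqP/kl'.
apply/eqP; rewrite !odd_bits_mkseq; apply/eq_in_map => i.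
by rewrite mem_iota => i6; exact: (kl (Ordinal i6)).
Qed.

Definition parity6 (b : 'I_6 -> bool) : bool := \big[addb/false]_i b i.

Lemma parity6_vmem (k : 'I_32) : parity6 (vmem k).
Proof.
rewrite /parity6 !big_ord_recl big_ord0 /=.
have : all (fun k => foldr addb false (odd_bits k)) (iota 0 32) by vm_compute.
by move=> /allP/(_ k); rewrite mem_iota ltn_ord => /(_ isT).
Qed.

Lemma parity6_exists (b : 'I_6 -> bool) : parity6 b ->
  exists k : 'I_32, forall i : 'I_6, vmem k i = b i.
Proof.
move=> b1; pose s := [seq b i | i <- enum 'I_6].
have sb (i : 'I_6) : nth false s i = b i.
  by rewrite (nth_map i) ?size_enum_ord ?nth_ord_enum.
have : foldr addb false s.
  by move: b1; rewrite /parity6 -big_enum -(big_map b xpredT id) unlock.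
have : size s = 6 by rewrite size_map size_enum_ord.
suff : forall s, size s = 6 -> foldr addb false s ->
    exists2 k, (k < 32)%N & odd_bits k = s.
  move=> H s6 /(H _ s6)[k k32 ks]; exists (Ordinal k32) => i.
  by rewrite /vmem /= ks.
case=> [|b0 [|b1' [|b2 [|b3 [|b4 [|b5 []]]]]]] //= _ p6.
(* The first five indicators are the binary digits of the index; the parity hypothesis then settles
   the sixth. *)
exists (b0 + (b1' + (b2 + (b3 + b4.*2).*2).*2).*2)%N.
  by case: b0 b1' b2 b3 b4 {p6} => [] [] [] [] [].
by case: b0 b1' b2 b3 b4 b5 p6 => [] [] [] [] [] [].
Qed.

(** The image of a subset under [g], complemented when [e] holds. The default [k] is never reached:
    the ground set has even size, so complements of odd subsets are odd. *)
Definition vact (g : 'S_6) (e : bool) (k : 'I_32) : 'I_32 :=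
  odflt k [pick l : 'I_32 | [forall i : 'I_6, vmem l (g i) == vmem k i (+) e]].

Lemma vactE (g : 'S_6) e k (i : 'I_6) : vmem (vact g e k) (g i) = vmem k i (+) e.
Proof.
rewrite /vact; case: pickP => [l /forallP/(_ i)/eqP//|no].
have [|l lP] := @parity6_exists (fun i : 'I_6 => vmem k (g^-1 i)%g (+) e).
  rewrite /parity6 big_split /= (reindex_inj (@perm_inj _ g)) /=.
  under eq_bigr do rewrite permK.
  rewrite -/(parity6 _) parity6_vmem big_const_ord.
  by case: e {no}.
by have /forallP[] := no l; move=> j; rewrite lP permK.
Qed.

Lemma vact_eq (g : 'S_6) e (k l : 'I_32) :
  (forall i : 'I_6, vmem l (g i) = vmem k i (+) e) -> vact g e k = l.
Proof.
move=> lP; apply: vmem_inj => i; rewrite -[i](permKV g).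
by rewrite vactE lP.
Qed.

Lemma vactM g h e f k : vact (g * h)%g (e (+) f) k = vact h f (vact g e k).
Proof. by apply: vact_eq => i; rewrite permM !vactE addbA. Qed.

Lemma vact1 k : vact 1%g false k = k.
Proof. by apply: vact_eq => i; rewrite perm1 addbF. Qed.

Lemma vact_inj g e : injective (vact g e).
Proof.
apply: (can_inj (g := vact g^-1%g e)) => k.
by rewrite -vactM mulgV addbb vact1.
Qed.

Definition vopp : 'I_32 -> 'I_32 := vact 1%g true.

(** Subtraction from 31 flips the five binary digits, and flipping an odd number of digits also
    flips the parity bit. *)
Lemma val_vopp k : val (vopp k) = (31 - k)%N.
Proof.
have k32 : (31 - k < 32)%N by rewrite ltnS leq_subr.
rewrite (_ : vopp k = Ordinal k32)//; apply: vact_eq => i; rewrite perm1 /=.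
have : all (fun k => all (fun i => vmem (31 - k) i == vmem k i (+) true)
  (iota 0 6)) (iota 0 32) by vm_compute.
move=> /allP/(_ k); rewrite mem_iota ltn_ord => /(_ isT)/allP/(_ i).
by rewrite mem_iota ltn_ord => /(_ isT)/eqP.
Qed.

Lemma voppK : involutive vopp.
Proof. by move=> k; rewrite /vopp -vactM mulg1 vact1. Qed.

Lemma vmem_vopp k (i : 'I_6) : vmem (vopp k) i = ~~ vmem k i.
Proof. by rewrite -{1}[i](perm1) vactE addbT. Qed.

Lemma vopp_neq k : vopp k != k.
Proof.
apply/negP => /eqP/(congr1 (fun l : 'I_32 => vmem l (ord0 : 'I_6))).
by rewrite vmem_vopp; case: (vmem k _).
Qed.

Lemma vact_opp g e k : vact g e (vopp k) = vopp (vact g e k).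
Proof.
by apply: vact_eq => i; rewrite !vmem_vopp vactE addNb.
Qed.

Definition vperm (ge : 'S_6 * 'Z_2) : 'S_32 := perm (@vact_inj ge.1 (ge.2 != 0)).

Lemma vpermE ge k : vperm ge k = vact ge.1 (ge.2 != 0) k.
Proof. by rewrite permE. Qed.

Lemma vpermM : {in [set: 'S_6 * 'Z_2]%SET &, {morph vperm : x y / (x * y)%g}}.
Proof.
move=> [g e] [h f] _ _; apply/permP => k; rewrite permM !vpermE /= -vactM.
congr (vact _ _ _).
by case: e f => [[|[|//]] ?] [[|[|//]] ?].
Qed.

Canonical vperm_morphism := Morphism vpermM.

(* [wvert a i] is the vertex [{i}] or its complement. *)
Lemma wvert_exists (a : bool) (i : 'I_6) :
  exists k : 'I_32, [forall j : 'I_6, vmem k j == ((j == i) (+) a)].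
Proof.
have [|k kP] := @parity6_exists (fun j => (j == i) (+) a).
  rewrite /parity6 big_split /= big_const_ord (bigD1 i)//= eqxx big1.
    by case: a.
  by move=> j /negPf.
by exists k; apply/forallP => j; rewrite kP.
Qed.

Definition wvert a i : 'I_32 := xchoose (wvert_exists a i).

Lemma vmem_wvert a i (j : 'I_6) : vmem (wvert a i) j = (j == i) (+) a.
Proof. by have /forallP/(_ j)/eqP := xchooseP (wvert_exists a i). Qed.

Lemma vact_wvert g e a i : vact g e (wvert a i) = wvert (a (+) e) (g i).
Proof.
by apply: vact_eq => j; rewrite !vmem_wvert (inj_eq perm_inj) addbA.
Qed.

Lemma third_ord6 (i j : 'I_6) : exists2 k, k != i & k != j.
Proof.
have : all (fun i => all (fun j => has (fun k => (k != i) && (k != j)) (iota 0 6))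
  (iota 0 6)) (iota 0 6) by [].
move=> /allP/(_ i); rewrite mem_iota ltn_ord => /(_ isT)/allP/(_ j).
rewrite mem_iota ltn_ord => /(_ isT)/hasP[k].
by rewrite mem_iota => k6 /andP[ki kj]; exists (Ordinal k6).
Qed.

Lemma wvert_inj a b i j : wvert a i = wvert b j -> a = b /\ i = j.
Proof.
move=> /(congr1 (fun k : 'I_32 => vmem k)) wE.
have H l : (l == i) (+) a = (l == j) (+) b.
  by rewrite -!vmem_wvert wE.
have [k ki kj] := third_ord6 i j.
have ab : a = b by have := H k; rewrite (negPf ki) (negPf kj).
split=> //; have := H i; rewrite ab eqxx => /(can_inj (addbK b))/esym/eqP.
by [].
Qed.

Lemma vperm_injm : ('injm vperm)%g.
Proof.
apply/injmP => [[g e] [h f]] _ _ gh.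
have w i : wvert (e != 0) (g i) = wvert (f != 0) (h i).
  have := congr1 (fun s : 'S_32 => s (wvert false i)) gh.
  by rewrite /= !vpermE /= !vact_wvert !addFb.
have /wvert_inj[ef _] := w ord0; congr (_, _).
  by apply/permP => i; have /wvert_inj[] := w i.
by apply/eqP; case: e f ef {gh w} => [[|[|//]] ?] [[|[|//]] ?].
Qed.

(** * The automorphism group of the boundary complex *)

Lemma all_iotaP (P : pred nat) n : all P (iota 0 n) -> forall i : 'I_n, P i.
Proof. by move=> /allP nP i; apply: nP; rewrite mem_iota ltn_ord. Qed.

Lemma nth_map_iota (F : nat -> nat) n (k : 'I_n) :
  nth 0%N [seq F i | i <- iota 0 n] k = F k.
Proof. by rewrite (nth_map 0%N) ?size_iota// nth_iota. Qed.

Lemma mem_facet_table F k : F \in facet_table -> k \in F -> (k < 32)%N.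
Proof.
move=> FT kF; have : all (all (fun k => k < 32)%N) facet_table.
  by rewrite facet_tableE; vm_compute.
by move=> /allP/(_ F FT)/allP/(_ k kF).
Qed.

Definition ord_set n (F : seq nat) : {set 'I_n} := [set k : 'I_n | val k \in F]%SET.

Definition L32 : {set {set 'I_32}} :=
  [set s : {set 'I_32} | has (fun F => s \subset ord_set 32 F) facet_table]%SET.

Lemma L32P (s : {set 'I_32}) :
  reflect (exists2 F, F \in facet_table & s \subset ord_set 32 F) (s \in L32).
Proof. by rewrite inE; apply: hasP. Qed.

(** A version of [vact] on plain numbers that evaluates by computation; [val_vact] links the two. *)
Definition vactn (f : nat -> nat) (e : bool) (k : nat) : nat :=
  find (fun l => all (fun i => vmem l (f i) == vmem k i (+) e) (iota 0 6)) (iota 0 32).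

Lemma val_vact (g : 'S_6) e (f : nat -> nat) (k : 'I_32) :
  (forall i : 'I_6, val (g i) = f i) -> val (vact g e k) = vactn f e k.
Proof.
move=> gf; set P := fun l => all (fun i => vmem l (f i) == vmem k i (+) e) (iota 0 6).
have Phas : has P (iota 0 32).
  apply/hasP; exists (val (vact g e k)); first by rewrite mem_iota ltn_ord.
  apply/allP => i; rewrite mem_iota => i6.
  by rewrite -(gf (Ordinal i6)) vactE.
have f32 : (vactn f e k < 32)%N by rewrite -[X in (_ < X)%N](size_iota 0) -has_find.
rewrite (_ : vact g e k = Ordinal f32)//; apply: vact_eq => i /=.
have := nth_find 0%N Phas; rewrite nth_iota -?has_find//= => /all_iotaP/(_ i)/eqP.
by rewrite gf.
Qed.

Definition shift6n (i : nat) : nat := if i == 5%N then 0%N else i.+1.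
Definition swap6n (i : nat) : nat := if i == 0%N then 1%N else if i == 1%N then 0%N else i.

Definition shift6 : 'S_6 := perm (addrI (1 : 'I_6)).
Definition swap6 : 'S_6 := tperm (0 : 'I_6) 1.

Lemma val_shift6 (i : 'I_6) : val (shift6 i) = shift6n i.
Proof. by rewrite permE; case: i => [] [|[|[|[|[|[|]]]]]]. Qed.

Lemma val_swap6 (i : 'I_6) : val (swap6 i) = swap6n i.
Proof. by rewrite permE; case: i => [] [|[|[|[|[|[|]]]]]]. Qed.

Lemma gen_shift_swap : <<[set swap6; shift6]%SET>>%g = [set: 'S_6]%SET.
Proof. exact: (@gen_tpermn_circular_shift 4 0 1). Qed.

Definition lists_invariant (tb : seq nat) (T : seq (seq nat)) : bool :=
  all (fun F => has (fun F' => all (fun k => nth 0%N tb k \in F') F) T) T.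

Definition table_invariant (f : nat -> nat) (e : bool) : bool :=
  lists_invariant [seq vactn f e k | k <- iota 0 32] facet_table.

Lemma table_invariant_shift : table_invariant shift6n false.
Proof. by rewrite /table_invariant facet_tableE; vm_compute. Qed.

Lemma table_invariant_swap : table_invariant swap6n false.
Proof. by rewrite /table_invariant facet_tableE; vm_compute. Qed.

Lemma table_invariant_opp : table_invariant id true.
Proof. by rewrite /table_invariant facet_tableE; vm_compute. Qed.

Lemma aut_L32P (a : 'S_32) : reflect (forall s, s \in L32 -> (a @: s)%SET \in L32)
  (a \in aut_complex L32).
Proof.
rewrite /= /astabs finset.in_setI finset.in_setT /= finset.in_set.
apply: (iffP fintype.subsetP) => [H s sL|H s sL].
  by have := H s sL; rewrite finset.in_set; apply.
by rewrite finset.in_set; exact: H.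
Qed.

Lemma table_invariant_aut (ge : 'S_6 * 'Z_2) f : table_invariant f (ge.2 != 0) ->
  (forall i : 'I_6, val (ge.1 i) = f i) -> vperm ge \in aut_complex L32.
Proof.
move=> /allP inv gf; apply/aut_L32P => s /L32P[F FT /fintype.subsetP sF].
have /hasP[F' F'T /allP FF'] := inv F FT.
apply/L32P; exists F' => //; apply/fintype.subsetP => _ /imsetP[k ks ->].
have kF : val k \in F by have := sF k ks; rewrite inE.
rewrite inE vpermE (val_vact _ _ gf).
by have := FF' _ kF; rewrite nth_map_iota => kF'; exact: kF'.
Qed.

Lemma pair_mulg (g h : 'S_6) (e f : 'Z_2) : ((g, e) * (h, f))%g = ((g * h)%g, e + f).
Proof. by []. Qed.

(** Three table checks suffice: a transposition and a six-cycle generate the symmetric group, and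
    complementation generates the other factor. *)
Lemma vperm_aut ge : vperm ge \in aut_complex L32.
Proof.
case: ge => g e.
have -> : (g, e) = ((g, 0 : 'Z_2) * ((1 : 'S_6), e))%g.
  by rewrite pair_mulg mulg1 add0r.
rewrite vpermM; [|exact: finset.in_setT..].
apply: groupM; last first.
  have [->|e0] := eqVneq e 0; first by rewrite (morph1 vperm_morphism) group1.
  apply: (table_invariant_aut (f := id)) => [|i]; last by rewrite perm1.
  by rewrite e0; exact: table_invariant_opp.
pose H := [set g : 'S_6 | vperm (g, 0 : 'Z_2) \in aut_complex L32]%SET.
have gH : group_set H.
  apply/group_setP; split.
    by rewrite finset.inE (morph1 vperm_morphism) group1.
  move=> x y; rewrite ![_ \in H]finset.inE => xA yA.
  have -> : ((x * y)%g, 0 : 'Z_2) = ((x, 0 : 'Z_2) * (y, 0 : 'Z_2))%g.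
    by rewrite pair_mulg addr0.
  by rewrite vpermM; [apply: groupM|exact: finset.in_setT..].
have HP x : (x \in H) = (vperm (x, 0) \in aut_complex L32) by rewrite finset.in_set.
rewrite -HP; have : <<[set swap6; shift6]%SET>>%g \subset Group gH.
  rewrite gen_subG; apply/fintype.subsetP => x; rewrite finset.in_set2.
  have swapH : swap6 \in H.
    rewrite HP; apply: (@table_invariant_aut (swap6, 0) swap6n _ val_swap6).
    by rewrite eqxx; exact: table_invariant_swap.
  have shiftH : shift6 \in H.
    rewrite HP; apply: (@table_invariant_aut (shift6, 0) shift6n _ val_shift6).
    by rewrite eqxx; exact: table_invariant_shift.
  by case/orP => /eqP->; [exact: swapH|exact: shiftH].
by rewrite gen_shift_swap => /fintype.subsetP/(_ g); rewrite finset.in_setT => /(_ isT).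
Qed.

Lemma facet_table_sorted :
  all (fun F : seq nat => F == [seq k <- iota 0 32 | k \in F]) facet_table.
Proof. by rewrite facet_tableE; vm_compute. Qed.

Lemma facet_table_uniq : uniq facet_table.
Proof. by rewrite facet_tableE; vm_compute. Qed.

Lemma ord_set_inj : {in facet_table &, injective (ord_set 32)}.
Proof.
move=> F G FT GT /setP FG.
have /allP srt := facet_table_sorted.
rewrite (eqP (srt F FT)) (eqP (srt G GT)); apply: eq_in_filter => k.
by rewrite mem_iota => k32; have := FG (Ordinal k32); rewrite !inE.
Qed.

Lemma card_ord_set_uniq n (t : seq nat) : uniq t -> all (fun i => i < n)%N t ->
  #|ord_set n t| = size t.
Proof.
move=> t_uniq t_n; have -> : ord_set n t = [set k in pmap insub t]%SET.
  by apply/setP => k; rewrite !finset.in_set mem_pmap_sub.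
rewrite cardsE (card_uniqP _) ?pmap_sub_uniq// size_pmap_sub.
by apply/eqP; rewrite -all_count.
Qed.

Lemma card_facet_set F : F \in facet_table -> #|ord_set 32 F| = 5%N.
Proof.
move=> FT; have /allP/(_ F FT)/eqP F5 := facet_table_size.
rewrite card_ord_set_uniq//; last by apply/allP => k; exact: mem_facet_table.
by have /allP/(_ F FT)/eqP-> := facet_table_sorted; rewrite filter_uniq ?iota_uniq.
Qed.

(** * Degrees and adjacency as invariants of automorphisms *)

Definition vdegree (k : 'I_32) : nat :=
  #|[set s in L32 | (#|s| == 5%N) && (k \in s)]%SET|.

Lemma vdegreeE k : vdegree k = count (fun F => val k \in F) facet_table.
Proof.
rewrite -size_filter.
have -> : size [seq F <- facet_table | val k \in F] =
    #|[set s in [seq ord_set 32 F | F <- facet_table & val k \in F]]%SET|.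
  rewrite cardsE (card_uniqP _) ?size_map// map_inj_in_uniq ?filter_uniq ?facet_table_uniq//.
  move=> F G; rewrite !mem_filter => /andP[_ FT] /andP[_ GT].
  exact: ord_set_inj.
congr #|pred_of_set _|; apply/setP => s; rewrite finset.inE [RHS]finset.inE.
apply/andP/mapP => [[/L32P[F FT sF] /andP[s5 ks]]|[F]].
  have sE : s = ord_set 32 F by apply/eqP; rewrite eqEcard sF card_facet_set// (eqP s5).
  by exists F => //; rewrite mem_filter FT andbT; move: ks; rewrite sE finset.inE.
rewrite mem_filter => /andP[kF FT] ->; rewrite card_facet_set//.
have -> : k \in ord_set 32 F by rewrite finset.inE.
by split=> //; apply/L32P; exists F.
Qed.

Lemma vdegree_aut a k : a \in aut_complex L32 -> vdegree (a k) = vdegree k.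
Proof.
suff le b l : b \in aut_complex L32 -> (vdegree l <= vdegree (b l))%N.
  move=> aA; apply/eqP; rewrite eqn_leq le// -{2}[k](permK a) le//.
  by rewrite groupV.
move=> /aut_L32P bL; rewrite /vdegree.
rewrite -(card_imset _ (imset_inj (@perm_inj _ b))).
apply/subset_leq_card/fintype.subsetP => _ /imsetP[s + ->].
rewrite !finset.inE => /andP[sL /andP[s5 ls]].
have sL' : s \in L32 by rewrite finset.inE.
rewrite (card_imset _ perm_inj) s5 imset_f// !andbT.
by have := bL _ sL'; rewrite finset.inE.
Qed.

Definition wvertn (a : bool) (i : nat) : nat :=
  find (fun k => all (fun j => vmem k j == (j == i) (+) a) (iota 0 6)) (iota 0 32).

Lemma val_wvert a (i : 'I_6) : val (wvert a i) = wvertn a i.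
Proof.
set P := fun k => all (fun j => vmem k j == (j == i) (+) a) (iota 0 6).
have Phas : has P (iota 0 32).
  apply/hasP; exists (val (wvert a i)); first by rewrite mem_iota ltn_ord.
  apply/allP => j; rewrite mem_iota => j6.
  by have := vmem_wvert a i (Ordinal j6); rewrite /= => ->.
have f32 : (wvertn a i < 32)%N by rewrite -[X in (_ < X)%N](size_iota 0) -has_find.
rewrite (_ : wvert a i = Ordinal f32)//; apply: vmem_inj => j /=.
have := nth_find 0%N Phas; rewrite nth_iota -?has_find//= => /all_iotaP/(_ j)/eqP.
by rewrite vmem_wvert => ->.
Qed.

Lemma degree_table : all (fun k =>
    (count (fun F => k \in F) facet_table == 45%N)
    == has (fun i => (k == wvertn false i) || (k == wvertn true i)) (iota 0 6))
  (iota 0 32).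
Proof. by rewrite facet_tableE; vm_compute. Qed.

Lemma vdegree45 k : (vdegree k == 45%N) = [exists i, exists a, k == wvert a i].
Proof.
rewrite vdegreeE; have /eqP-> := all_iotaP degree_table k.
apply/hasP/existsP => [[i]|[i /existsP[a /eqP->]]].
  rewrite mem_iota => i6 /orP[]/eqP ki; exists (Ordinal i6).
    by apply/existsP; exists false; apply/eqP/val_inj; rewrite val_wvert.
  by apply/existsP; exists true; apply/eqP/val_inj; rewrite val_wvert.
exists (val i); first by rewrite mem_iota ltn_ord.
rewrite val_wvert; apply/orP.
by case: a; [right; apply/eqP; reflexivity|left; apply/eqP; reflexivity].
Qed.

Definition adj_in (T : seq (seq nat)) (k l : nat) : bool :=
  has (fun F => (k \in F) && (l \in F)) T.

Definition adjn (k l : nat) : bool := adj_in facet_table k l.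

Lemma adjnE (k l : 'I_32) : ([set k; l]%SET \in L32) = adjn k l.
Proof.
apply/L32P/hasP => [[F FT /fintype.subsetP kl]|[F FT /andP[kF lF]]]; exists F => //.
  by have := kl k; have := kl l; rewrite !finset.inE !eqxx ?orbT => -> // ->.
by apply/fintype.subsetP => x; rewrite !finset.inE => /orP[]/eqP->.
Qed.

Lemma adj_aut a (k l : 'I_32) : a \in aut_complex L32 -> adjn (a k) (a l) = adjn k l.
Proof.
have le b (x y : 'I_32) : b \in aut_complex L32 -> adjn x y -> adjn (b x) (b y).
  move=> /aut_L32P bL; rewrite -!adjnE => /bL.
  by rewrite imsetU !imset_set1.
move=> aA; apply/idP/idP => [|/le]; last exact.
by move=> /le-/(_ a^-1%g); rewrite groupV !permK; apply.
Qed.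

(** Apart from equality, [{i}] is adjacent only to the complements of the other singletons: the
    twelve vertices span a complete bipartite graph minus a perfect matching, whose automorphism
    group is S_6 x C_2. *)
Lemma adj_table_w : all (fun i => all (fun j => all (fun a => all (fun b =>
    adjn (wvertn a i) (wvertn b j) == ((a == b) == (i == j))) [:: true; false])
    [:: true; false]) (iota 0 6)) (iota 0 6).
Proof. by rewrite /adjn facet_tableE; vm_compute. Qed.

(** The neighbours of a 3-set among the twelve special vertices spell out its elements, so an
    automorphism is determined by its action on those twelve. *)
Lemma adj_table_v : all (fun k => (count (fun F => k \in F) facet_table == 45%N) ||
  all (fun i => all (fun a => adjn k (wvertn a i) == vmem k i (+) a)
    [:: true; false]) (iota 0 6)) (iota 0 32).
Proof. by rewrite /adjn facet_tableE; vm_compute. Qed.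

Lemma adj_wvert a b (i j : 'I_6) :
  adjn (wvert a i) (wvert b j) = ((a == b) == (i == j)).
Proof.
rewrite !val_wvert.
have /(all_iotaP)/(_ j)/allP/(_ a) := all_iotaP adj_table_w i.
have -> : a \in [:: true; false] by case: (a).
move=> /(_ isT)/allP/(_ b); have -> : b \in [:: true; false] by case: (b).
by move=> /(_ isT)/eqP.
Qed.

Lemma adj_vmem k a (i : 'I_6) : vdegree k != 45%N ->
  adjn k (wvert a i) = vmem k i (+) a.
Proof.
rewrite vdegreeE val_wvert => /negPf k45; have := all_iotaP adj_table_v k.
rewrite k45 orFb => kT; have /allP/(_ a) := all_iotaP kT i.
have -> : a \in [:: true; false] by case: (a).
by move=> /(_ isT)/eqP.
Qed.

Lemma aut_L32_sub a : a \in aut_complex L32 -> exists ge, a = vperm ge.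
Proof.
move=> aA.
have /choice[f fP] : forall ai : bool * 'I_6, exists bj : bool * 'I_6,
    a (wvert ai.1 ai.2) = wvert bj.1 bj.2.
  move=> [b i]; have : vdegree (a (wvert b i)) == 45%N.
    by rewrite vdegree_aut// vdegree45; apply/existsP; exists i; apply/existsP; exists b.
  by rewrite vdegree45 => /existsP[j /existsP[c /eqP->]]; exists (c, j).
have fadj b c i j : (((f (b, i)).1 == (f (c, j)).1) == ((f (b, i)).2 == (f (c, j)).2))
    = ((b == c) == (i == j)).
  have := adj_aut (wvert b i) (wvert c j) aA.
  by rewrite (fP (b, i)) (fP (c, j)) !adj_wvert.
have f_inj b c i j : f (b, i) = f (c, j) -> b = c /\ i = j.
  move=> ff; apply: wvert_inj; apply: (@perm_inj _ a).
  by rewrite (fP (b, i)) (fP (c, j)) ff.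
(* Opposite signs and distinct indices mean adjacent and distinct; the images are again adjacent and
   distinct, which forces opposite signs. *)
have sgnN b i j : i != j -> (f (~~ b, j)).1 = ~~ (f (b, i)).1.
  move=> ij; have bN : (b == ~~ b) = false by case: (b).
  have := fadj b (~~ b) i j; rewrite (negPf ij) bN eqxx.
  have := @f_inj b (~~ b) i j.
  case: (f (b, i)) (f (~~ b, j)) => [x k] [y l] /= ff.
  have [xy|] := eqVneq x y; last by move: x y {ff} => [] [].
  move=> /eqP/esym/eqP kl; have [|_ ji] := ff; first by rewrite xy kl.
  by rewrite ji eqxx in ij.
have sgn_const b i j : (f (b, i)).1 = (f (b, j)).1.
  have [k ki kj] := third_ord6 i j; apply: negb_inj.
  by rewrite -(sgnN b i k) 1?eq_sym// -(sgnN b j k) 1?eq_sym.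
pose e := (f (false, ord0)).1.
have sgnE b i : (f (b, i)).1 = b (+) e.
  rewrite (sgn_const b i ord0) /e; case: b; last by [].
  have [k k0 _] := third_ord6 ord0 ord0.
  by rewrite (sgn_const true ord0 k) (sgnN false ord0 k) 1?eq_sym// addTb.
pose g0 i := (f (false, i)).2.
(* [{i}] and its complement are not adjacent, while their images have opposite signs; nonadjacency
   then forces equal indices. *)
have idxE b i : (f (b, i)).2 = g0 i.
  case: b => //; apply/eqP; have := fadj true false i i; rewrite eqxx /= !sgnE.
  by rewrite -/(g0 i); move: (_ == g0 i) => q; case: (e); case: q.
have aw b j : a (wvert b j) = wvert (b (+) e) (g0 j).
  by rewrite (fP (b, j)) sgnE idxE.
have g0_inj : injective g0.
  move=> i j ij; have : a (wvert false i) = a (wvert false j) by rewrite !aw ij.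
  by move=> /perm_inj/wvert_inj[].
pose ez : 'Z_2 := if e then 1 else 0.
have ezE : (ez != 0) = e by rewrite /ez; case: (e).
exists (perm g0_inj, ez); apply/permP => k; rewrite vpermE /= ezE.
apply/esym/vact_eq => i; rewrite permE.
have [|k45] := boolP (vdegree k == 45%N).
  rewrite vdegree45 => /existsP[j /existsP[b /eqP->]].
  by rewrite aw !vmem_wvert (inj_eq g0_inj) addbA.
have ak45 : vdegree (a k) != 45%N by rewrite vdegree_aut.
have := adj_aut k (wvert false i) aA.
by rewrite aw !adj_vmem// addbF addFb => <-; rewrite addbK.
Qed.

Lemma aut_L32_isog : aut_complex L32 \isog [set: 'S_6 * 'Z_2]%SET.
Proof.
rewrite isog_sym; apply/isogP; exists vperm_morphism; first exact: vperm_injm.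
apply/setP => a; apply/morphimP/idP => [[ge _ _ ->]|aA]; first exact: vperm_aut.
by have [ge aE] := aut_L32_sub aA; exists ge.
Qed.

(** * The complex on 16 vertices and its symmetry group *)

Lemma val_lab k : (k <= 16)%N -> val (lab k) = k.-1.
Proof. by move=> k16; rewrite /= inordK//; case: k k16. Qed.

Lemma map_val_lab (s : seq nat) : all (leq^~ 16) s ->
  map val (map lab s) = map predn s.
Proof.
by move=> /allP s16; rewrite -map_comp; apply/eq_in_map => k /s16; exact: val_lab.
Qed.

Lemma val_cyc (s : seq nat) (x : 'I_16) : all (leq^~ 16) s -> uniq (map predn s) ->
  val (cyc s x) = next (map predn s) (val x).
Proof.
move=> s16 us.
have us' : uniq (map lab s) by rewrite -(map_inj_uniq val_inj) map_val_lab.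
by rewrite cycE// -(next_map val_inj us') map_val_lab.
Qed.

Definition permTn (x : nat) : nat :=
  next [:: 10; 11; 12; 13; 14; 15]%N (next [:: 5; 7; 8]%N (next [:: 0; 1; 2; 3; 4; 9]%N x)).

Definition permSn (x : nat) : nat :=
  next [:: 10; 11]%N (next [:: 4; 5]%N (next [:: 3; 9]%N (next [:: 1; 6]%N x))).

Lemma val_permT (x : 'I_16) : val (permT x) = permTn x.
Proof. by rewrite /permT !permM !val_cyc. Qed.

Lemma val_permS (x : 'I_16) : val (permS x) = permSn x.
Proof. by rewrite /permS !permM !val_cyc. Qed.

(* The vertex of [K16] below each vertex of the polytope. *)
Definition proj_table : seq nat :=
  [:: 15; 10; 11; 7; 12; 9; 3; 8; 13; 1; 6; 0; 2; 4; 5; 14;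
      14; 5; 4; 2; 0; 6; 1; 13; 8; 3; 9; 12; 7; 11; 10; 15]%N.

Definition projn (k : nat) : nat := nth 0%N proj_table k.

Definition liftn (x : nat) : nat := index x proj_table.

Lemma projn_lt16 (k : 'I_32) : (projn k < 16)%N.
Proof.
have : all (fun k => projn k < 16)%N (iota 0 32) by vm_compute.
by move=> /all_iotaP/(_ k).
Qed.

Lemma liftn_lt32 (x : 'I_16) : (liftn x < 32)%N.
Proof.
have : all (fun k => liftn k < 32)%N (iota 0 16) by vm_compute.
by move=> /all_iotaP/(_ x).
Qed.

Definition proj (k : 'I_32) : 'I_16 := Ordinal (projn_lt16 k).
Definition vlift (x : 'I_16) : 'I_32 := Ordinal (liftn_lt32 x).

Lemma vliftK : cancel vlift proj.
Proof.
move=> x; apply: val_inj => /=; apply/eqP.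
have : all (fun x => projn (liftn x) == x) (iota 0 16) by vm_compute.
by move=> /all_iotaP/(_ x).
Qed.

Lemma projP (k l : 'I_32) : (proj k == proj l) = (k == l) || (k == vopp l).
Proof.
rewrite -!(inj_eq val_inj) val_vopp /=.
have : all (fun k => all (fun l => (projn k == projn l) == (k == l) || (k == 31 - l)%N)
  (iota 0 32)) (iota 0 32) by vm_compute.
by move=> /all_iotaP/(_ k) kP; have /eqP := all_iotaP kP l.
Qed.

Lemma proj_vopp k : proj (vopp k) = proj k.
Proof. by apply/eqP; rewrite projP eqxx orbT. Qed.

Lemma vlift_proj k : vlift (proj k) = k \/ vlift (proj k) = vopp k.
Proof.
have : proj (vlift (proj k)) == proj k by rewrite vliftK.
by rewrite projP => /orP[]/eqP; [left|right].
Qed.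

(** The choice of lift does not matter because [vact] commutes with the antipodal map. *)
Definition pact (g : 'S_6) (x : 'I_16) : 'I_16 := proj (vact g false (vlift x)).

Lemma pact_proj g k : pact g (proj k) = proj (vact g false k).
Proof.
rewrite /pact; case: (vlift_proj k) => -> //.
by rewrite vact_opp proj_vopp.
Qed.

Lemma pactM g h x : pact (g * h)%g x = pact h (pact g x).
Proof. by rewrite [pact g x]/pact pact_proj -vactM addbF. Qed.

Lemma pact1 x : pact 1%g x = x.
Proof. by rewrite /pact vact1 vliftK. Qed.

Lemma pact_inj g : injective (pact g).
Proof. by apply: (can_inj (g := pact g^-1%g)) => x; rewrite -pactM mulgV pact1. Qed.

Definition pperm (g : 'S_6) : 'S_16 := perm (@pact_inj g).

Lemma ppermM : {in [set: 'S_6]%SET &, {morph pperm : x y / (x * y)%g}}.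
Proof. by move=> g h _ _; apply/permP => x; rewrite permM !permE pactM. Qed.

Canonical pperm_morphism := Morphism ppermM.

Lemma pact_wvert g i : pact g (proj (wvert false i)) = proj (wvert false (g i)).
Proof. by rewrite pact_proj vact_wvert. Qed.

Lemma proj_wvert_inj i j : proj (wvert false i) = proj (wvert false j) -> i = j.
Proof.
move=> /eqP; rewrite projP => /orP[/eqP/wvert_inj[]//|/eqP].
by rewrite /vopp vact_wvert => /wvert_inj[].
Qed.

Lemma pperm_injm : ('injm pperm)%g.
Proof.
apply/injmP => g h _ _ gh; apply/permP => i; apply: proj_wvert_inj.
have := congr1 (fun s : 'S_16 => s (proj (wvert false i))) gh.
by rewrite /= !permE !pact_wvert.
Qed.

(** The lift of [F x] has to match the image of the lift of [x] only up to complementation. *)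
Definition pact_table (f F : nat -> nat) : bool :=
  all (fun x => all (fun i => vmem (liftn (F x)) (f i) == vmem (liftn x) i) (iota 0 6)
    || all (fun i => vmem (liftn (F x)) (f i) == ~~ vmem (liftn x) i) (iota 0 6))
  (iota 0 16).

Lemma pact_tableP (g : 'S_6) (s : 'S_16) f F : pact_table f F ->
  (forall i : 'I_6, val (g i) = f i) -> (forall x : 'I_16, val (s x) = F x) ->
  pperm g = s.
Proof.
move=> T gf sF; apply/permP => x; rewrite permE /pact.
have := all_iotaP T x => /orP[]H.
  rewrite (_ : vact _ _ _ = vlift (s x)) ?vliftK//; apply: vact_eq => i.
  by rewrite gf addbF /= sF; have /eqP := all_iotaP H i.
rewrite (_ : vact _ _ _ = vopp (vlift (s x))) ?proj_vopp ?vliftK//.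
apply: vact_eq => i; rewrite vmem_vopp gf addbF /= sF.
have /eqP e := all_iotaP H i.
exact: etrans (congr1 negb e) (negbK _).
Qed.

(** On the ten splittings into 3 + 3 a six-cycle has cycles of length 6, 3 and 1; the fixed
    splitting, into alternate points, is the vertex labelled 7. *)
Lemma pperm_shift : pperm shift6 = permT.
Proof. by apply: (pact_tableP _ val_shift6 val_permT); vm_compute. Qed.

Lemma pperm_swap : pperm swap6 = permS.
Proof. by apply: (pact_tableP _ val_swap6 val_permS); vm_compute. Qed.

Lemma G16E : G16 = (pperm_morphism @* [set: 'S_6]%SET)%g :> {set 'S_16}.
Proof.
transitivity (pperm_morphism @* <<[set swap6; shift6]%SET>>)%g; last first.
  by congr (morphim _ _); exact: gen_shift_swap.
rewrite morphim_gen ?finset.subsetT//.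
rewrite morphimEsub ?finset.subsetT// imsetU !imset_set1 /= pperm_shift pperm_swap.
by rewrite finset.setUC.
Qed.

Lemma G16_isog : G16 \isog [set: 'S_6]%SET.
Proof.
rewrite isog_sym; apply/isogP; exists pperm_morphism; first exact: pperm_injm.
by rewrite -G16E.
Qed.

Lemma card_G16 : #|G16| = 720%N.
Proof. by rewrite (card_isog G16_isog) cardsT card_Sn. Qed.

(** * Orbits computed by closure under the two generators *)

Section OrbitSearch.
Variables (T : finType) (to : {action 'S_16 &-> T}) (U : eqType) (D : T -> U -> Prop).
Variables (stepT stepS : U -> U).
Hypothesis D_T : forall x u, D x u -> D (to x permT) (stepT u).
Hypothesis D_S : forall x u, D x u -> D (to x permS) (stepS u).

Definition orbit_step (l : seq U) : seq U :=
  undup (l ++ map stepT l ++ map stepS l).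

Lemma permT_G16 : permT \in G16.
Proof. by rewrite mem_gen// !inE eqxx. Qed.

Lemma permS_G16 : permS \in G16.
Proof. by rewrite mem_gen// !inE eqxx orbT. Qed.

(** Lower bound for the orbit: whatever the search lists is the code of an element of it. *)
Lemma orbit_stepP x u n : D x u -> forall w, w \in iter n orbit_step [:: u] ->
  exists2 y, y \in orbit to G16 x & D y w.
Proof.
move=> xu; elim: n => [|n IH] w /=.
  by rewrite inE => /eqP->; exists x => //; exact: orbit_refl.
rewrite mem_undup !mem_cat => /or3P[/IH//|/mapP[w' /IH[y yx yw'] ->]|/mapP[w' /IH[y yx yw'] ->]].
  exists (to y permT); last exact: D_T.
  by have /orbitP[g gG <-] := yx; rewrite -actM mem_orbit// groupM ?permT_G16.
exists (to y permS); last exact: D_S.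
by have /orbitP[g gG <-] := yx; rewrite -actM mem_orbit// groupM ?permS_G16.
Qed.

(** Upper bound for the orbit: the elements with a code in a closed list form a set stabilized by
    both generators, hence by the group. *)
Lemma orbit_closedP (l : seq U) x u : D x u -> u \in l ->
  all (fun w => (stepT w \in l) && (stepS w \in l)) l ->
  forall y, y \in orbit to G16 x -> exists2 w, w \in l & D y w.
Proof.
move=> xu ul /allP lP y /orbitP[g gG <-].
pose A := [set y | `[< exists2 w, w \in l & D y w >]]%SET.
have stab s st : (forall x u, D x u -> D (to x s) (st u)) ->
    (forall w, w \in l -> st w \in l) -> s \in 'N(A | to)%g.
  move=> Ds stl; rewrite finset.inE /= finset.in_setT /= finset.in_set.
  apply/fintype.subsetP => z; rewrite !finset.in_set => /asboolP[w wl zw].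
  by apply/asboolP; exists (st w); [exact: stl|exact: Ds].
have GN : G16 \subset 'N(A | to)%g.
  rewrite gen_subG; apply/fintype.subsetP => s; rewrite finset.in_set2.
  by case/orP => /eqP->; [apply: stab D_T _|apply: stab D_S _] => w /lP/andP[].
have : to x g \in A.
  rewrite (astabs_act _ (fintype.subsetP GN _ gG)) finset.in_set.
  by apply/asboolP; exists u.
by rewrite finset.in_set => /asboolP.
Qed.

End OrbitSearch.

Lemma orbit_vertex (x : 'I_16) (l : seq nat) n :
  all (fun w => (permTn w \in l) && (permSn w \in l)) l -> val x \in l ->
  all (fun w => w \in iter n (orbit_step permTn permSn) [:: val x]) l ->
  orbit 'P G16 x = [set i : 'I_16 | val i \in l]%SET.
Proof.
move=> lP xl lx; apply/setP => y; rewrite finset.in_set; apply/idP/idP => [yx|yl].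
  have [||w wl ->//] := @orbit_closedP _ 'P%act _ (fun y u => val y = u) permTn permSn
    _ _ l x (val x) erefl xl lP y yx.
    by move=> z u <-; exact: val_permT.
  by move=> z u <-; exact: val_permS.
have [||z zx yz] := @orbit_stepP _ 'P%act _ (fun y u => val y = u) permTn permSn
    _ _ x (val x) n erefl (val y) (allP lx _ yl).
- by move=> z u <-; exact: val_permT.
- by move=> z u <-; exact: val_permS.
by rewrite -(val_inj yz).
Qed.

Lemma G16_orbits : [set orbit 'P G16 x | x in [set: 'I_16]%SET]%SET
  = [set [set i : 'I_16 | (i < 10)%N]; [set i : 'I_16 | (10 <= i)%N]]%SET.
Proof.
pose x0 : 'I_16 := Ordinal (isT : 0 < 16)%N.
pose x10 : 'I_16 := Ordinal (isT : 10 < 16)%N.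
have low : orbit 'P G16 x0 = [set i : 'I_16 | (i < 10)%N]%SET.
  have -> := @orbit_vertex x0 (iota 0 10) 8 (erefl true) (erefl true) (erefl true).
  by apply/setP => i; rewrite !finset.in_set mem_iota.
have high : orbit 'P G16 x10 = [set i : 'I_16 | (10 <= i)%N]%SET.
  have -> := @orbit_vertex x10 (iota 10 6) 8 (erefl true) (erefl true) (erefl true).
  by apply/setP => i; rewrite !finset.in_set mem_iota ltn_ord andbT.
apply/setP => A; rewrite finset.in_set2 -low -high.
apply/imsetP/orP => [[x _ ->]|[/eqP->|/eqP->]]; last 2 first.
- by exists x0.
- by exists x10.
have [x10'|x10'] := ltnP x 10.
  by left; apply/eqP/orbit_eqP; rewrite low finset.in_set.
by right; apply/eqP/orbit_eqP; rewrite high finset.in_set.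
Qed.

(** Increasing form without repetitions, so that equality of vertex sets becomes equality of
    lists. *)
Definition normal_list (n : nat) (u : seq nat) : seq nat := [seq i <- iota 0 n | i \in u].

Lemma ord_set_normal n u : ord_set n (normal_list n u) = ord_set n u.
Proof.
by apply/setP => i; rewrite !finset.in_set mem_filter mem_iota leq0n add0n ltn_ord !andbT.
Qed.

Lemma normal_list_inj n u w : ord_set n u = ord_set n w ->
  normal_list n u = normal_list n w.
Proof.
move=> /setP uw; apply: eq_in_filter => i; rewrite mem_iota => i_n.
by have := uw (Ordinal i_n); rewrite !finset.in_set.
Qed.

Lemma card_ord_sets n (l : seq (seq nat)) : uniq l ->
  all (fun u => normal_list n u == u) l ->
  #|[set s in [seq ord_set n u | u <- l]]%SET| = size l.
Proof.
move=> l_uniq /allP l_norm; rewrite cardsE (card_uniqP _) ?size_map//.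
rewrite map_inj_in_uniq// => u w /l_norm/eqP uE /l_norm/eqP wE /normal_list_inj.
by rewrite uE wE.
Qed.

Definition list_act (F : nat -> nat) (u : seq nat) : seq nat :=
  normal_list 16 [seq F i | i <- u].

Definition represents (s : {set 'I_16}) (u : seq nat) : Prop :=
  s = ord_set 16 u /\ all (fun i => i < 16)%N u.

Lemma represents_act (g : 'S_16) (F : nat -> nat) s u : (forall x : 'I_16, val (g x) = F x) ->
  represents s u -> represents (('P^*)%act s g) (list_act F u).
Proof.
move=> gF [-> /allP u16]; split; last first.
  by apply/allP => i; rewrite mem_filter mem_iota => /andP[_ /andP[]].
rewrite ord_set_normal; apply/setP => i; rewrite finset.in_set.
apply/imsetP/mapP => [[k + ->]|[k ku iE]].
  by rewrite finset.in_set => ku; exists (val k) => //; rewrite -gF.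
exists (Ordinal (u16 k ku)); first by rewrite finset.in_set.
by apply: val_inj; rewrite iE /= /aperm gF.
Qed.

Definition orbit_lists (n : nat) (u : seq nat) : seq (seq nat) :=
  iter n (orbit_step (list_act permTn) (list_act permSn)) [:: u].

Definition orbit_lists_closed (l : seq (seq nat)) : bool :=
  all (fun w => (list_act permTn w \in l) && (list_act permSn w \in l)) l.

Lemma orbit_listsP s u l n : represents s u -> orbit_lists_closed l ->
  u \in l -> orbit_lists n u = l ->
  simplex_orbit s = [set t in [seq ord_set 16 w | w <- l]]%SET.
Proof.
have DT x w : represents x w -> represents (('P^*)%act x permT) (list_act permTn w).
  by apply: represents_act; exact: val_permT.
have DS x w : represents x w -> represents (('P^*)%act x permS) (list_act permSn w).
  by apply: represents_act; exact: val_permS.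
move=> su cl uu lE; apply/setP => t; rewrite [RHS]finset.in_set.
apply/idP/mapP => [tO|[w wu ->]].
  have [w wl [-> _]] := orbit_closedP DT DS su uu cl tO.
  by exists w.
rewrite -lE in wu; have [z zs [zw _]] := orbit_stepP DT DS su wu.
by rewrite -zw.
Qed.

Lemma simplexE l : all (leq^~ 16) l -> all (leq 1) l ->
  simplex l = ord_set 16 (map predn l).
Proof.
move=> l16 l0; apply/setP => i; rewrite !finset.in_set -map_val_lab//.
by rewrite (mem_map val_inj).
Qed.

Definition base1 : seq nat := [:: 0; 1; 3; 4; 10]%N.
Definition base2 : seq nat := [:: 0; 1; 3; 10; 12]%N.

(** The numbers of rounds, 12 and 16, only have to make the lists closed under both generators,
    which [simplex_orbit1] and [simplex_orbit2] check. *)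
Definition simplex_lists_value := Eval vm_compute in
  (orbit_lists 12 base1, orbit_lists 16 base2).

Lemma simplex_lists_sealed : {ll : seq (seq nat) * seq (seq nat) |
  ll = simplex_lists_value}.
Proof. by exists simplex_lists_value. Qed.

Definition simplex_list1 : seq (seq nat) := (sval simplex_lists_sealed).1.
Definition simplex_list2 : seq (seq nat) := (sval simplex_lists_sealed).2.

Lemma simplex_list1E : simplex_list1 = simplex_lists_value.1.
Proof. by rewrite /simplex_list1 (svalP simplex_lists_sealed). Qed.

Lemma simplex_list2E : simplex_list2 = simplex_lists_value.2.
Proof. by rewrite /simplex_list2 (svalP simplex_lists_sealed). Qed.

Lemma orbit_lists1 : orbit_lists 12 base1 = simplex_list1.
Proof. by rewrite simplex_list1E; vm_compute. Qed.

Lemma orbit_lists2 : orbit_lists 16 base2 = simplex_list2.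
Proof. by rewrite simplex_list2E; vm_compute. Qed.

Lemma simplex_orbit1 :
  simplex_orbit simplex1 = [set t in [seq ord_set 16 w | w <- simplex_list1]]%SET.
Proof.
apply: (orbit_listsP _ _ _ orbit_lists1).
- by split=> //; rewrite /simplex1 simplexE.
- by rewrite simplex_list1E; vm_compute.
- by rewrite simplex_list1E; vm_compute.
Qed.

Lemma simplex_orbit2 :
  simplex_orbit simplex2 = [set t in [seq ord_set 16 w | w <- simplex_list2]]%SET.
Proof.
apply: (orbit_listsP _ _ _ orbit_lists2).
- by split=> //; rewrite /simplex2 simplexE.
- by rewrite simplex_list2E; vm_compute.
- by rewrite simplex_list2E; vm_compute.
Qed.

Lemma card_simplex_orbits :
  #|simplex_orbit simplex1| = 30%N /\ #|simplex_orbit simplex2| = 120%N.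
Proof.
rewrite simplex_orbit1 simplex_orbit2 !card_ord_sets ?simplex_list1E ?simplex_list2E;
  by vm_compute.
Qed.

Definition simplex_table : seq (seq nat) := simplex_list1 ++ simplex_list2.

Lemma K16P (s : {set 'I_16}) :
  reflect (exists2 u, u \in simplex_table & s \subset ord_set 16 u) (s \in K16).
Proof.
rewrite finset.in_set; apply: (iffP existsP) => [[F /andP[FO sF]]|[u uT su]].
  move: FO; rewrite finset.in_setU simplex_orbit1 simplex_orbit2 !finset.in_set.
  by rewrite -mem_cat -map_cat => /mapP[u uT FE]; exists u; rewrite // -FE.
exists (ord_set 16 u); rewrite su andbT finset.in_setU simplex_orbit1 simplex_orbit2.
by rewrite !finset.in_set -mem_cat -map_cat map_f.
Qed.

Lemma two_neighbourly_K16 : two_neighbourly K16.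
Proof.
move=> i j _; apply/K16P.
have : all (fun i => all (fun j => has (fun u : seq nat => (i \in u) && (j \in u))
    simplex_table) (iota 0 16)) (iota 0 16).
  by rewrite /simplex_table simplex_list1E simplex_list2E; vm_compute.
move=> /all_iotaP/(_ i) T; have /hasP[u uT /andP[iu ju]] := all_iotaP T j.
exists u => //; apply/fintype.subsetP => x; rewrite finset.in_set2 finset.in_set.
by case/orP => /eqP->.
Qed.

Lemma simplicial_complex_K16 : simplicial_complex K16.
Proof.
have K16S (s t : {set 'I_16}) : s \in K16 -> t \subset s -> t \in K16.
  by move=> /K16P[u uT su] ts; apply/K16P; exists u => //; exact: fintype.subset_trans su.
split=> // i; have [j ji] : exists j : 'I_16, j != i.
  by have [->|i0] := eqVneq i ord0; [exists ord_max|exists ord0; rewrite eq_sym].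
by apply: K16S (two_neighbourly_K16 ji) _; rewrite finset.subsetUr.
Qed.

Lemma proj_invariant : all (fun F => normal_list 16 (map projn F) \in simplex_table) facet_table
  && all (fun u => u \in [seq normal_list 16 (map projn F) | F <- facet_table]) simplex_table.
Proof.
by rewrite /simplex_table simplex_list1E simplex_list2E facet_tableE; vm_compute.
Qed.

Lemma proj_ord_set F : F \in facet_table ->
  (proj @: ord_set 32 F)%SET = ord_set 16 (map projn F).
Proof.
move=> FT; apply/setP => i; rewrite [RHS]finset.in_set.
apply/imsetP/mapP => [[k + ->]|[k kF iE]].
  by rewrite finset.in_set => kF; exists (val k).
exists (Ordinal (mem_facet_table FT kF)); first by rewrite finset.in_set.
by apply: val_inj; rewrite iE.
Qed.

Lemma K16_proj : K16 = [set (proj @: s)%SET | s : {set 'I_32} in L32]%SET.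
Proof.
have /andP[/allP FS /allP SF] := proj_invariant.
apply/setP => t; apply/K16P/imsetP => [[u uT tu]|[s /L32P[F FT sF] ->]].
  have /mapP[F FT uE] := SF u uT; rewrite uE ord_set_normal -proj_ord_set// in tu.
  (* The full preimage of [t] contains antipodal pairs; intersecting with the facet [F] leaves a
     face that still maps onto [t]. *)
  exists (ord_set 32 F :&: proj @^-1: t)%SET.
    by apply/L32P; exists F; rewrite ?finset.subsetIl.
  apply/setP => i; apply/idP/imsetP => [it|[k + ->]]; last first.
    by rewrite finset.in_setI => /andP[_]; rewrite finset.in_set.
  have /imsetP[k kF iE] := fintype.subsetP tu i it.
  by exists k => //; rewrite finset.in_setI kF /= finset.in_set -iE.
exists (normal_list 16 (map projn F)); first exact: FS.
by rewrite ord_set_normal -proj_ord_set// imsetS.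
Qed.

(** * Counting faces *)

Fixpoint subseqs (T : Type) (s : seq T) : seq (seq T) :=
  if s is x :: s' then map (cons x) (subseqs s') ++ subseqs s' else [:: [::]].

Lemma mem_subseqs (T : eqType) (s t : seq T) : (t \in subseqs s) = subseq t s.
Proof.
elim: s t => [|x s IH] [|y t]; rewrite ?inE//=.
  by rewrite mem_cat IH sub0seq orbT.
rewrite mem_cat IH; case: eqVneq => [->|yx].
  rewrite mem_map ?IH; last by move=> ? ? [].
  by apply/orP/idP => [[//|/cons_subseq]|->] //; left.
by case: mapP => [[z _ [xy]]|_] //; rewrite xy eqxx in yx.
Qed.

Definition faces (k : nat) (T : seq (seq nat)) : seq (seq nat) :=
  undup [seq t <- flatten (map (@subseqs nat) T) | size t == k.+1].

Lemma simplex_table_normal : all (fun u => normal_list 16 u == u) simplex_table.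
Proof.
by rewrite /simplex_table simplex_list1E simplex_list2E; vm_compute.
Qed.

Lemma simplex_table_uniq u : u \in simplex_table -> uniq u /\ all (fun i => i < 16)%N u.
Proof.
move=> uT; have /allP/(_ u uT)/eqP <- := simplex_table_normal.
split; first by rewrite filter_uniq ?iota_uniq.
by apply/allP => i; rewrite mem_filter mem_iota => /andP[_].
Qed.

(** Simplices are stored in increasing order, so subsets are subsequences, and a face shared by
    several simplices yields the same list each time. *)
Lemma fvec_K16 k : fvec K16 k = size (faces k simplex_table).
Proof.
have sub_uniq t u : u \in simplex_table -> subseq t u ->
    uniq t /\ all (fun i => i < 16)%N t.
  move=> /simplex_table_uniq[u_uniq /allP u16] tu; split; first exact: subseq_uniq tu _.
  by apply/allP => i it; apply: u16; exact: mem_subseq tu _ it.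
rewrite -(@card_ord_sets 16) ?undup_uniq//; last first.
  apply/allP => t; rewrite mem_undup mem_filter => /andP[_ /flattenP[_ /mapP[u uT ->]]].
  rewrite mem_subseqs => tu.
  have /allP/(_ u uT)/eqP uE := simplex_table_normal.
  rewrite -uE in tu; have : subseq t (iota 0 16).
    exact: subseq_trans tu (filter_subseq _ _).
  by move=> /(subseq_uniqP (iota_uniq _ _)) e; apply/eqP/esym.
congr #|pred_of_set _|; apply/setP => s; rewrite finset.in_set [RHS]finset.in_set.
apply/andP/mapP => [[/K16P[u uT /fintype.subsetP su] sk]|[t]].
  pose t := [seq i <- u | i \in map val (enum s)].
  have tu : subseq t u by exact: filter_subseq.
  have st : s = ord_set 16 t.
    apply/setP => i; rewrite [RHS]finset.in_set mem_filter (mem_map val_inj) mem_enum.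
    by case: (boolP (i \in s)) => //= /su; rewrite finset.in_set => ->.
  exists t => //; rewrite mem_undup mem_filter.
  have [t_uniq t16] := sub_uniq _ _ uT tu.
  rewrite -(card_ord_set_uniq t_uniq t16) -st sk /=.
  by apply/flattenP; exists (subseqs u); rewrite ?map_f ?mem_subseqs.
rewrite mem_undup mem_filter => /andP[tk /flattenP[_ /mapP[u uT ->]]].
rewrite mem_subseqs => tu ->; have [t_uniq t16] := sub_uniq _ _ uT tu.
rewrite (card_ord_set_uniq t_uniq t16) tk; split=> //; apply/K16P; exists u => //.
apply/fintype.subsetP => i; rewrite !finset.in_set.
exact: mem_subseq tu _.
Qed.

Lemma fvector_K16 : [seq fvec K16 k | k <- iota 0 5] = [:: 16; 120; 330; 375; 150]%N.
Proof.
rewrite (eq_map fvec_K16) /simplex_table simplex_list1E simplex_list2E.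
by vm_compute.
Qed.

(** * The polytope *)

Section Hyperplane.
Variable R : realType.
Implicit Types (x : 'rV[R]_6) (y : 'rV[R]_5).

(** A root of [5 * x ^+ 2 = 2 * x + 1]. For a vector of sum zero with last entry [a], adding
    [gam * a] to the other five entries changes their square norm by
    [(5 * gam ^+ 2 - 2 * gam) * a ^+ 2], which must equal the dropped [a ^+ 2]. *)
Let gam : R := (1 + Num.sqrt 6) / 5.

Lemma sqr_gam : 5 * gam ^+ 2 = 2 * gam + 1.
Proof.
have : Num.sqrt 6 ^+ 2 = 6 :> R by rewrite sqr_sqrtr.
by rewrite /gam; set s := Num.sqrt 6 => s2; field: s2.
Qed.

(* An isometry from the hyperplane of sum zero onto the 5-space. *)
Definition hproj x : 'rV[R]_5 :=
  \row_i (x 0 (widen_ord (leqnSn 5) i) + gam * x 0 ord_max).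

(** The entries of [hproj x] add up to [5 * gam - 1], that is the square root of 6, times the last
    entry of [x]; so [t] recovers that entry. *)
Definition hlift y : 'rV[R]_6 :=
  \row_i (let t := (\sum_j y 0 j) / Num.sqrt 6 in
    if unlift ord_max i is Some j then y 0 j - gam * t else t).

Lemma widen_lift (i : 'I_5) : widen_ord (leqnSn 5) i = lift ord_max i.
Proof. by apply: val_inj; rewrite /= /bump leqNgt ltn_ord. Qed.

Lemma dotv_hproj x x' : \sum_i x 0 i = 0 -> \sum_i x' 0 i = 0 ->
  dotv (hproj x) (hproj x') = dotv x x'.
Proof.
move=> x0 x'0; rewrite /dotv [RHS]big_ord_recr /=; under eq_bigr do rewrite !mxE.
set a := x 0 ord_max; set b := x' 0 ord_max.
pose X : R := \sum_(i < 5) x 0 (widen_ord (leqnSn 5) i).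
pose X' : R := \sum_(i < 5) x' 0 (widen_ord (leqnSn 5) i).
have xs : X + a = 0 by rewrite -x0 [RHS]big_ord_recr.
have xs' : X' + b = 0 by rewrite -x'0 [RHS]big_ord_recr.
transitivity (\sum_(i < 5) (x 0 (widen_ord (leqnSn 5) i) * x' 0 (widen_ord (leqnSn 5) i)
    + gam * b * x 0 (widen_ord (leqnSn 5) i)
    + gam * a * x' 0 (widen_ord (leqnSn 5) i) + gam ^+ 2 * a * b)).
  by apply: eq_bigr => i _; ring.
rewrite !big_split /= -!mulr_sumr -/X -/X' sumr_const card_ord.
have -> : X = - a by apply/eqP; rewrite -addr_eq0 xs.
have -> : X' = - b by apply/eqP; rewrite -addr_eq0 xs'.
rewrite -!addrA; congr (_ + _).
transitivity ((5 * gam ^+ 2) * (a * b) - 2 * gam * (a * b)); first by ring.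
by rewrite sqr_gam; ring.
Qed.

Lemma sum_hlift y : \sum_i hlift y 0 i = 0.
Proof.
rewrite big_ord_recr /= mxE unlift_none.
under eq_bigr do rewrite mxE widen_lift liftK.
rewrite big_split /= sumr_const card_ord.
set s := \sum_j y 0 j; have r0 : Num.sqrt 6 != 0 :> R by rewrite gt_eqF ?sqrtr_gt0.
by rewrite /gam; field.
Qed.

Lemma hliftK : cancel hlift hproj.
Proof.
move=> y; apply/rowP => i; rewrite !mxE unlift_none widen_lift liftK.
by rewrite subrK.
Qed.

Lemma hprojK x : \sum_i x 0 i = 0 -> hlift (hproj x) = x.
Proof.
move=> x0; have r0 : Num.sqrt 6 != 0 :> R by rewrite gt_eqF ?sqrtr_gt0.
have t : (\sum_j hproj x 0 j) / Num.sqrt 6 = x 0 ord_max.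
  under eq_bigr do rewrite mxE.
  move: x0; rewrite big_ord_recr big_split /= sumr_const card_ord.
  by move=> /eqP; rewrite addr_eq0 => /eqP->; rewrite /gam; field.
apply/rowP => i; rewrite mxE t; case: unliftP => [j ->|->//] /=.
by rewrite mxE widen_lift addrK.
Qed.

Lemma hproj_linear : linear hproj.
Proof. by move=> a x x'; apply/rowP => i; rewrite !mxE; ring. Qed.

Lemma hlift_linear : linear hlift.
Proof.
move=> a y y'; apply/rowP => i; rewrite !mxE.
under eq_bigr do rewrite !mxE.
by rewrite big_split /= -mulr_sumr; case: unliftP => [j _|_]; rewrite ?mxE; ring.
Qed.

Definition hsym (g : 'S_6) (e : bool) y : 'rV[R]_5 :=
  (-1) ^+ e *: hproj (\row_i hlift y 0 (g^-1%g i)).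

Lemma hsym_linear g e : linear (hsym g e).
Proof.
move=> a y y'; rewrite /hsym hlift_linear scalerA mulrC -scalerA -scalerDr.
by congr (_ *: _); rewrite -hproj_linear; congr hproj; apply/rowP => i; rewrite !mxE.
Qed.

Lemma enorm_hsym g e y : enorm (hsym g e y) = enorm y.
Proof.
rewrite /enorm /hsym dotvZl dotvZr mulrA -expr2 sqrr_sign mul1r -{3 4}[y]hliftK.
rewrite !dotv_hproj ?sum_hlift//; last 2 first.
- rewrite -[RHS](sum_hlift y) [RHS](reindex_inj (@perm_inj _ g^-1%g)).
  by apply: eq_bigr => i _; rewrite mxE.
- rewrite -[RHS](sum_hlift y) [RHS](reindex_inj (@perm_inj _ g^-1%g)).
  by apply: eq_bigr => i _; rewrite mxE.
congr Num.sqrt; rewrite /dotv [RHS](reindex_inj (@perm_inj _ g^-1%g)).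
by apply: eq_bigr => i _; rewrite !mxE.
Qed.

End Hyperplane.

(** * The 32 vertices and 300 functionals over Q(sqrt 5) *)

Section Polytope32.
Variable R : realType.

Let r5 : R := Num.sqrt 5.

Let r5_sqr : r5 ^+ 2 = 5. Proof. by rewrite sqr_sqrtr. Qed.

Let r5_gt0 : 0 < r5. Proof. by rewrite sqrtr_gt0. Qed.

Let r5_neq0 : r5 != 0. Proof. by rewrite gt_eqF. Qed.

Definition root5R (ab : root5) : R := ab.1%:~R + ab.2%:~R * r5.

Lemma root5R_neg ab : root5_neg ab -> root5R ab < 0.
Proof.
case: ab => a b /andP[/= ab1 ab2]; rewrite /root5R /=.
have lo : 11 / 5 <= r5 by rewrite -ler_sqr ?nnegrE ?r5_sqr ?ltW//; lra.
have hi : r5 <= 9 / 4 by rewrite -ler_sqr ?nnegrE ?r5_sqr ?ltW//; lra.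
have {}ab1 : 4 * a%:~R + 9 * b%:~R < 0 :> R.
  by rewrite -(ltr_int R) in ab1; rewrite !rmorphD !rmorphM /= in ab1.
have {}ab2 : 5 * a%:~R + 11 * b%:~R < 0 :> R.
  by rewrite -(ltr_int R) in ab2; rewrite !rmorphD !rmorphM /= in ab2.
(* The expression is linear in [r5]: the sign of [b] tells at which end of the enclosing interval it
   is largest. *)
have [b0|b0] := lerP 0 (b%:~R : R).
  have : b%:~R * r5 <= b%:~R * (9 / 4) by rewrite ler_wpM2l.
  lra.
have : b%:~R * r5 <= b%:~R * (11 / 5) by rewrite ler_wnM2l// ltW.
lra.
Qed.

Definition sgR (b : bool) : R := if b then 1 else -1.

Definition sgsum (k : nat) : R := \sum_(i < 6) sgR (vmem k i).

Definition vscale (k : nat) : R := if vcard k == 3%N then 1 else 3 / r5.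

Definition vec6 (k : nat) : 'rV[R]_6 :=
  \row_i (vscale k * (sgR (vmem k i) - sgsum k / 6)).

Lemma sum_vec6 k : \sum_i vec6 k 0 i = 0.
Proof.
under eq_bigr do rewrite mxE.
rewrite -mulr_sumr sumrB -/(sgsum k) sumr_const card_ord.
by rewrite -[_ *+ 6]mulr_natr divfK ?subrr ?mulr0.
Qed.

Definition functional6 (c : seq root5) : 'rV[R]_6 :=
  \row_i (root5R (nth (0, 0) c i) / 12).

Lemma foldr_sum (V : zmodType) (F : nat -> V) (s : seq nat) :
  foldr (fun x y => F x + y) 0 s = \sum_(x <- s) F x.
Proof. by elim: s => [|x s IH]; rewrite ?big_nil ?big_cons //= IH. Qed.

Lemma sum_iota (V : zmodType) (F : nat -> V) n :
  \sum_(x <- iota 0 n) F x = \sum_(i < n) F i.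
Proof. by rewrite -(big_mkord xpredT F) /index_iota subn0. Qed.

Lemma sum_functional6 c : c \in functionals -> \sum_i functional6 c 0 i = 0.
Proof.
move=> cF; have /allP/(_ c cF)/andP[] := functionals_sum0.
rewrite !foldr_sum !sum_iota => /eqP a0 /eqP b0.
under eq_bigr do rewrite mxE.
rewrite -mulr_suml big_split /= -mulr_suml.
have := congr1 (fun z : int => z%:~R : R) a0; rewrite rmorph_sum /= => ->.
have := congr1 (fun z : int => z%:~R : R) b0; rewrite rmorph_sum /= => ->.
by rewrite mul0r addr0 mul0r.
Qed.

Lemma vsumE c k : vsum c k =
  (\sum_(i < 6) if vmem k i then (nth (0, 0) c i).1 else 0,
   \sum_(i < 6) if vmem k i then (nth (0, 0) c i).2 else 0).
Proof.
rewrite /vsum -(sum_iota (fun i => if vmem k i then (nth (0, 0) c i).1 else 0)).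
rewrite -(sum_iota (fun i => if vmem k i then (nth (0, 0) c i).2 else 0)).
elim: (iota 0 6) => [|x s IH]; rewrite ?big_nil// !big_cons /= IH.
by case: ifP => _ //=; rewrite !add0r.
Qed.

(** A sign vector is twice an indicator minus a constant, and [functional6 c] is orthogonal to
    constants; the factor 1/6 is 2/12. *)
Lemma dotv_functional6 c k : c \in functionals ->
  dotv (functional6 c) (vec6 k) = vscale k / 6 * root5R (vsum c k).
Proof.
move=> cF; have c0 := sum_functional6 cF.
transitivity (vscale k * (2 * \sum_(i < 6)
    (if vmem k i then functional6 c 0 i else 0) -
    \sum_i functional6 c 0 i - sgsum k / 6 * \sum_i functional6 c 0 i)).
  rewrite mulr_sumr -sumrB mulr_sumr -sumrB mulr_sumr; apply: eq_bigr => i _.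
  by rewrite [vec6 k 0 i]mxE /sgR; case: ifP => _; ring.
rewrite c0 mulr0 !subr0 vsumE /root5R /= !rmorph_sum mulr_suml -big_split /=.
rewrite -mulrA; congr (_ * _); rewrite !mulr_sumr; apply: eq_bigr => i _.
by case: ifP => _; rewrite ?mxE /root5R; [field|rewrite !rmorph0; field].
Qed.

Lemma dotv_excess c k : c \in functionals -> dotv (functional6 c) (vec6 k) - 1 =
  root5R (excess c k) / (if vcard k == 3%N then 6 else 10).
Proof.
move=> cF; rewrite dotv_functional6// /excess /vscale.
case: (vsum c k) => a b; case: ifP => _; rewrite /root5R /=.
  by rewrite rmorphB /=; field.
rewrite rmorphB rmorphM /=.
have -> : 3 / r5 = 3 / 5 * r5 by rewrite -r5_sqr; field.
have -> : 3 / 5 * r5 / 6 * (a%:~R + b%:~R * r5) =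
    3 / 5 / 6 * (a%:~R * r5 + b%:~R * r5 ^+ 2) by ring.
by rewrite r5_sqr; field.
Qed.

Definition vtx (k : 'I_32) : 'rV[R]_5 := hproj (vec6 k).

Definition fnl (j : 'I_300) : 'rV[R]_5 := hproj (functional6 (nth [::] functionals j)).

Lemma mem_functionals (j : 'I_300) : nth [::] functionals j \in functionals.
Proof. by rewrite mem_nth// size_functionals. Qed.

Lemma dotv_fnl j k : dotv (fnl j) (vtx k) - 1 =
  root5R (excess (nth [::] functionals j) k) / (if vcard k == 3%N then 6 else 10).
Proof.
rewrite dotv_hproj ?sum_vec6 ?sum_functional6 ?mem_functionals//.
by rewrite dotv_excess ?mem_functionals.
Qed.

Lemma facet_fnl j : facet_of vtx fnl j = ord_set 32 (nth [::] facet_table j).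
Proof.
apply/setP => k; rewrite !finset.in_set -facet_listsE (nth_map [::]) ?size_functionals//.
rewrite mem_filter mem_iota leq0n add0n ltn_ord !andbT -subr_eq0 dotv_fnl.
have /allP/(_ _ (mem_functionals j)) T := functionals_excess.
have d0 : (if vcard k == 3%N then 6 else 10) != 0 :> R by case: ifP => _; rewrite pnatr_eq0.
have := all_iotaP T k; case: eqVneq => [->|_ /= /root5R_neg e0].
  by rewrite /root5R /= rmorph0 mul0r addr0 mul0r eqxx.
by rewrite mulf_eq0 invr_eq0 (negPf d0) orbF lt_eqF.
Qed.

Lemma size_facet_table : size facet_table = 300%N.
Proof. by rewrite -facet_listsE size_map size_functionals. Qed.

Lemma nth_facet_table (j : 'I_300) : nth [::] facet_table j \in facet_table.
Proof. by rewrite mem_nth// size_facet_table. Qed.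

Lemma facet_table_index F : F \in facet_table ->
  exists j : 'I_300, nth [::] facet_table j = F.
Proof.
move=> FT; have := FT; rewrite -index_mem size_facet_table => Fi.
by exists (Ordinal Fi); rewrite nth_index.
Qed.

Lemma polytope32_system : facet_system vtx fnl.
Proof.
split=> [j k|j|j k].
- rewrite -subr_le0 dotv_fnl.
  have /allP/(_ _ (mem_functionals j)) T := functionals_excess.
  have := all_iotaP T k; case: eqVneq => [-> _|_ /= /root5R_neg e0].
    by rewrite /root5R /= rmorph0 mul0r addr0 mul0r.
  by rewrite ltW// pmulr_llt0// invr_gt0; case: ifP.
- by rewrite facet_fnl card_facet_set ?nth_facet_table.
- rewrite !facet_fnl finset.in_set => kF.
  have /allP/(_ _ (nth_facet_table j))/allP/(_ _ kF)/hasP[F FT] := facet_table_ridge.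
  move=> /andP[kF' /allP sub]; have [j' j'F] := facet_table_index FT.
  exists j'; rewrite facet_fnl j'F; last by rewrite finset.in_set.
  apply/fintype.subsetP => l; rewrite finset.in_setD1 !finset.in_set => /andP[lk lF].
  by have := sub _ lF; rewrite -[val l == val k]/(l == k) (negPf lk).
Qed.

Lemma vec6_vact g e (k : 'I_32) (i : 'I_6) :
  vec6 (vact g e k) 0 i = (-1) ^+ e * vec6 k 0 (g^-1%g i).
Proof.
have sgE (j : 'I_6) : sgR (vmem (vact g e k) j) = (-1) ^+ e * sgR (vmem k (g^-1%g j)).
  rewrite -{1}[j](permKV g) vactE /sgR.
  by case: e; case: (vmem _ _); rewrite /= ?expr1 ?expr0; ring.
have sumE : sgsum (vact g e k) = (-1) ^+ e * sgsum k.
  rewrite /sgsum mulr_sumr [RHS](reindex_inj (@perm_inj _ g^-1%g)).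
  by apply: eq_bigr => j _.
(* In terms of the sign sum, having size 3 is visibly invariant under complementation, and hence so
   is the scale. *)
have card3 l : (vcard l == 3%N) = (sgsum l == 0).
  have -> : sgsum l = 2 * (vcard l)%:R - 6.
    have -> : vcard l = (\sum_(j < 6) vmem l j)%N.
      by rewrite !big_ord_recl big_ord0.
    rewrite natr_sum mulr_sumr /sgsum.
    have -> : 6 = \sum_(j < 6) 1 :> R by rewrite sumr_const card_ord.
    by rewrite -sumrB; apply: eq_bigr => j _; rewrite /sgR; case: (vmem _ _) => /=; ring.
  rewrite -(eqr_nat R); apply/eqP/eqP; lra.
rewrite !mxE sgE sumE.
have -> : vscale (vact g e k) = vscale k.
  by rewrite /vscale !card3 sumE mulf_eq0 signr_eq0.
by ring.
Qed.

Lemma vtx_vact g e k : vtx (vact g e k) = hsym g e (vtx k).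
Proof.
rewrite /hsym hprojK ?sum_vec6// /vtx.
have -> : vec6 (vact g e k) = (-1) ^+ e *: \row_i vec6 k 0 (g^-1%g i).
  by apply/rowP => i; rewrite vec6_vact [RHS]mxE [X in _ = _ * X]mxE.
move: (\row_i _) => x; apply/rowP => i; rewrite !mxE; ring.
Qed.

Lemma vtx_vopp k : vtx (vopp k) = - vtx k.
Proof.
rewrite /vopp vtx_vact /hsym hprojK ?sum_vec6// expr1 scaleN1r; congr (- hproj _).
by apply/rowP => i; rewrite mxE invg1 perm1.
Qed.

Lemma vgramE k l : dotv (vec6 k) (vec6 l) =
  vscale k * vscale l / 6 * (vgram k l)%:~R.
Proof.
have -> : (vgram k l)%:~R =
    6 * \sum_(i < 6) (sgR (vmem k i) * sgR (vmem l i)) - sgsum k * sgsum l :> R.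
  pose sg (b : bool) : int := if b then 1 else -1.
  have sgI (b : bool) : (sg b)%:~R = sgR b by case: b.
  rewrite /vgram -/sg !foldr_sum !sum_iota rmorphB !rmorphM /= !rmorph_sum /=.
  congr (_ * _ - _ * _); apply: eq_bigr => i _; rewrite ?rmorphM /= -/sg ?sgI//.
transitivity (\sum_(i < 6) (vscale k * vscale l * (sgR (vmem k i) * sgR (vmem l i)
   - sgsum k / 6 * sgR (vmem l i) - sgsum l / 6 * sgR (vmem k i)
   + sgsum k / 6 * (sgsum l / 6)))).
  by apply: eq_bigr => i _; rewrite !mxE; ring.
rewrite -mulr_sumr big_split !sumrB /= -!mulr_sumr -/(sgsum k) -/(sgsum l).
by rewrite sumr_const card_ord -mulr_natr; field.
Qed.

Lemma vscale_gt0 k : 0 < vscale k.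
Proof. by rewrite /vscale; case: ifP; rewrite ?divr_gt0. Qed.

Lemma dotv_vtx k l : dotv (vtx k) (vtx l) = vscale k * vscale l / 6 * (vgram k l)%:~R.
Proof. by rewrite dotv_hproj ?sum_vec6// vgramE. Qed.

Lemma vgram_diag : all (fun k => vgram k k == if vcard k == 3%N then 36 else 20)
  (iota 0 32).
Proof. by vm_compute. Qed.

(** The two cases are 36/6 and (9/5)(20/6); this common value gives the radius of the sphere. *)
Lemma dotv_vtx_diag k : dotv (vtx k) (vtx k) = 6.
Proof.
rewrite dotv_vtx; have /eqP-> := all_iotaP vgram_diag k; rewrite /vscale.
case: ifP => _; first by field.
have -> : 3 / r5 * (3 / r5) = 9 / r5 ^+ 2 by field.
by rewrite r5_sqr; field.
Qed.

Lemma facet_vtx_acute j k l : k \in facet_of vtx fnl j -> l \in facet_of vtx fnl j ->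
  0 < dotv (vtx k) (vtx l).
Proof.
rewrite facet_fnl !finset.in_set => kF lF.
have /allP/(_ _ (nth_facet_table j))/allP/(_ _ kF)/allP/(_ _ lF) := facet_table_acute.
by rewrite dotv_vtx pmulr_rgt0 ?ltr0z// divr_gt0// mulr_gt0 ?vscale_gt0.
Qed.

Lemma facet_complex_L32 : facet_complex vtx fnl = L32.
Proof.
apply/setP => s; apply/facet_complexP/L32P => [[j]|[F FT]].
  by rewrite facet_fnl; exists (nth [::] facet_table j); rewrite ?nth_facet_table.
by have [j <-] := facet_table_index FT; exists j; rewrite facet_fnl.
Qed.

Lemma facet_vtx_opp j : exists j', forall k,
  (k \in facet_of vtx fnl j') = (vopp k \in facet_of vtx fnl j).
Proof.
have /allP/(_ _ (nth_facet_table j))/hasP[F FT H] := facet_table_opp.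
have [j' j'F] := facet_table_index FT; exists j' => k.
rewrite !facet_fnl j'F !finset.in_set val_vopp.
by have /eqP := all_iotaP H k.
Qed.

Lemma vtx_covered k : exists j, k \in facet_of vtx fnl j.
Proof.
have /hasP[F FT kF] := all_iotaP facet_table_cover k.
have [j jF] := facet_table_index FT; exists j.
by rewrite facet_fnl jF finset.in_set.
Qed.

Lemma vperm_symmetry ge : exists2 f : 'rV[R]_5 -> 'rV[R]_5,
  euclidean_symmetry (facet_polytope vtx) f & forall i, f (vtx i) = vtx (vperm ge i).
Proof.
have fv (ge' : 'S_6 * 'Z_2) i : hsym ge'.1 (ge'.2 != 0) (vtx i) = vtx (vperm ge' i).
  by rewrite vpermE vtx_vact.
have fl (ge' : 'S_6 * 'Z_2) := @hsym_linear R ge'.1 (ge'.2 != 0).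
exists (hsym ge.1 (ge.2 != 0)); last exact: fv.
split=> [x y|].
  have -> : hsym ge.1 (ge.2 != 0) x - hsym ge.1 (ge.2 != 0) y
      = hsym ge.1 (ge.2 != 0) (x - y).
    have := fl ge (-1) y x; rewrite !scaleN1r ![- _ + _]addrC => ->.
    by [].
  exact: enorm_hsym.
apply: (facet_polytope_linear ord0 polytope32_system vtx_vopp (isT : 0 < 5)%N
  (fl ge) (fl ge^-1%g) (fv ge)) => i.
by rewrite fv (morphV vperm_morphism) ?finset.in_setT.
Qed.

End Polytope32.

Theorem theorem6p1 (R : realType) :
  [/\ triangulates R K16 (RP R 4),
      [/\ G16 \isog [set: 'S_6]%SET, #|G16| = 720%N
        & [set orbit 'P G16 x | x in [set: 'I_16]%SET]%SET
          = [set [set i : 'I_16 | (i < 10)%N]; [set i : 'I_16 | (10 <= i)%N]]%SET],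
      #|simplex_orbit simplex1| = 30%N /\ #|simplex_orbit simplex2| = 120%N,
      two_neighbourly K16 /\
        [seq fvec K16 k | k <- iota 0 5] = [:: 16; 120; 330; 375; 150]%N
    & exists (P : set 'rV[R]_5) (v : 'I_32 -> 'rV[R]_5),
        [/\ [/\ polytope P, affine_dimension P 5, spherical P
              & centrally_symmetric P],
            set_bij [set: 'I_32] (vertices P) v,
            exists (m : nat) (L : {set {set 'I_m}}) (p : 'I_m -> 'I_16),
              universal_covering R L K16 p /\
              complex_iso L (boundary_complex P v),
            aut_complex (boundary_complex P v) \isog [set: 'S_6 * 'Z_2]%SET
          & forall s : 'S_32, s \in aut_complex (boundary_complex P v) ->
              exists2 f : 'rV[R]_5 -> 'rV[R]_5, euclidean_symmetry P f
                & forall i, f (v i) = v (s i)]].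
Proof.
have sys := polytope32_system R; have vN := @vtx_vopp R.
have LE := facet_complex_L32 R; have cov := @vtx_covered R.
have bE : boundary_complex (facet_polytope (@vtx R)) (@vtx R) = L32.
  by rewrite (facet_boundary_complex sys ord0 vN) ?LE.
split.
- split; first exact: simplicial_complex_K16.
  have := quotient_homeomorphic_RP ord0 sys voppK vN (@facet_vtx_opp R)
    (@facet_vtx_acute R) vopp_neq projP.
  by rewrite LE -K16_proj.
- by split; [exact: G16_isog|exact: card_G16|exact: G16_orbits].
- exact: card_simplex_orbits.
- by split; [exact: two_neighbourly_K16|exact: fvector_K16].
exists (facet_polytope (@vtx R)), (@vtx R); split.
- split.
  + exact: facet_polytope_polytope.
  + exact: (facet_affine_dimension ord0 sys vN).
  + exists 0, (Num.sqrt 6); split; first exact: (centre_facet_polytope sys ord0 vN).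
      by rewrite sqrtr_gt0.
    move=> x xP; have [_ _ /(_ x xP)[i _ <-]] :=
      facet_polytope_vertices sys ord0 vN (isT : 0 < 5)%N cov.
    by rewrite subr0 /enorm dotv_vtx_diag.
  + exact: (facet_polytope_symmetric sys ord0 vN).
- exact: (facet_polytope_vertices sys ord0 vN).
- exists 32%N, L32, proj; split; last first.
    by rewrite bE; exists id => [|s]; [by exists id|rewrite imset_id].
  have := facet_universal_covering ord0 sys voppK vN (@facet_vtx_opp R)
    (@facet_vtx_acute R) vopp_neq projP (facet_simplicial_complex cov)
    (sphere_simply_connected R 2).
  by rewrite LE -K16_proj.
- by rewrite bE; exact: aut_L32_isog.
- move=> s; rewrite bE => /aut_L32_sub[ge ->]; exact: vperm_symmetry.
Qed.
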